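(* Let $m$ be a string transduction. Then $m\in\mathcal{NMSO}_{\mathrm{ed}}$ if and only if $m\in\bigcup_{k\ge1}\mathcal{NGSM}^k$ and $m$ is finitary.
   Context: A 2gsm is $M=(Q,\Sigma_1,\Sigma_2,\delta,q_{in},q_f)$ with finite state set $Q$ and instructions $(p,\sigma,q_1,\alpha_1,\epsilon_1,q_0,\alpha_0,\epsilon_0)$, $p\neq q_f$, $\sigma\in\Sigma_1\cup\{\vdash,\dashv\}$, $\alpha_i\in\Sigma_2^*$, $\epsilon_i\in\{-1,0,+1\}$. On input $w$ the read-only tape is $\vdash w\dashv$ (positions $0..|w|+1$); start in $q_{in}$ at position 0; in state $p$ any instruction starting with $p$ may be executed: if the scanned symbol is $\sigma$, go to $q_1$, append $\alpha_1$ to the one-way output tape and move by $\epsilon_1$, else do the same with $(q_0,\alpha_0,\epsilon_0)$; the head may not leave the tape. $M$ realizes the relation of all $(w,z)$ such that some computation reaches $q_f$ having written $z$. $\mathcal{NGSM}$ is the family of transductions realized by 2gsm's, and $\mathcal{NGSM}^k$ the family of compositions of $k$ of them (composition $R_1\circ R_2=\{(a,c)\mid\exists b:(a,b)\in R_1,(b,c)\in R_2\}$). A relation $m$ is finitary if $\{z\mid(w,z)\in m\}$ is finite for each $w$ in its domain. Graphs are $(V,E,\mathrm{lab})$ with $E\subseteq V\times\Gamma\times V$, $\mathrm{lab}:V\to\Sigma$; monadic second-order logic on graphs has node and node-set variables and atomic formulas $\mathrm{lab}_\sigma(x)$, $\mathrm{edge}_\gamma(x,y)$, $x=y$, $x\in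 X$. A nondeterministic mso definable graph transduction is given by a domain formula $\varphi_{\mathrm{dom}}$, a finite copy set $C$, node formulas $\varphi^c_\sigma(x)$ and edge formulas $\varphi^{c_1,c_2}_\gamma(x,y)$, with common free node-set variables (parameters); for each input $g$ and assignment of node sets to the parameters satisfying $\varphi_{\mathrm{dom}}$, the output has nodes $(u,c)$ for which exactly one $\sigma$ satisfies $\varphi^c_\sigma(u)$ (labelled $\sigma$) and edges $((u,c_1),\gamma,(v,c_2))$ between such nodes iff $\varphi^{c_1,c_2}_\gamma(u,v)$; the transduction is the relation of all such pairs. For $w$ of length $k$, $\mathrm{ed}(w)$ has $k+1$ unlabelled nodes forming a path whose edges are labelled by the letters of $w$; $\mathcal{NMSO}_{\mathrm{ed}}$ is the family of string transductions $m$ such that $\{(\mathrm{ed}(w),\mathrm{ed}(z))\mid(w,z)\in m\}$ is a nondeterministic mso definable graph transduction. *)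

(* Defs.v *)
From mathcomp Require Import all_boot.
Set Implicit Arguments. Unset Strict Implicit. Unset Printing Implicit Defensive.

Inductive tsym (A : Type) := LMark | RMark | Letter of A.
Arguments LMark {A}. Arguments RMark {A}.

Definition tsym_eqb (A : eqType) (s t : tsym A) : bool :=
  match s, t with
  | LMark, LMark => true
  | RMark, RMark => true
  | Letter a, Letter b => a == b
  | _, _ => false
  end.

Inductive hmove := MLeft | MStay | MRight.

Record instr (Q A B : Type) := Instr {
  i_p : Q; i_sym : tsym A;
  i_q1 : Q; i_a1 : seq B; i_e1 : hmove;
  i_q0 : Q; i_a0 : seq B; i_e0 : hmove }.

Record gsm2 (A B : Type) := Gsm2 {
  gQ : finType;
  gdelta : seq (instr gQ A B);
  gqin : gQ;
  gqf : gQ;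
  gdelta_wf : all (fun t => i_p t != gqf) gdelta }.

Fixpoint inlist (T : Type) (x : T) (s : seq T) : Prop :=
  if s is y :: s' then y = x \/ inlist x s' else False.

(* Symbol at position i of the tape |- w -| (positions 0 .. |w|+1). *)
Definition tape (A : Type) (w : seq A) (i : nat) : tsym A :=
  if i == 0 then LMark
  else if i <= size w then
    match drop i.-1 w with a :: _ => Letter a | [::] => RMark end
  else RMark.

Definition move_head (n i : nat) (e : hmove) : option nat :=
  match e with
  | MLeft => if i is i'.+1 then Some i' else None
  | MStay => Some i
  | MRight => if i.+1 <= n.+1 then Some i.+1 else None
  end.

Definition gstep (A : eqType) (B : Type) (M : gsm2 A B) (w : seq A)
    (c c' : gQ M * nat * seq B) : Prop :=
  let: (p, i, z) := c in
  let: (q', j, z') := c' in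
  exists2 t, inlist t (gdelta M) &
    [/\ i_p t = p &
      let: (q, a, e) :=
        if tsym_eqb (i_sym t) (tape w i) then (i_q1 t, i_a1 t, i_e1 t)
        else (i_q0 t, i_a0 t, i_e0 t) in
      [/\ q' = q, z' = z ++ a & move_head (size w) i e = Some j]].

Arguments gstep {A B} M w c c'.

Inductive star (T : Type) (R : T -> T -> Prop) : T -> T -> Prop :=
| star_refl x : star R x x
| star_step x y z : R x y -> star R y z -> star R x z.
Arguments star {T} R _ _.

Definition gsm_rel (A : eqType) (B : Type) (M : gsm2 A B) (w : seq A) (z : seq B)
  : Prop :=
  exists i, star (gstep M w) (gqin M, 0, [::]) (gqf M, i, z).

Inductive NGSMk : forall (A B : finType), nat -> (seq A -> seq B -> Prop) -> Prop :=
| NGSM_one (A B : finType) (M : gsm2 A B) (m : seq A -> seq B -> Prop) :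
    (forall w z, m w z <-> gsm_rel M w z) -> NGSMk 1 m
| NGSM_comp (A C B : finType) (k : nat) (M : gsm2 A C)
    (m' : seq C -> seq B -> Prop) (m : seq A -> seq B -> Prop) :
    NGSMk k m' ->
    (forall w z, m w z <-> exists y, gsm_rel M w y /\ m' y z) ->
    NGSMk k.+1 m.

Definition finitary (A : Type) (B : eqType) (m : seq A -> seq B -> Prop) : Prop :=
  forall w, exists s : seq (seq B), forall z, m w z -> z \in s.

Record graph (S G : Type) := Graph {
  gV : finType;
  gE : gV -> G -> gV -> bool;
  glab : gV -> S }.
Arguments gV {S G} g.
Arguments gE {S G} g _ _ _.
Arguments glab {S G} g _.

Definition giso (S : Type) (G : Type) (g h : graph S G) : Prop :=
  exists f : gV g -> gV h,
    [/\ bijective f,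
        forall v, glab h (f v) = glab g v &
        forall u c v, gE h (f u) c (f v) = gE g u c v].

Definition ed (A : eqType) (w : seq A) : graph unit A :=
  @Graph unit A ('I_(size w).+1 : finType)
    (fun i c j => (nat_of_ord j == (nat_of_ord i).+1) && (nth c w i == c))
    (fun _ => tt).

Inductive mso (S G : Type) :=
| FLab of S & nat
| FEdge of G & nat & nat
| FEq of nat & nat
| FIn of nat & nat
| FNot of mso S G
| FAnd of mso S G & mso S G
| FOr of mso S G & mso S G
| FEx1 of nat & mso S G
| FEx2 of nat & mso S G.

Fixpoint fvn (S G : Type) (f : mso S G) : seq nat :=
  match f with
  | FLab _ x => [:: x]
  | FEdge _ x y => [:: x; y]
  | FEq x y => [:: x; y]
  | FIn x _ => [:: x]
  | FNot f => fvn f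
  | FAnd f1 f2 | FOr f1 f2 => fvn f1 ++ fvn f2
  | FEx1 x f => [seq y <- fvn f | y != x]
  | FEx2 _ f => fvn f
  end.

Fixpoint fvs (S G : Type) (f : mso S G) : seq nat :=
  match f with
  | FIn _ X => [:: X]
  | FNot f => fvs f
  | FAnd f1 f2 | FOr f1 f2 => fvs f1 ++ fvs f2
  | FEx1 _ f => fvs f
  | FEx2 X f => [seq Y <- fvs f | Y != X]
  | _ => [::]
  end.

Definition upd (T : Type) (e : nat -> T) (x : nat) (a : T) : nat -> T :=
  fun y => if y == x then a else e y.

Fixpoint sat (S : eqType) (G : Type) (g : graph S G)
    (nu : nat -> option (gV g)) (mu : nat -> {set gV g}) (f : mso S G) : bool :=
  match f with
  | FLab s x => if nu x is Some v then glab g v == s else false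
  | FEdge c x y =>
      match nu x, nu y with Some u, Some v => gE g u c v | _, _ => false end
  | FEq x y =>
      match nu x, nu y with Some u, Some v => u == v | _, _ => false end
  | FIn x X => if nu x is Some v then v \in mu X else false
  | FNot f => ~~ sat nu mu f
  | FAnd f1 f2 => sat nu mu f1 && sat nu mu f2
  | FOr f1 f2 => sat nu mu f1 || sat nu mu f2
  | FEx1 x f => [exists v : gV g, sat (upd nu x (Some v)) mu f]
  | FEx2 X f => [exists A : {set gV g}, sat nu (upd mu X A) f]
  end.

(* A nondeterministic mso graph transduction: parameters are the set
   variables 0 .. npar-1; in node formulas x is node variable 0, in edge
   formulas (x, y) are node variables 0 and 1. *)
Record msot (S1 G1 S2 G2 : Type) := Msot {
  npar : nat;
  tC : finType;
  tdom : mso S1 G1;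
  tnode : tC -> S2 -> mso S1 G1;
  tedge : tC -> tC -> G2 -> mso S1 G1 }.
Arguments npar {S1 G1 S2 G2} m.
Arguments tC {S1 G1 S2 G2} m.
Arguments tdom {S1 G1 S2 G2} m.
Arguments tnode {S1 G1 S2 G2} m _ _.
Arguments tedge {S1 G1 S2 G2} m _ _ _.

Definition msot_wf (S1 G1 : Type) (S2 G2 : finType) (T : msot S1 G1 S2 G2) : Prop :=
  [/\ fvn (tdom T) = [::] /\ all (fun X => X < npar T) (fvs (tdom T)),
      forall c s, all (fun x => x == 0) (fvn (tnode T c s)) /\
                  all (fun X => X < npar T) (fvs (tnode T c s)) &
      forall c1 c2 e, all (fun x => x <= 1) (fvn (tedge T c1 c2 e)) /\
                  all (fun X => X < npar T) (fvs (tedge T c1 c2 e))].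

Definition penv (V : finType) (n : nat) (P : 'I_n -> {set V}) : nat -> {set V} :=
  fun i => odflt set0 (omap P (insub i)).

Definition nu1 (V : Type) (u : V) : nat -> option V :=
  fun i => if i == 0 then Some u else None.
Definition nu2 (V : Type) (u v : V) : nat -> option V :=
  fun i => if i == 0 then Some u else if i == 1 then Some v else None.

(* (g, h) is in the transduction defined by T: for some parameter assignment
   satisfying the domain formula, h is (isomorphic to) the output graph, whose
   nodes are the (u,c) with exactly one sigma satisfying phi^c_sigma(u),
   labelled by that sigma, with edges given by the edge formulas.  (Graph
   transductions are taken up to isomorphism of the output.) *)
Definition msot_rel (S1 : eqType) (G1 : Type) (S2 G2 : finType)
    (T : msot S1 G1 S2 G2) (g : graph S1 G1) (h : graph S2 G2) : Prop :=
  exists P : 'I_(npar T) -> {set gV g},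
    let mu := penv P in
    sat (fun _ => None) mu (tdom T) /\
    exists f : gV h -> (gV g * tC T)%type,
      [/\ injective f,
          forall u c, (exists v, f v = (u, c)) <->
                      #|[pred s : S2 | sat (nu1 u) mu (tnode T c s)]| = 1,
          forall v, sat (nu1 (f v).1) mu (tnode T (f v).2 (glab h v)) &
          forall v e v', gE h v e v' =
             sat (nu2 (f v).1 (f v').1) mu (tedge T (f v).2 (f v').2 e)].

Definition NMSO_ed (A B : finType) (m : seq A -> seq B -> Prop) : Prop :=
  exists T : msot unit A unit B, msot_wf T /\
    forall (g : graph unit A) (h : graph unit B),
      msot_rel T g h <-> exists w z, [/\ m w z, giso g (ed w) & giso h (ed z)].

(* Main.v *)
From HB Require Import structures.
Require Import Defs.
From mathcomp Require Import all_boot zify.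
From Stdlib Require Import FunctionalExtensionality.
Set Implicit Arguments. Unset Strict Implicit. Unset Printing Implicit Defensive.

(**
  The bridge between the two formalisms is a path transducer [ktr]: the input is covered by a
  tiling from a recognizable language, every tile carries finitely many copies of nodes with local
  forward and backward pointers, and the output is read along the single path which these
  pointers form.  Such transducers compose, because a recognizable condition on the word read
  along the path is a recognizable condition on the tiling, and they are definable in monadic
  second-order logic, the tiling being guessed by the parameters.

  A 2gsm whose runs visit each state at each position at most [n] times is a path transducer, a
  copy being a state together with the number of the visit.  If a composition [M; K] of a 2gsm and
  a path transducer is finite at [w], such a bound suffices: a run of [M] that visits some
  configuration too often has, by the pigeonhole principle, a loop that acts neutrally on the
  automata for the tilings of [K] and for the order of the nodes on the path.  If part of the
  output were read inside the loop, iterating it would give infinitely many outputs; otherwise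
  removing the loop does not change the output.  Words are padded with blanks so that a machine
  writes one symbol per step.

  Conversely, formulas become automata on words with marked positions.  A first 2gsm guesses the
  parameters and annotates every position with the state reached by the prefix and the transition
  function of the suffix.  These annotations let a second 2gsm recognize nodes and edges of the
  output graph by walking from one end of an edge to the other, so that it can follow the path.
*)

(** * Recognizable languages *)

(** The main obstacle is that only the composition is finitary: a machine inside it may have
    infinitely many outputs at an intermediate word, so visits cannot be bounded machine by machine.
    The induction therefore puts one machine in front of a path transducer for all the others, and
    asks of a loop only whether visible output is read inside it, however much the machine itself
    writes there. Finiteness is needed at one input word at a time, while the bound on visits
    depends only on the two devices, because it counts automaton states. The path of the second
    device may cross a loop many times, and removing the loop can connect its pieces in a new way.
    Hence paths are not compared as a whole: only the order of their visible nodes is, which an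
    automaton can read off a tiling with two marked nodes. The pigeonhole principle does not make a
    loop act as the identity on the states of this automaton; it gives a loop that acts trivially
    behind an earlier factor, and that earlier factor stays. In the converse direction definability
    itself guarantees that every output graph is a path, so the second 2gsm follows edges without
    testing the shape of the graph. *)

Record dfa (X : Type) := Dfa {
  dS : finType; d0 : dS; dstep : dS -> X -> dS; dacc : pred dS }.
Arguments d0 {X} d. Arguments dstep {X} d _ _. Arguments dacc {X} d _.

Definition drun (X : Type) (D : dfa X) (s : dS D) (w : seq X) : dS D :=
  foldl (dstep D) s w.
Definition dlang (X : Type) (D : dfa X) (w : seq X) : bool :=
  dacc D (drun (d0 D) w).

Lemma drun_cat (X : Type) (D : dfa X) s u v :
  drun (D := D) s (u ++ v) = drun (drun s u) v.
Proof. exact: foldl_cat. Qed.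

(** The automaton is kept as data, since formulas and machines are later built from it; [reflect]
    makes membership decidable, on which complement and union rest. *)
Definition recog (X : Type) (L : seq X -> Prop) : Type :=
  { D : dfa X & forall w, reflect (L w) (dlang D w) }.

Lemma recog_ext (X : Type) (L L' : seq X -> Prop) :
  (forall w, L w <-> L' w) -> recog L -> recog L'.
Proof.
move=> e [D h]; exists D => w.
by apply: (iffP (h w)) => /e.
Qed.

Lemma recog_not (X : Type) (L : seq X -> Prop) :
  recog L -> recog (fun w => ~ L w).
Proof.
case=> D h; exists (@Dfa X (dS D) (d0 D) (dstep D) (predC (dacc D))) => w.
rewrite /dlang /drun /=; apply: (iffP negP) => H; first by move=> /(h w).
by move=> /(h w).
Qed.

Lemma recog_and (X : Type) (L1 L2 : seq X -> Prop) :
  recog L1 -> recog L2 -> recog (fun w => L1 w /\ L2 w).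
Proof.
case=> D1 h1 [D2 h2].
pose D := @Dfa X (dS D1 * dS D2)%type (d0 D1, d0 D2)
  (fun s x => (dstep D1 s.1 x, dstep D2 s.2 x)) (fun s => dacc D1 s.1 && dacc D2 s.2).
exists D => w.
have E s : drun (D := D) s w = (drun s.1 w, drun s.2 w).
  by elim: w s => [|x w IH] [s1 s2] //=; rewrite IH.
rewrite /dlang E /=.
by apply: (iffP andP) => -[/h1 a /h2 b].
Qed.

Lemma recog_map (X Y : Type) (f : X -> Y) (L : seq Y -> Prop) :
  recog L -> recog (fun w => L (map f w)).
Proof.
case=> D h.
pose D' := @Dfa X (dS D) (d0 D) (fun s x => dstep D s (f x)) (dacc D).
exists D' => w.
have E s : drun (D := D') s w = drun (D := D) s (map f w).
  by elim: w s => [|x w IH] s //=; rewrite IH.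
by rewrite /dlang E; apply: h.
Qed.

(** One product automaton decides the whole family, only acceptance depending on the index. A single
    annotation of the input by its states can thus serve several languages. *)
Lemma recog_family (X : Type) (I : finType) (L : I -> seq X -> Prop) :
  (forall i, recog (L i)) ->
  { S : finType & { s0 : S & { step : S -> X -> S & { acc : I -> pred S &
    forall i w, reflect (L i w) (acc i (foldl step s0 w)) } } } }.
Proof.
move=> r; pose D i := projT1 (r i).
pose S : finType := {dffun forall i, dS (D i)}.
pose step (s : S) x : S := finfun (fun i => dstep (D i) (s i) x).
exists S, (finfun (fun i => d0 (D i)) : S), step, (fun i (s : S) => dacc (D i) (s i)).
move=> i w.
have E (s : S) : foldl step s w i = drun (s i) w.
  by elim: w s => [|x w IH] s //=; rewrite IH ffunE.
rewrite E ffunE; exact: (projT2 (r i)).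
Qed.

Lemma recog_or (X : Type) (L1 L2 : seq X -> Prop) :
  recog L1 -> recog L2 -> recog (fun w => L1 w \/ L2 w).
Proof.
move=> r1 r2.
apply: recog_ext (recog_not (recog_and (recog_not r1) (recog_not r2))) => w.
case: r1 r2 => D1 h1 [D2 h2].
by case: (h1 w); case: (h2 w); tauto.
Qed.

Lemma recog_exists (X : Type) (I : finType) (L : I -> seq X -> Prop) :
  (forall i, recog (L i)) -> recog (fun w => exists i, L i w).
Proof.
move=> /recog_family [S [s0 [step [acc h]]]].
exists (@Dfa X S s0 step (fun s => [exists i, acc i s])) => w.
apply: (iffP existsP) => -[i H]; exists i; first exact/(h i w).
exact/(h i w).
Qed.

Lemma recog_all (X : Type) (p : pred X) : recog (fun w => all p w).
Proof.
pose D := @Dfa X bool true (fun s x => s && p x) id.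
exists D => w.
have E s : drun (D := D) s w = s && all p w.
  by elim: w s => [|x w IH] s /=; rewrite ?andbT ?IH // andbA.
by rewrite /dlang E; apply: (iffP idP).
Qed.

Lemma recog_has (X : Type) (p : pred X) : recog (fun w => has p w).
Proof.
apply: recog_ext (recog_not (recog_all (predC p))) => w.
by rewrite all_predC; split=> [/negP/negPn | H] //; apply/negP/negPn.
Qed.

(** Subset construction. All certificates below, such as separating sets, runs read along a path or
    tilings, are guessed as a second track through it. *)
Lemma recog_proj (X : Type) (Y : finType) (L : seq (X * Y) -> Prop) :
  recog L -> recog (fun w => exists2 r : seq Y, size r = size w & L (zip w r)).
Proof.
case=> D h.
pose D' := @Dfa X {set dS D} [set d0 D]
  (fun s x => [set q | [exists p in s, [exists y, q == dstep D p (x, y)]]])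
  (fun s => [exists q in s, dacc D q]).
exists D' => w.
have E (s : {set dS D}) q : (q \in drun (D := D') s w) <->
   exists2 r : seq Y, size r = size w & exists2 p, p \in s & q = drun p (zip w r).
  elim: w s q => [|x w IH] s q /=.
    split=> [qs | [[|//] _ [p ps ->]]] //.
    by exists [::] => //; exists q.
  split.
  - move/IH; case=> r sr [p]; rewrite inE => /existsP [p' /andP [p's /existsP [y /eqP ->]]] ->.
    by exists (y :: r); [rewrite /= sr | exists p'].
  - case=> -[//|y r] /= [sr] [p ps ->]; apply/IH.
    exists r => //; exists (dstep D p (x, y)) => //.
    rewrite inE; apply/existsP; exists p; rewrite ps /=.
    by apply/existsP; exists y.
apply: (iffP existsP).
- case=> q /andP [/E [r sr [p]]]; rewrite inE => /eqP -> -> a.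
  by exists r => //; apply/h.
- case=> r sr /h a; exists (drun (d0 D) (zip w r)); rewrite [X in _ && X]a andbT.
  by apply/E; exists r => //; exists (d0 D); rewrite ?inE.
Qed.

(* Cells carry 1-based indices here, so that the neighbours of the cell with
   0-based index i are [cell w i], [cell w i.+1], [cell w i.+2]. *)
Definition cell (X : Type) (w : seq X) (k : nat) : option X :=
  if k is i.+1 then onth w i else None.

Definition nbr (X : Type) (Q : option X -> option X -> option X -> bool) (w : seq X) :=
  forall i, i < size w -> Q (cell w i) (cell w i.+1) (cell w i.+2).

(** The automaton lags one cell behind: a cell is tested when its right neighbour is read, and the
    last cell on acceptance. *)
Lemma recog_nbr (X : finType) Q : recog (@nbr X Q).
Proof.
pose D := @Dfa X (option X * option X * bool)%type (None, None, true)
  (fun s x => (s.1.2, Some x, s.2 && (s.1.2 ==> Q s.1.1 s.1.2 (Some x))))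
  (fun s => s.2 && (s.1.2 ==> Q s.1.1 s.1.2 None)).
exists D => w.
(* [p1] is the cell just before [w], whose test is pending: this is the middle conjunct. It is also
   the left neighbour of the first cell of [w]. *)
have E : forall w p2 p1 b, dacc D (drun (D := D) (p2, p1, b) w) =
   b && (p1 ==> Q p2 p1 (onth w 0)) &&
   [forall i : 'I_(size w), Q (if i : nat is i'.+1 then cell w i else p1)
       (cell w i.+1) (cell w i.+2)].
  elim=> [|x {}w IH] p2 p1 b.
    by rewrite /= -[LHS]andbT; congr andb; symmetry; apply/forallP; case.
  transitivity (dacc D (drun (D := D) (p1, Some x, b && (p1 ==> Q p2 p1 (Some x))) w)).
    by [].
  rewrite IH /= -!andbA; congr (_ && (_ && _)).
  apply/andP/forallP => [[h0 /forallP h] [[|i] Hi] //=|h].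
    by have /= := h (Ordinal (Hi : i < size w)); case: i {h} Hi.
  split; first exact: (h ord0).
  apply/forallP => -[i Hi]; have /= := h (Ordinal (Hi : i.+1 < (size w).+1)).
  by case: i Hi.
rewrite /dlang E /=; apply: (iffP forallP) => [h i Hi | h [i Hi]].
  by have := h (Ordinal Hi); case: i Hi.
by have := h i Hi; case: i Hi.
Qed.

(** * Head moves and positions in sequences *)

Arguments onth {T} s n : simpl nomatch.

Definition hmove_encode (e : hmove) : option bool :=
  match e with MLeft => Some false | MStay => None | MRight => Some true end.
Definition hmove_decode (o : option bool) : hmove :=
  match o with Some false => MLeft | None => MStay | Some true => MRight end.
Lemma hmove_encodeK : cancel hmove_encode hmove_decode. Proof. by case. Qed.
HB.instance Definition _ := Finite.copy hmove (can_type hmove_encodeK).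

(** Shifted by one to stay within the natural numbers: [i + hcode d] is the target position plus
    one, and 0 stands for a move off the left end. *)
Definition hcode (e : hmove) : nat :=
  match e with MLeft => 0 | MStay => 1 | MRight => 2 end.
Definition hopp (e : hmove) : hmove :=
  match e with MLeft => MRight | MStay => MStay | MRight => MLeft end.
Definition pick3 (X : Type) (e : hmove) (l m r : X) : X :=
  match e with MLeft => l | MStay => m | MRight => r end.

Lemma pick3_cell (X : Type) e (t : seq X) i :
  pick3 e (cell t i) (cell t i.+1) (cell t i.+2) = cell t (i + hcode e).
Proof. by case: e; rewrite /= ?addn0 ?addn1 ?addn2. Qed.

Lemma onth_lt (X : Type) (s : seq X) i x : onth s i = Some x -> i < size s.
Proof. by rewrite -onthTE => ->. Qed.

Lemma ltn_onth (X : Type) (s : seq X) i : i < size s -> exists x, onth s i = Some x.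
Proof. by rewrite -onthTE; case: (onth s i) => // x _; exists x. Qed.

Lemma onth_eq_inj (X : eqType) (s : seq X) a b n :
  uniq s -> onth s a = Some n -> onth s b = Some n -> a = b.
Proof.
move=> u ha hb; apply: (onth_inj _ _ _ u); last by rewrite ha hb.
by rewrite gtn_min (onth_lt ha) orbT.
Qed.

Lemma onth_inj_uniq (X : eqType) (s : seq X) :
  (forall a b n, onth s a = Some n -> onth s b = Some n -> a = b) -> uniq s.
Proof.
elim: s => [|x s IH] //= h; apply/andP; split; last first.
  by apply: IH => a b n ha hb; apply: succn_inj; apply: (h a.+1 b.+1 n).
by apply/onthP => -[i hi]; have := h 0 i.+1 x erefl hi.
Qed.

Lemma onth_zip (X Y : Type) (s : seq X) (r : seq Y) i : size r = size s ->
  onth (zip s r) i = if onth s i is Some x then omap (pair x) (onth r i) else None.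
Proof. by elim: s r i => [|x s IH] [|y r] [|i] //= [/IH ->]. Qed.

Lemma onth_mkseq (X : Type) (f : nat -> X) n i :
  onth (mkseq f n) i = if i < n then Some (f i) else None.
Proof.
rewrite /mkseq onth_map; case: ltnP => h.
  have /ltn_onth [j hj] : i < size (iota 0 n) by rewrite size_iota.
  by have := onth_nth 0 _ _ _ hj; rewrite nth_iota // hj add0n => <-.
by rewrite onth_default // size_iota.
Qed.

(** * Paths in tilings *)

(* Copy [c] of a cell with tile [a] is a node iff [pres a c]; [ptr true] and [ptr false] are its
   links to the next and to the previous node, which lie on an adjacent cell or the same one. *)
Record pgs (T C : finType) := Pgs {
  pres : T -> C -> bool;
  ptr : bool -> T -> C -> option (hmove * C) }.

Section PathGraph.
Variables (T C : finType) (G : pgs T C).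
Implicit Types (t : seq T) (n : nat * C) (p : seq (nat * C)).

Definition npres t n : bool := if onth t n.1 is Some a then pres G a n.2 else false.

(* Pointer targets are kept in the raw form (position + 1, copy), so that a
   move to the left of position 0 is not confused with an absent pointer. *)
Definition raw n : nat * C := (n.1.+1, n.2).
Definition nptr b t n : option (nat * C) :=
  if onth t n.1 is Some a then
    omap (fun x => (n.1 + hcode x.1, x.2)) (ptr G b a n.2)
  else None.

(** The third clause leaves no node outside [p], so a path accompanied by closed cycles of pointers
    does not qualify. *)
Definition ispath t p :=
  [/\ p <> [::], uniq p, forall n, (n \in p) = npres t n &
      forall l n, onth p l = Some n ->
        nptr true t n = omap raw (onth p l.+1) /\
        nptr false t n = omap raw (cell p l)].

Lemma raw_inj : injective raw.
Proof. by case=> i c [j d] [-> ->]. Qed.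

Lemma path_onth_pres t p l n : ispath t p -> onth p l = Some n -> npres t n.
Proof. by case=> _ _ h _ e; rewrite -h; apply/onthP; exists l. Qed.

(** The head of a path is the only node without a backward pointer, so both paths start at the same
    node; forward pointers determine the rest. *)
Lemma path_uniq t p p' : ispath t p -> ispath t p' -> p = p'.
Proof.
move=> hp hp'; apply: eq_from_onth; elim=> [|l IH].
  case: (hp) => p0 _ m h; case: p p0 m h hp => [//|n p] _ m h hp.
  have : n \in p' by case: hp' => _ _ -> _; rewrite -m mem_head.
  case/onthP => a ha; have [_] := h 0 n erefl.
  case: (hp') => _ _ _ /(_ _ _ ha) [_ ->] /=.
  case: a ha => [<- //|a ha] /=.
  by have [x ->] := ltn_onth (ltnW (onth_lt ha)).
case e: (onth p l) IH => [n|] IH.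
  case: hp => _ _ _ /(_ _ _ e) [+ _]; case: hp' => _ _ _ /(_ _ _ (esym IH)) [-> _].
  case: (onth p l.+1) (onth p' l.+1) => [x|] [y|] //= [e1 e2].
  by congr Some; apply: raw_inj; rewrite /raw e1 e2.
have e' s : onth s l = None -> onth s l.+1 = None :> option (nat * C).
  move=> h; apply: onth_default; rewrite leqW //.
  by rewrite -onthNE h.
by rewrite !e'.
Qed.

Definition consistent t := forall b n q, npres t n -> nptr b t n = Some q ->
  exists m, [/\ q = raw m, npres t m & nptr (~~ b) t m = Some (raw n)].

Definition consq (l m r : option T) : bool :=
  if m is Some a then
    [forall b, forall c, pres G a c ==>
      if ptr G b a c is Some (d, c') then
        if pick3 d l m r is Some a' then
          pres G a' c' && (ptr G (~~ b) a' c' == Some (hopp d, c))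
        else false
      else true]
  else true.

Lemma consistentP t : nbr consq t <-> consistent t.
Proof.
split=> [h b [i c] q|h i Hi].
  rewrite /npres /nptr /=; case e: (onth t i) => [a|] // pa.
  case e2: (ptr G b a c) => [[d c']|] //= [<-].
  have := h i (onth_lt e); rewrite /consq /= e => /forallP /(_ b) /forallP /(_ c).
  rewrite pa e2 /= -[Some a]e -/(cell t i.+1).
  have -> := pick3_cell d t i.
  case j: (i + hcode d) => [|k] //=.
  case e3: (onth t k) => [a'|] // /andP [p' /eqP n'].
  exists (k, c'); rewrite /raw /= e3; split => //=.
  by rewrite n' /=; congr (Some (_, _)); case: (d) j => /=; lia.
rewrite /consq /=; have [a e] := ltn_onth Hi; rewrite e.
apply/forallP => b; apply/forallP => c; apply/implyP => pa.
case e2: (ptr G b a c) => [[d c']|] //=.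
have := h b (i, c) (i + hcode d, c').
rewrite /npres /nptr /= e e2 /= => /(_ pa erefl) [[k c2]] [[jk <-]] /=.
rewrite -[Some a]e -/(cell t i.+1).
have -> := pick3_cell d t i.
rewrite jk /=; case: (onth t k) => [a'|] // p'.
case: (ptr G (~~ b) a' c') => [[d' c3]|] //= [jk' ->]; rewrite p' /=.
by apply/eqP; congr (Some (_, _)); case: (d) (d') jk jk' => -[] //=; lia.
Qed.

Section Annotation.
Variables (Y : finType) (Q : T -> Y -> C -> bool)
  (R : bool -> T -> Y -> C -> T -> Y -> C -> bool).

(** [Q] constrains a single node, [R] a node together with the target of one of its pointers. One
    letter of [r] serves all copies on a cell, hence letters are typically sets of copies or
    functions on copies. *)
Definition annotates t (r : seq Y) :=
  forall i a y c, onth t i = Some a -> onth r i = Some y -> pres G a c ->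
    Q a y c /\
    forall b d c' j a' y', ptr G b a c = Some (d, c') -> i + hcode d = j.+1 ->
      onth t j = Some a' -> onth r j = Some y' -> R b a y c a' y' c'.

Definition annq (l m r : option (T * Y)) : bool :=
  if m is Some (a, y) then
    [forall c, pres G a c ==> Q a y c && [forall b,
      if ptr G b a c is Some (d, c') then
        if pick3 d l m r is Some (a', y') then R b a y c a' y' c' else true
      else true]]
  else true.

Lemma annotatesP t (r : seq Y) : size r = size t -> nbr annq (zip t r) <-> annotates t r.
Proof.
move=> sr; split=> [h i a y c ha hy pa|h i].
  have hz: onth (zip t r) i = Some (a, y) by rewrite onth_zip // ha hy.
  have := h i (onth_lt hz); rewrite /annq /= hz => /forallP /(_ c).
  rewrite pa /= => /andP [-> /forallP hb]; split=> // b d c' j a' y' e1 e2 ea ey.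
  have := hb b; rewrite e1 -[Some (a, y)]hz -/(cell _ i.+1).
  by have -> := pick3_cell d (zip t r) i; rewrite e2 /= onth_zip // ea ey.
move=> Hi; rewrite /annq /=; have [[a y] e] := ltn_onth Hi; rewrite e.
have [ha hy] : onth t i = Some a /\ onth r i = Some y.
  move: e; rewrite onth_zip //; case: (onth t i) (onth r i) => [x|] [z|] //=.
  by case=> -> ->.
apply/forallP => c; apply/implyP => pa; have [-> hb] := h _ _ _ _ ha hy pa.
apply/forallP => b; case e2: (ptr G b a c) => [[d c']|] //.
rewrite -[Some (a, y)]e -/(cell _ i.+1); have -> := pick3_cell d (zip t r) i.
case j: (i + hcode d) => [|k] //=; rewrite onth_zip //.
case ea: (onth t k) => [a'|] //; case ey: (onth r k) => [y'|] //=.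
exact: (hb b d c' k).
Qed.

End Annotation.

Lemma recog_consistent : recog consistent.
Proof. exact: recog_ext consistentP (recog_nbr consq). Qed.

Definition inset (r : seq {set C}) n : bool :=
  if onth r n.1 is Some A then n.2 \in A else false.

Definition setword (P : pred (nat * C)) k : seq {set C} :=
  mkseq (fun i => [set c | P (i, c)]) k.

Definition has_start t := has (fun a => [exists c, pres G a c && (ptr G false a c == None)]) t.

(* With consistent pointers, a start node and no set separating the nodes, there is no closed
   cycle beside the path. *)
Definition separated t := exists2 r : seq {set C}, size r = size t &
  annotates (fun _ _ _ => true) (fun _ _ (A : {set C}) c _ A' c' => (c \in A) == (c' \in A')) t r /\
  has (fun x : T * {set C} => [exists c, pres G x.1 c && (c \in x.2)]) (zip t r) /\
  has (fun x : T * {set C} => [exists c, pres G x.1 c && (c \notin x.2)]) (zip t r).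

Lemma annotates_setwordP t (P : pred (nat * C))
    (Q : T -> {set C} -> C -> bool)
    (R : bool -> T -> {set C} -> C -> T -> {set C} -> C -> bool) :
  (forall i a c, onth t i = Some a -> pres G a c -> Q a [set c | P (i, c)] c) ->
  (forall b i j a a' c c', npres t (i, c) -> nptr b t (i, c) = Some (raw (j, c')) ->
     onth t i = Some a -> onth t j = Some a' ->
     R b a [set c | P (i, c)] c a' [set c | P (j, c)] c') ->
  annotates Q R t (setword P (size t)).
Proof.
move=> hQ hR i a y c e; rewrite onth_mkseq (onth_lt e) => -[<-] pa; split.
  exact: hQ.
move=> b d c' j a' y' e1 e2 e'; rewrite onth_mkseq (onth_lt e') => -[<-].
by apply: hR => //; rewrite /npres /nptr /= ?e //= e1 /= e2.
Qed.

Lemma has_setword t (P : pred (nat * C)) (h : pred (T * {set C})) i a :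
  onth t i = Some a -> h (a, [set c | P (i, c)]) ->
  has h (zip t (setword P (size t))).
Proof.
move=> e H; apply/hasP; exists (a, [set c | P (i, c)]) => //.
by apply/onthP; exists i; rewrite onth_zip ?size_mkseq // e onth_mkseq (onth_lt e).
Qed.

Lemma has_onth (X : Type) (h : pred X) s : has h s <-> exists i x, onth s i = Some x /\ h x.
Proof.
split; last first.
  by case=> i [x []]; elim: s i => [|y s IH] [|i] //= => [[->] ->|/IH h1 /h1 ->] //; rewrite orbT.
elim: s => [|y s IH] //= /orP [hy|/IH [i [x hx]]]; first by exists 0, y.
by exists i.+1, x.
Qed.

Lemma npresE t i c : npres t (i, c) <-> exists2 a, onth t i = Some a & pres G a c.
Proof.
rewrite /npres /=; case: (onth t i) => [a|]; first by split=> [h|[_ [<-]]] //; exists a.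
by split=> [|[]].
Qed.

Lemma path_consistent t p : ispath t p -> consistent t.
Proof.
move=> [p0 u m h] b n q; rewrite -m => /onthP [l hl]; have [h1 h2] := h _ _ hl.
case: b; rewrite ?h1 ?h2 => hq.
  case e: (onth p l.+1) hq => [n'|] //= [<-]; exists n'; split=> //.
    by rewrite -m; apply/onthP; exists l.+1.
  by have [_ ->] := h _ _ e; rewrite /= hl.
case: l hl h1 h2 hq => [|l] hl h1 h2 //=.
case e: (onth p l) => [n'|] //= [<-]; exists n'; split=> //.
  by rewrite -m; apply/onthP; exists l.
by have [-> _] := h _ _ e; rewrite hl.
Qed.

Lemma path_has_start t p : ispath t p -> has_start t.
Proof.
case=> p0 u m h; case: p p0 u m h => [//|[i c] p] _ u m h.
have : npres t (i, c) by rewrite -m mem_head.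
case/npresE => a e pa; apply/has_onth; exists i, a; split=> //.
apply/existsP; exists c; rewrite pa /=; have [_] := h 0 _ erefl.
by rewrite /nptr /= e; case: (ptr G false a c).
Qed.

(** Membership in the guessed set does not change along pointers, hence is constant on the path, and
    both witnesses lie on the path. *)
Lemma path_not_separated t p : ispath t p -> ~ separated t.
Proof.
move=> hp [r sr [/= ann [/has_onth [i [[a A] [e1 /existsP [c /andP /= [pc cA]]]]] hin]]].
move: hin => /has_onth [i' [[a' A'] [e2]]] /=.
move=> /existsP [c' /andP [pc' cA']].
have inv x y z : onth (zip t r) x = Some (y, z) -> onth t x = Some y /\ onth r x = Some z.
  by rewrite onth_zip //; case: (onth t x) (onth r x) => [?|] [?|] //= [-> ->].
move: e1 e2 => /inv [ea eA] /inv [ea' eA'].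
case: (hp) => p0 u m h.
have [n0 hn0] : exists n0, onth p 0 = Some n0 by case: (p) p0 => // n0 p' _; exists n0.
have key l n : onth p l = Some n -> inset r n = inset r n0.
  elim: l n => [|l IH] [j d] hl; first by move: hl; rewrite hn0 => -[->].
  have [[j1 d1] hl1] := ltn_onth (ltnW (onth_lt hl)).
  rewrite -(IH _ hl1); have [+ _] := h _ _ hl1; rewrite hl /=.
  have : npres t (j, d) by rewrite -m; apply/onthP; exists l.+1.
  have : npres t (j1, d1) by rewrite -m; apply/onthP; exists l.
  move=> /npresE [b1 e1 pb1] /npresE [b e pb].
  have [B eB] : exists B, onth r j = Some B by apply: ltn_onth; rewrite sr (onth_lt e).
  have [B1 eB1] : exists B, onth r j1 = Some B by apply: ltn_onth; rewrite sr (onth_lt e1).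
  rewrite /nptr /= e1 /inset /= eB eB1.
  case e3: (ptr G true b1 d1) => [[mv d2]|] //= [ej ed].
  rewrite {}ed in e3.
  have [_ /(_ _ _ _ _ _ _ e3 ej e eB) /eqP ->] := ann _ _ _ _ e1 eB1 pb1.
  by [].
have : (i, c) \in p by rewrite m; apply/npresE; exists a.
have : (i', c') \in p by rewrite m; apply/npresE; exists a'.
move=> /onthP [l' hl'] /onthP [l hl].
have := key _ _ hl; rewrite -(key _ _ hl') /inset /= eA eA' cA.
by rewrite (negbTE cA').
Qed.

Definition chain t n0 p := onth p 0 = Some n0 /\
  forall l n, onth p l = Some n ->
    [/\ npres t n, nptr false t n = omap raw (cell p l) &
        forall n', onth p l.+1 = Some n' -> nptr true t n = Some (raw n')].

(** Backward pointers lead two occurrences of one node back in parallel until one of them reaches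
    the start, which has no predecessor; so they sit at the same index. *)
Lemma chain_uniq t n0 p : chain t n0 p -> uniq p.
Proof.
case=> h0 h; apply: onth_inj_uniq.
suff key a b n : a <= b -> onth p a = Some n -> onth p b = Some n -> a = b.
  move=> a b n ha hb; case: (leqP a b) => [/key|/ltnW /key] k; first exact: k ha hb.
  by symmetry; apply: k hb ha.
elim: a b n => [|a IH] [|b] n //=.
  move=> _ ha hb; have [_ e _] := h _ _ ha; have [_ + _] := h _ _ hb.
  by rewrite e /=; have [x ->] := ltn_onth (ltnW (onth_lt hb)).
move=> ab ha hb; have [_ e _] := h _ _ ha; have [_ + _] := h _ _ hb.
rewrite e /=; have [x hx] := ltn_onth (ltnW (onth_lt hb)).
have [y hy] := ltn_onth (ltnW (onth_lt ha)).
by rewrite hx hy /= => -[e1 e2]; congr S; apply: (IH b x) => //; rewrite hy;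
   congr Some; apply: raw_inj; rewrite /raw e1 e2.
Qed.

Lemma chain_size t n0 p : chain t n0 p -> size p <= size t * #|C|.
Proof.
move=> hc; have u := chain_uniq hc.
have -> : size t * #|C| = size (allpairs pair (iota 0 (size t)) (enum C)).
  by rewrite size_allpairs size_iota cardE.
apply: uniq_leq_size => // -[i c] /onthP [l hl].
have [pn _ _] := hc.2 _ _ hl; move/npresE: pn => [a e _].
by apply: allpairs_f; rewrite ?mem_enum // mem_iota (onth_lt e).
Qed.

(** By consistency a forward pointer always leads to a node that extends the chain; as chains have
    no repetitions, this stops after at most [size t * #|C|] nodes. *)
Lemma chain_complete t n0 p : consistent t -> chain t n0 p ->
  exists2 p', chain t n0 p' & forall l n, onth p' l = Some n -> onth p' l.+1 = None ->
    nptr true t n = None.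
Proof.
move=> ct; have [k] := ubnP (size t * #|C| - size p); elim: k p => // k IH p Hk hc.
have [n hn] : exists n, onth p (size p).-1 = Some n.
  apply: ltn_onth; case: (p) hc => [|x s] [] //=; by rewrite ltnS.
have sp : (size p).-1.+1 = size p by case: (p) hn.
case e: (nptr true t n) => [q|]; last first.
  exists p => // l n' hl /eqP; rewrite -[_ == _]negbK.
  case: (ltnP l.+1 (size p)) => [/ltn_onth [x ->] //|h] _.
  have : l = (size p).-1 by have := onth_lt hl; lia.
  by move=> el; move: hl; rewrite el hn => -[<-].
have [pn pf _] := hc.2 _ _ hn; have [m [eq pm pm']] := ct _ _ _ pn e.
have hc' : chain t n0 (rcons p m).
  split; first by rewrite -cats1 onth_cat; case: (p) hc => [|x s] [].
  move=> l n'; rewrite -cats1 !onth_cat; case: ltnP => hl hl'.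
    have [a1 a2 a3] := hc.2 _ _ hl'; split=> //.
      by rewrite a2; case: (l) hl => [|l'] //= hl; rewrite onth_cat (ltnW hl).
    move=> n''; case: ltnP => hl2; first exact: a3.
    have el : l = (size p).-1 by lia.
    move: hl'; rewrite el hn => -[<-].
    by rewrite sp subnn /= => -[<-]; rewrite e eq.
  have el : l = size p.
    by have := onth_lt hl'; rewrite /=; lia.
  move: hl'; rewrite el subnn /= => -[<-]; split=> //.
    by rewrite pm' -sp /= onth_cat sp leqnn hn.
  by move=> n''; rewrite ltnNge leqnSn /= subSnn.
apply: (IH (rcons p m)) => //.
have := chain_size hc'; rewrite size_rcons; lia.
Qed.

(** The maximal chain from a start node is closed under pointers in both directions, so a node
    missed by it would be separated from it. *)
Lemma path_exists t : consistent t -> has_start t -> ~ separated t -> exists p, ispath t p.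
Proof.
move=> ct /has_onth [i [a [ea /existsP [c /andP [pa /eqP ps]]]]] sep.
have hn0 : npres t (i, c) by apply/npresE; exists a.
have hf0 : nptr false t (i, c) = None by rewrite /nptr /= ea ps.
have [|p hp last] := @chain_complete t (i, c) [:: (i, c)] ct.
  by split=> // -[|[|l]] n //= [<-].
have nx l n : onth p l = Some n -> nptr true t n = omap raw (onth p l.+1).
  move=> hl; case e: (onth p l.+1) => [n'|]; last exact: last e.
  by have [_ _ /(_ _ e) ->] := hp.2 _ _ hl.
have inp n : n \in p -> npres t n by move=> /onthP [l /hp.2 []].
exists p; split.
- by move=> p0; case: hp; rewrite p0.
- exact: chain_uniq hp.
- move=> n; apply/idP/idP; first exact: inp.
  case: n => i' c' pn; apply/negPn/negP => np; apply: sep.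
  exists (setword (mem p) (size t)); first by rewrite size_mkseq.
  split; [|split].
  + apply: annotates_setwordP => // b j j' b1 b2 d d' pj nj _ _; rewrite !inE.
    apply/eqP; have [m [/raw_inj em pm]] := ct _ _ _ pj nj; rewrite -{}em in pm *.
    move=> nj'; apply/idP/idP => /= /onthP [l hl].
    * case: b nj {nj'} => nj.
        apply/onthP; exists l.+1; move: nj; rewrite (nx _ _ hl).
        by case: (onth p l.+1) => [x|] //= [e1 e2]; congr Some; apply: raw_inj; rewrite /raw e1 e2.
      have [_ e _] := hp.2 _ _ hl; move: e; rewrite nj; case: l hl => [|l] hl //= e.
      apply/onthP; exists l; move: e.
      by case: (onth p l) => [x|] //= [e1 e2]; congr Some; apply: raw_inj; rewrite /raw e1 e2.
    * case: b nj' {nj} => nj; last first.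
        apply/onthP; exists l.+1; move: nj; rewrite (nx _ _ hl).
        by case: (onth p l.+1) => [x|] //= [e1 e2]; congr Some; apply: raw_inj; rewrite /raw e1 e2.
      have [_ e _] := hp.2 _ _ hl; move: e; rewrite nj; case: l hl => [|l] hl //= e.
      apply/onthP; exists l; move: e.
      by case: (onth p l) => [x|] //= [e1 e2]; congr Some; apply: raw_inj; rewrite /raw e1 e2.
  + apply: has_setword ea _ => /=; apply/existsP; exists c; rewrite pa inE /=.
    by apply/onthP; exists 0; case: hp.
  + move/npresE: pn => [a' ea' pa']; apply: has_setword ea' _ => /=.
    by apply/existsP; exists c'; rewrite pa' inE.
- by move=> l n hl; split; [apply: nx | have [_ ->] := hp.2 _ _ hl].
Qed.

Lemma recog_annotates (Y : finType) Q R :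
  recog (fun w : seq (T * Y) => annotates Q R (unzip1 w) (unzip2 w)).
Proof.
apply: recog_ext (recog_nbr (annq Q R)) => w.
by rewrite -annotatesP ?size_map // zip_unzip.
Qed.

Definition single_path t := exists p, ispath t p.

Lemma recog_single_path : recog single_path.
Proof.
have rs : recog separated.
  apply: recog_ext (recog_proj (recog_and (recog_annotates
     (fun _ _ _ => true) (fun _ _ (A : {set C}) c _ A' c' => (c \in A) == (c' \in A')))
     (recog_and
       (recog_has (fun x : T * {set C} => [exists c, pres G x.1 c && (c \in x.2)]))
       (recog_has (fun x : T * {set C} => [exists c, pres G x.1 c && (c \notin x.2)])))))
    => t.
  by split=> -[r sr h]; exists r => //; move: h; rewrite unzip1_zip ?unzip2_zip ?sr.
apply: recog_ext (recog_and recog_consistent (recog_and (recog_has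
  (fun a => [exists c, pres G a c && (ptr G false a c == None)])) (recog_not rs))) => t.
split=> [[a [b c]]|[p hp]]; first exact: path_exists.
by split; [apply: path_consistent hp | split; [apply: path_has_start hp |
   apply: path_not_separated hp]].
Qed.

End PathGraph.

Lemma onth_index (X : eqType) (s : seq X) l x : uniq s -> onth s l = Some x -> index x s = l.
Proof.
move=> u e; apply: (onth_eq_inj u _ e).
have hx : x \in s by apply/onthP; exists l.
elim: s {u e} hx => //= y s IH; rewrite inE eq_sym.
by case: eqP => [-> //|_] /=; apply: IH.
Qed.

Lemma index_onth (X : eqType) (s : seq X) x : x \in s -> onth s (index x s) = Some x.
Proof.
elim: s => //= y s IH; rewrite inE eq_sym.
by case: eqP => [-> //|_] /=; apply: IH.
Qed.

Lemma take_onth (X : Type) (s : seq X) l x : onth s l = Some x -> take l.+1 s = rcons (take l s) x.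
Proof.
elim: s l => [|y s IH] [|l] //=; first by case=> ->; rewrite take0.
by move=> /IH ->.
Qed.

Lemma map_eq_onth (X Y : Type) (f : X -> option Y) s (y : seq Y) l x :
  map f s = map Some y -> onth s l = Some x -> f x = onth y l.
Proof.
move=> e h; have := congr1 (fun z => onth z l) e; rewrite !onth_map h /=.
by case: (onth y l) => [z|] //= [].
Qed.

(** * Recognizable conditions on the word read along the path *)

Section Pull.
Variables (T C : finType) (G : pgs T C) (Y : Type) (lab : T -> C -> Y).
Implicit Types (t : seq T) (p : seq (nat * C)).

Definition olab t (n : nat * C) : option Y :=
  if onth t n.1 is Some a then Some (lab a n.2) else None.

Lemma path_labels t p : ispath G t p -> exists y, map (olab t) p = map Some y.
Proof.
case=> _ _ m _; have : forall n, n \in p -> npres G t n by move=> n; rewrite m.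
elim: p {m} => [|n p IH] h; first by exists [::].
have [|y hy] := IH; first by move=> n' hn; apply: h; rewrite inE hn orbT.
have := h n (mem_head _ _); rewrite /npres.
case e: (onth t n.1) => [a|] // _; exists (lab a n.2 :: y).
by rewrite /= hy /olab e.
Qed.

Definition pulled (L : seq Y -> Prop) t :=
  exists p y, [/\ ispath G t p, map (olab t) p = map Some y & L y].

Lemma annotates_mkseq (Y' : finType) t (f : nat -> Y')
    (Q : T -> Y' -> C -> bool) (R : bool -> T -> Y' -> C -> T -> Y' -> C -> bool) :
  (forall i a c, onth t i = Some a -> pres G a c -> Q a (f i) c) ->
  (forall b i j a a' c c', npres G t (i, c) -> nptr G b t (i, c) = Some (raw (j, c')) ->
     onth t i = Some a -> onth t j = Some a' -> R b a (f i) c a' (f j) c') ->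
  annotates G Q R t (mkseq f (size t)).
Proof.
move=> hQ hR i a y c e; rewrite onth_mkseq (onth_lt e) => -[<-] pa; split.
  exact: hQ.
move=> b d c' j a' y' e1 e2 e'; rewrite onth_mkseq (onth_lt e') => -[<-].
by apply: hR => //; rewrite /npres /nptr /= ?e //= e1 /= e2.
Qed.

(** The path may cross a cell many times and in both directions, so an automaton cannot follow it.
    Instead the state of [D] before each node is guessed, one state per copy of a cell; start,
    transition and acceptance are then conditions along pointers. *)
Lemma recog_pulled (L : seq Y -> Prop) : recog L -> recog (pulled L).
Proof.
case=> D hD.
pose Q (a : T) (r : {ffun C -> dS D}) (c : C) :=
  ((ptr G false a c == None) ==> (r c == d0 D)) &&
  ((ptr G true a c == None) ==> dacc D (dstep D (r c) (lab a c))).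
pose R (b : bool) (a : T) (r : {ffun C -> dS D}) (c : C) (a' : T) (r' : {ffun C -> dS D}) (c' : C) :=
  b ==> (r' c' == dstep D (r c) (lab a c)).
apply: recog_ext (recog_and (recog_single_path G) (recog_proj (recog_annotates G Q R))) => t.
have sy p y : map (olab t) p = map Some y -> size y = size p.
  by move=> /(congr1 size); rewrite !size_map.
have ly p y l i c a : map (olab t) p = map Some y -> onth p l = Some (i, c) ->
    onth t i = Some a -> onth y l = Some (lab a c).
  by move=> e /(map_eq_onth e) <-; rewrite /olab /= => ->.
split.
- case=> -[p hp] [r sr]; rewrite unzip1_zip ?unzip2_zip ?sr // => ann.
  have [y hy] := path_labels hp; exists p, y; split=> //; apply/hD.
  have key l i c s : onth p l = Some (i, c) -> onth r i = Some s ->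
      s c = drun (d0 D) (take l y).
    elim: l i c s => [|l IH] i c s hl hs.
      have pn := path_onth_pres hp hl; case/npresE: pn => a ea pa.
      have [/andP [/implyP h _] _] := ann _ _ _ _ ea hs pa.
      rewrite take0 /=; apply/eqP/h; case: hp => _ _ _ /(_ _ _ hl) [_].
      by rewrite /nptr /= ea; case: (ptr G false a c).
    have [[i' c'] hl'] := ltn_onth (ltnW (onth_lt hl)).
    have /npresE [a ea pa] := path_onth_pres hp hl.
    have /npresE [a' ea' pa'] := path_onth_pres hp hl'.
    have [s' hs'] : exists s', onth r i' = Some s'.
      by apply: ltn_onth; rewrite sr (onth_lt ea').
    rewrite (take_onth (ly _ _ _ _ _ _ hy hl' ea')) -cats1 drun_cat -(IH _ _ _ hl' hs') /=.
    have [_ h] := ann _ _ _ _ ea' hs' pa'.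
    case: (hp) => _ _ _ /(_ _ _ hl') [+ _].
    rewrite /nptr /= ea' hl /=; case e: (ptr G true a' c') => [[d c2]|] //= [e1 e2].
    by rewrite {}e2 in e; have /eqP := h _ _ _ _ _ _ e e1 ea hs.
  have [[i c] hl] : exists n, onth p (size p).-1 = Some n.
    apply: ltn_onth; case: (p) hp => [|x s] [] //=; by rewrite ltnS.
  have /npresE [a ea pa] := path_onth_pres hp hl.
  have [s hs] : exists s', onth r i = Some s' by apply: ltn_onth; rewrite sr (onth_lt ea).
  have [/andP [_ /implyP h] _] := ann _ _ _ _ ea hs pa.
  have p0 : 0 < size p by case: (p) hp => [|? ?] [].
  have -> : y = take (size p).-1.+1 y by rewrite prednK // take_oversize // (sy _ _ hy).
  rewrite (take_onth (ly _ _ _ _ _ _ hy hl ea)) /dlang -cats1 drun_cat -(key _ _ _ _ hl hs) /=.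
  apply: h; case: (hp) => _ _ _ /(_ _ _ hl) [+ _].
  by rewrite /nptr /= ea prednK // onth_default //; case: (ptr G true a c).
- case=> p [y [hp hy /hD Ly]]; split; first by exists p.
  (* A copy that is not a node has index [size p] and gets the state after all of [y]; [annotates]
     constrains present copies only. *)
  exists (mkseq (fun i => [ffun c => drun (d0 D) (take (index (i, c) p) y)]) (size t)).
    by rewrite size_mkseq.
  rewrite unzip1_zip ?unzip2_zip ?size_mkseq //.
  case: (hp) => p0 u m h; apply: annotates_mkseq.
  + move=> i a c ea pa; rewrite /Q ffunE.
    have : (i, c) \in p by rewrite m; apply/npresE; exists a.
    case/onthP=> l hl; have [h1 h2] := h _ _ hl; rewrite (onth_index u hl).
    apply/andP; split; apply/implyP => /eqP e.
      move: h2; rewrite /nptr /= ea e /=; case: l hl {h1} => [|l] hl; first by rewrite take0.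
      by have [x /= ->] := ltn_onth (ltnW (onth_lt hl)).
    move: h1; rewrite /nptr /= ea e /= => h1.
    have : size p <= l.+1 by rewrite -onthNE; case: (onth p l.+1) h1.
    move=> sl; have ty : take l.+1 y = y by rewrite take_oversize // (sy _ _ hy).
    move: Ly; rewrite /dlang -{1}ty.
    by rewrite (take_onth (ly _ _ _ _ _ _ hy hl ea)) -cats1 drun_cat.
  + move=> b i j a a' c c' pn np ea ea'; apply/implyP => -[]; rewrite !ffunE.
    have : (i, c) \in p by rewrite m.
    case/onthP=> l hl; have [h1 _] := h _ _ hl; rewrite (onth_index u hl).
    move: h1; case: b np => // -> h1.
    have hl' : onth p l.+1 = Some (j, c').
      by case: (onth p l.+1) h1 => [x|] //= [e1 e2]; congr Some; apply: raw_inj; rewrite /raw e1 e2.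
    by rewrite (onth_index u hl') (take_onth (ly _ _ _ _ _ _ hy hl ea)) -cats1 drun_cat.
Qed.

End Pull.

(** * Path transducers *)

(** Nondeterminism lies in the choice of the tiling alone: by [path_uniq] a tiling determines the
    path, and so the output. *)
Record ktr (X Y : finType) := Ktr {
  kT : finType; kC : finType;
  kG : pgs kT kC;
  ksym : kT -> X;
  klab : kT -> kC -> Y;
  kL : seq kT -> Prop;
  krec : recog kL }.

Definition kt_rel (X Y : finType) (K : ktr X Y) (x : seq X) (y : seq Y) :=
  exists t p, [/\ kL (k := K) t, map (ksym (k := K)) t = x, ispath (kG K) t p &
    map (olab (klab (k := K)) t) p = map Some y].

(** * Composition of path transducers *)

Section Compose.
Variables (X Y Z : finType) (K1 : ktr X Y) (K2 : ktr Y Z).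

(** Each copy on a tile of [K1] writes one letter of the intermediate word, so it carries the tile
    which [K2] lays on that letter. *)
Definition compT : finType := (kT K1 * {ffun kC K1 -> kT K2})%type.
Definition compC : finType := (kC K1 * kC K2)%type.

(** Neighbouring letters of the intermediate word are neighbours on the path of [K1]: a move of [K2]
    to the right or left becomes one forward or backward pointer of [K1], which again reaches at
    most an adjacent cell. *)
Definition comp_ptr b (a : compT) (c : compC) : option (hmove * compC) :=
  match ptr (kG K2) b (a.2 c.1) c.2 with
  | Some (MStay, c2) => Some (MStay, (c.1, c2))
  | Some (MRight, c2) => omap (fun x => (x.1, (x.2, c2))) (ptr (kG K1) true a.1 c.1)
  | Some (MLeft, c2) => omap (fun x => (x.1, (x.2, c2))) (ptr (kG K1) false a.1 c.1)
  | None => None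
  end.

Definition compG : pgs compT compC :=
  Pgs (fun (a : compT) (c : compC) => pres (kG K1) a.1 c.1 && pres (kG K2) (a.2 c.1) c.2) comp_ptr.

Definition outerG : pgs compT (kC K1) :=
  Pgs (fun (a : compT) c => pres (kG K1) a.1 c) (fun b a c => ptr (kG K1) b a.1 c).

(** That [K2] has a single path is demanded here, as a condition read along the path of [K1]; so it
    need not be reconstructed from a path of [compG]. *)
Definition compL (t : seq compT) :=
  kL (k := K1) (unzip1 t) /\
  (all (fun a : compT => [forall c, pres (kG K1) a.1 c ==> (ksym (a.2 c) == klab a.1 c)]) t /\
  pulled outerG (fun (a : compT) c => a.2 c)
    (fun t2 => kL (k := K2) t2 /\ single_path (kG K2) t2) t).

Lemma recog_compL : recog compL.
Proof.
apply: recog_and; first exact: (recog_map _ (krec K1)).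
apply: recog_and; first exact: recog_all.
exact: recog_pulled (recog_and (krec K2) (recog_single_path _)).
Qed.

Definition kcomp : ktr X Z :=
  @Ktr X Z compT compC compG (fun a : compT => ksym a.1)
    (fun (a : compT) (c : compC) => klab (a.2 c.1) c.2)
    compL recog_compL.

Lemma outer_path t p : ispath outerG t p <-> ispath (kG K1) (unzip1 t) p.
Proof.
have e1 n : npres outerG t n = npres (kG K1) (unzip1 t) n.
  by rewrite /npres onth_map; case: (onth t n.1).
have e2 b n : nptr outerG b t n = nptr (kG K1) b (unzip1 t) n.
  by rewrite /nptr onth_map; case: (onth t n.1).
by split=> -[h1 h2 h3 h4]; split=> // [n|l n /h4]; rewrite -?h3 -?e1 ?e2 ?h3 //;
   rewrite ?e1 -?h3 -?e2 ?h3.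
Qed.

Section Lift.
Variables (t : seq compT) (p1 : seq (nat * kC K1)) (t2 : seq (kT K2)) (p2 : seq (nat * kC K2)).
Variable n0 : nat * kC K1.
Hypotheses (hp1 : ispath outerG t p1)
  (ht2 : map (olab (fun (a : compT) c => a.2 c) t) p1 = map Some t2)
  (hp2 : ispath (kG K2) t2 p2).

Let sz : size t2 = size p1.
Proof. by move/(congr1 size): ht2; rewrite !size_map. Qed.

Definition lift (n : nat * kC K2) : nat * compC :=
  let n1 := nth n0 p1 n.1 in (n1.1, (n1.2, n.2)).

Lemma node_data j : j < size p1 -> exists i c a,
  [/\ onth p1 j = Some (i, c), nth n0 p1 j = (i, c), onth t i = Some a,
      pres (kG K1) a.1 c & onth t2 j = Some (a.2 c)].
Proof.
move=> /ltn_onth [[i c] hj]; have /npresE [a ea pa] := path_onth_pres hp1 hj.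
exists i, c, a; split=> //; first exact: onth_nth hj.
by rewrite -(map_eq_onth ht2 hj) /olab /= ea.
Qed.

Lemma lift_ptr b j c2 q : npres (kG K2) t2 (j, c2) ->
  (forall n, q = Some n -> npres (kG K2) t2 n) ->
  nptr (kG K2) b t2 (j, c2) = omap (@raw _) q ->
  nptr compG b t (lift (j, c2)) = omap (@raw _) (omap lift q).
Proof.
move=> /npresE [a2 e2 pa2] hq.
have [i [c1 [a [hj hn ea pa et2]]]] : exists i c a,
  [/\ onth p1 j = Some (i, c), nth n0 p1 j = (i, c), onth t i = Some a,
      pres (kG K1) a.1 c & onth t2 j = Some (a.2 c)].
  by apply: node_data; rewrite -sz (onth_lt e2).
case: (hp1) => _ _ _ /(_ _ _ hj) [].
rewrite /lift /nptr /= hn /= ea et2 /= /comp_ptr /=.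
case e: (ptr (kG K2) b (a.2 c1) c2) => [[d c2']|] /=; last by case: q hq.
move=> h1 h2; case: q hq => [[j' c3]|] //= /(_ _ erefl) /npresE [a3 e3 pa3] [ej <-].
have [i' [c1' [a' [hj' hn' ea' pa' et2']]]] : exists i c a,
  [/\ onth p1 j' = Some (i, c), nth n0 p1 j' = (i, c), onth t i = Some a,
      pres (kG K1) a.1 c & onth t2 j' = Some (a.2 c)].
  by apply: node_data; rewrite -sz (onth_lt e3).
rewrite /= hn' /=; case: d e ej => /= e ej.
- have jj : j = j'.+1 by lia.
  move: h2; rewrite jj /= hj' /=.
  by case: (ptr _ false _ _) => [[d c]|] //= [-> ->].
- have jj : j = j' by lia.
  by move: hj'; rewrite -jj hj => -[<- <-]; rewrite addn1.
- have jj : j' = j.+1 by lia.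
  move: h1; rewrite -jj hj' /=.
  by case: (ptr _ true _ _) => [[d c]|] //= [-> ->].
Qed.

Lemma lift_path : ispath compG t (map lift p2).
Proof.
case: (hp2) => p20 u2 m2 h2; case: (hp1) => p10 u1 m1 h1.
have lt2 j c : (j, c) \in p2 -> j < size p1.
  by rewrite m2 => /npresE [a e _]; rewrite -sz (onth_lt e).
split.
- by case: (p2) p20.
- rewrite map_inj_in_uniq // => -[j c] [j' c'] /lt2 hj /lt2 hj' [e1 e2 ->].
  have e : nth n0 p1 j = nth n0 p1 j' by apply: injective_projections.
  by congr (_, _); apply/eqP; rewrite -(nth_uniq n0 hj hj' u1) e.
- move=> [i [c1 c2]]; apply/idP/idP.
  + case/mapP => -[j c] hj [-> -> ->].
    have [i' [c1' [a [e1 e2 ea pa e3]]]] := node_data (lt2 _ _ hj).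
    rewrite /npres /= e2 /= ea pa /=; move: hj; rewrite m2 => /npresE [a2].
    by rewrite e3 => -[->].
  + case/npresE=> a ea /= /andP [pa pc].
    have : (i, c1) \in p1 by rewrite m1; apply/npresE; exists a.
    case/onthP => j hj; have [i' [c1' [a' [e1 e2 ea' pa' e3]]]] := node_data (onth_lt hj).
    move: e1; rewrite hj => -[ei ec]; subst i' c1'.
    move: ea'; rewrite ea => -[ea']; subst a'.
    apply/mapP; exists (j, c2); last by rewrite /lift /= e2.
    by rewrite m2; apply/npresE; exists (a.2 c1).
- move=> l n; rewrite onth_map; case e: (onth p2 l) => [[j c2]|] //= [<-].
  have hin l' n' : onth p2 l' = Some n' -> npres (kG K2) t2 n'.
    by move=> ?; rewrite -m2; apply/onthP; exists l'.
  have [h3 h4] := h2 _ _ e; split.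
  + by rewrite onth_map; apply: lift_ptr => //; [apply: hin e | move=> n' /hin].
  + have -> : cell (map lift p2) l = omap lift (cell p2 l) by case: (l) => //= l'; rewrite onth_map.
    apply: lift_ptr => //; first by apply: hin e.
    by move=> n'; case: (l) => //= l' /hin.
Qed.

Lemma lift_labels : map (olab (fun (a : compT) (c : compC) => klab (a.2 c.1) c.2) t) (map lift p2) =
  map (olab (klab (k := K2)) t2) p2.
Proof.
rewrite -map_comp; apply/eq_in_map => -[j c] hj.
case: (hp2) => _ _ m2 _; move: hj; rewrite m2 => /npresE [a2 e2 _].
have [|i [c1 [a [e1 e3 ea pa e4]]]] := @node_data j; first by rewrite -sz (onth_lt e2).
by rewrite /olab /= e3 /= ea e4.
Qed.

End Lift.

(** The path of [K2], lifted to the nodes of [K1], is a path of the composite tiling, and by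
    [path_uniq] the only one. Conversely, the tiles of [K2] are distributed over the nodes of [K1]
    by their index on the path. *)
Lemma kcompP x z : kt_rel kcomp x z <-> exists2 y, kt_rel K1 x y & kt_rel K2 y z.
Proof.
split.
- case=> t [p [[L1 [hall [p1 [t2 [hp1 ht2 [L2 [p2 hp2]]]]]]] hx hp hz]].
  have [y hy] := path_labels (klab (k := K1)) ((outer_path t p1).1 hp1).
  exists y.
    exists (unzip1 t), p1; split=> //; last exact/outer_path.
    by rewrite -hx -map_comp.
  exists t2, p2; split=> //; last first.
    have n0 : nat * kC K1 by case: (p1) hp1 => [|n ?] [].
    have hl := lift_path n0 hp1 ht2 hp2.
    by rewrite -(lift_labels n0 hp1 ht2 hp2) -hz (path_uniq hp hl).
  apply: eq_from_onth => j; rewrite onth_map.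
  case e: (onth t2 j) => [a2|] /=; last first.
    symmetry; apply: onth_default; move/(congr1 size): hy; rewrite !size_map => <-.
    move/(congr1 size): ht2; rewrite !size_map => ->.
    by rewrite -onthNE e.
  have : j < size p1.
    by move/(congr1 size): ht2; rewrite !size_map => ->; apply: onth_lt e.
  case/ltn_onth => -[i c] hj; rewrite -(map_eq_onth hy hj) /olab /= onth_map.
  have := map_eq_onth ht2 hj; rewrite /olab /= e.
  have /npresE [a ea pa] := path_onth_pres hp1 hj; rewrite ea /= => -[<-].
  have : a \in t by apply/onthP; exists i.
  by move/(allP hall) => /forallP /(_ c) /implyP /(_ pa) /eqP ->.
- case=> y [t1 [p1 [L1 hx hp1 hy]]] [t2 [p2 [L2 hy2 hp2 hz]]].
  have s12 : size t2 = size p1.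
    move/(congr1 size): hy; rewrite !size_map => ->.
    by move/(congr1 size): hy2; rewrite !size_map => ->.
  have a0 : kT K2.
    by case: (p1) (t2) hp1 s12 => [|n ?] [|a ?] [].
  (* Copies that are not nodes have index [size p1], which is [size t2], and receive the default
     tile. *)
  pose f i := [ffun c => nth a0 t2 (index (i, c) p1)].
  pose t : seq compT := zip t1 (mkseq f (size t1)).
  have ut : unzip1 t = t1 by rewrite unzip1_zip ?size_mkseq.
  have et i a : onth t1 i = Some a -> onth t i = Some (a, f i).
    by move=> e; rewrite onth_zip ?size_mkseq // e onth_mkseq (onth_lt e).
  have hp1' : ispath outerG t p1 by apply/outer_path; rewrite ut.
  case: (hp1) => _ u1 m1 _.
  have ht2 : map (olab (fun (a : compT) c => a.2 c) t) p1 = map Some t2.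
    apply: eq_from_onth => j; rewrite !onth_map.
    case e: (onth p1 j) => [[i c]|] /=; last first.
      by rewrite [onth t2 j]onth_default // s12 -onthNE e.
    have /npresE [a ea pa] := path_onth_pres hp1 e.
    rewrite /olab /= (et _ _ ea) /= /f ffunE (onth_index u1 e).
    have /ltn_onth [b hb] : j < size t2 by rewrite s12 (onth_lt e).
    by rewrite hb (onth_nth _ _ _ _ hb).
  have n0 : nat * kC K1 by case: (p1) hp1 => [|n ?] [].
  have hl := lift_path n0 hp1' ht2 hp2.
  exists t, (map (lift p1 n0) p2); split=> //; last first.
  + by rewrite (lift_labels n0 hp1' ht2 hp2).
  + by rewrite -hx -[in RHS]ut -map_comp.
  split; first by rewrite ut.
  split; last by exists p1, t2; split=> //; split=> //; exists p2.
  apply/allP => -[a fa] /onthP [i]; rewrite onth_zip ?size_mkseq //.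
  case ea: (onth t1 i) => [a'|] //; rewrite onth_mkseq (onth_lt ea) /= => -[<- <-].
  apply/forallP => c; apply/implyP => pa; rewrite ffunE.
  have hin : (i, c) \in p1 by rewrite m1; apply/npresE; exists a'.
  have hj := index_onth hin.
  have /ltn_onth [b hb] : index (i, c) p1 < size t2 by rewrite s12 (onth_lt hj).
  have := map_eq_onth hy hj; rewrite /olab /= ea -hy2 onth_map hb (onth_nth _ _ _ _ hb) /=.
  by case=> ->.
Qed.

End Compose.

(** * Simulation of a 2gsm with one output symbol per step *)

Definition erase (A : Type) (w : seq (option A)) : seq A := pmap id w.

Lemma erase_cat (A : Type) (u v : seq (option A)) : erase (u ++ v) = erase u ++ erase v.
Proof. exact: pmap_cat. Qed.

Lemma erase_Some (A : Type) (u : seq A) : erase (map Some u) = u.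
Proof. by elim: u => //= x u ->. Qed.

(* The word whose cells are the nodes of [ed w]: the last cell carries no
   letter, and the first one is flagged. *)
Definition nodeword (A : Type) (w : seq A) : seq (bool * option A) :=
  mkseq (fun i => (i == 0, onth w i)) (size w).+1.

Lemma size_nodeword (A : Type) (w : seq A) : size (nodeword w) = (size w).+1.
Proof. exact: size_mkseq. Qed.

Lemma onth_nodeword (A : Type) (w : seq A) i :
  onth (nodeword w) i = if i <= size w then Some (i == 0, onth w i) else None.
Proof. exact: onth_mkseq. Qed.

#[global] Opaque nodeword.

Lemma nodeword_inj (A : Type) (w w' : seq A) : nodeword w = nodeword w' -> w = w'.
Proof.
move=> e; have es : size w = size w' by apply: succn_inj; rewrite -!size_nodeword e.
apply: eq_from_onth => i; have := congr1 (fun z => onth z i) e.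
rewrite /= !onth_nodeword es; case: leqP => [_ [->] //|h _].
by rewrite !onth_default // ?es ltnW.
Qed.

Lemma map_snd_nodeword (A : Type) (w : seq A) :
  map snd (nodeword w) = rcons (map Some w) None.
Proof.
apply: eq_from_onth => i; rewrite onth_map onth_nodeword -cats1 onth_cat size_map onth_map.
case: (leqP i (size w)) => h /=; last first.
  by rewrite ltnNge (ltnW h) /= -[i - size w]prednK ?subn_gt0 //; case: (_.-1).
case: ltnP => h'; first by have [x ->] := ltn_onth h'.
have -> : i = size w by lia.
by rewrite subnn onth_default.
Qed.

Lemma rcons_None (A : Type) (s : seq (option A)) : s <> [::] ->
  (forall i o, onth s i = Some o -> (o = None <-> i.+1 = size s)) ->
  exists w, s = rcons (map Some w) None.
Proof.
elim: s => // o s IH _ h; case: s IH h => [|o' s] IH h.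
  by exists [::]; have [_ ->] := h 0 o erefl.
have [|i p hi|w hw] := IH; [by []| |].
  by have [h1 h2] := h i.+1 p hi; split=> [/h1 [->]|[e]] //; apply: h2; rewrite e.
case: o h => [a|] h; first by exists (a :: w); rewrite hw.
by have [/(_ erefl)] := h 0 None erefl.
Qed.

Definition nodewordq (A : eqType) (l m r : option (bool * option A)) : bool :=
  if m is Some (f, o) then (f == (l == None)) && ((o == None) == (r == None)) else true.

(** The flag and the missing letter only record which cells lack a left or a right neighbour, so
    node words are a local language. *)
Lemma nodewordP (A : eqType) (x : seq (bool * option A)) :
  nbr (@nodewordq A) x /\ has xpredT x <-> exists w, x = nodeword w.
Proof.
split; last first.
  case=> w ->; split; last by rewrite has_predT size_nodeword.
  move=> i; rewrite size_nodeword ltnS => hi; rewrite /nodewordq /= (onth_nodeword w i) hi. rewrite (onth_nodeword w i.+1).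
  apply/andP; split.
    by case: i hi => //= i hi; rewrite onth_nodeword (ltnW hi).
  by rewrite -onthTE; case: (onth w i).
case=> h x0.
have h1 i f o : onth x i = Some (f, o) -> f = (i == 0) /\ (o = None <-> i.+1 = size x).
  move=> e; have := h i (onth_lt e); rewrite /nodewordq /= e => /andP [/eqP -> /eqP h2].
  split.
    case: i e {h2} => //= i e; by have [y ->] := ltn_onth (ltnW (onth_lt e)).
  have := onth_lt e; have : (onth x i.+1 == None) = ~~ (i.+1 < size x).
    by rewrite -onthTE; case: (onth x i.+1).
  rewrite -h2 => h3; split=> [o0|ei]; first by move: h3; rewrite o0 eqxx; lia.
  by apply/eqP; rewrite h3 -ei ltnn.
have [w hw] : exists w, map snd x = rcons (map Some w) None.
  apply: rcons_None; first by case: (x) x0.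
  by move=> i o; rewrite onth_map size_map; case e: (onth x i) => [[f o']|] //= [<-]; have [] := h1 _ _ _ e.
exists w; apply: eq_from_onth => i.
have := congr1 (fun s => onth s i) (etrans hw (esym (map_snd_nodeword w))).
rewrite /= onth_map [RHS]onth_map.
case e: (onth x i) => [[f o]|]; last by case: (onth (nodeword w) i).
have [-> _] := h1 _ _ _ e.
by rewrite onth_nodeword; case: ifP => //= _ [->].
Qed.

Lemma recog_nodeword (A : finType) : recog (fun x => exists w : seq A, x = nodeword w).
Proof.
apply: recog_ext (@nodewordP A) _.
by apply: recog_and; [apply: recog_nbr | apply: recog_has].
Qed.

(** A nondeterministic two-way machine on node words. No end markers are needed, as the cells at
    both ends are recognizable as such. Each step writes exactly one symbol. *)
Record smach (X Y : finType) := Smach {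
  sQ : finType; sq0 : sQ; sfin : pred sQ;
  str : sQ -> bool * option X -> Y -> hmove -> sQ -> bool }.
Arguments sq0 {X Y} s. Arguments sfin {X Y} s _. Arguments str {X Y} s _ _ _ _ _.

Section Run.
Variables (X Y : finType) (N : smach X Y).
Local Notation config := (sQ N * nat)%type.

Definition scan (x : seq (bool * option X)) (k : config) (y : Y) (k' : config) : bool :=
  (k'.2 < size x) && [exists d, (k.2 + hcode d == k'.2.+1) &&
     if onth x k.2 is Some s then str N k.1 s y d k'.1 else false].

Definition rstep x (a b : config * option Y) : bool :=
  if a.2 is Some y then scan x a.1 y b.1 else false.

(** The last item writes [None]. A run thus has exactly one item for each cell of the node word of
    its output. *)
Definition srun x (r : seq (config * option Y)) : Prop :=
  if r is a :: r' then
    [/\ a.1 = (sq0 N, 0), path (rstep x) a r', (last a r').2 = None & sfin N (last a r').1.1]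
  else False.

Definition srel (w : seq X) (y : seq Y) :=
  exists2 r, srun (nodeword w) r & map snd r = rcons (map Some y) None.

Inductive sreach (x : seq (bool * option X)) : config -> seq Y -> config -> Prop :=
| sreach_refl k : sreach x k [::] k
| sreach_step k y k1 ys k2 : scan x k y k1 -> sreach x k1 ys k2 -> sreach x k (y :: ys) k2.

Lemma sreach_cat x k1 y k2 y' k3 :
  sreach x k1 y k2 -> sreach x k2 y' k3 -> sreach x k1 (y ++ y') k3.
Proof. by elim=> //= k z k' ys k'' s _ IH /IH; apply: sreach_step. Qed.

Lemma srel_sreach w y : srel w y <->
  exists2 k, sreach (nodeword w) (sq0 N, 0) y k & sfin N k.1.
Proof.
split.
- case=> -[//|a r] [ea + lo lf] /= e; rewrite -{}ea.
  elim: r a y e lo lf => [|b r IH] a y /= e lo lf.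
    exists a.1 => //; case: y e => [|z [|? ?]] //= [ea]; first exact: sreach_refl.
  case/andP => s p; case: y e => [|z y] /= []; first by case: (r).
  move=> ez e; have [k h1 h2] := IH b y e lo lf p.
  by exists k => //; apply: sreach_step h1; move: s; rewrite /rstep ez.
- case=> k + fk; move e: (sq0 N, 0) => k0 h.
  suff [a [r [h1 h2 h3 h4 h5]]] : exists a r, [/\ a.1 = k0, path (rstep (nodeword w)) a r,
      (last a r).2 = None, sfin N (last a r).1.1 & map snd (a :: r) = rcons (map Some y) None].
    by exists (a :: r) => //; split=> //; rewrite h1.
  move: {e} fk; elim: h => {k0 k y} [k|k y k1 ys k2 s _ IH] fk.
    by exists (k, None), [::].
  have [a [r [h1 h2 h3 h4 h5]]] := IH fk.
  exists (k, Some y), (a :: r); split=> //=; last by rewrite -h5.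
  by rewrite h2 andbT /rstep /= h1.
Qed.

End Run.

Lemma inlist_has (T : Type) (p : pred T) s : has p s <-> exists2 x, inlist x s & p x.
Proof.
elim: s => [|y s IH] /=; first by split=> // -[].
split.
- case/orP => [py|/IH [x h hx]]; first by exists y => //; left.
  by exists x => //; right.
- by case=> x [<- ->|h hx] //; apply/orP; right; apply/IH; exists x.
Qed.

Section FromGsm.
Variables (A C : finType) (M : gsm2 A C).

Definition maxout := foldr (fun t n => maxn (size (i_a1 t)) (maxn (size (i_a0 t)) n)) 0 (gdelta M).

(* A state records: whether the head of [M] is on the left end marker, the
   state of [M], the letters still to be written, and the pending work
   ([None]: simulate an instruction; [inl e]: write, then make the move [e];
   [inr b]: skip blanks, to the right iff [b]). *)
Definition simQ : finType := (bool * gQ M * {bseq maxout of C} * option (hmove + bool))%type.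
Definition mkQ lm q s ph : simQ := (lm, q, insub_bseq maxout s, ph).

Definition instr_out (t : instr (gQ M) A C) (s : tsym A) :=
  if tsym_eqb (i_sym t) s then (i_q1 t, i_a1 t, i_e1 t) else (i_q0 t, i_a0 t, i_e0 t).

Definition cell_sym (lm : bool) (o : option (option A)) : option (tsym A) :=
  if lm then Some LMark else match o with
  | None => Some RMark | Some (Some a) => Some (Letter a) | Some None => None end.

(** Blanks have no position on the tape of the simulated 2gsm, so the head runs across them in the
    direction of its move. The left end marker shares the first cell, which explains the stay move
    there; the right one is the last cell, which is never blank. *)
Definition skip_step (first lm blank right : bool) : option (hmove * (bool * option (hmove + bool))) :=
  if blank then
    if right then Some (MRight, (false, Some (inr true)))
    else if first then Some (MStay, (true, None)) else Some (MLeft, (false, Some (inr false)))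
  else Some (MStay, (false, None)).

Definition move_step (first lm last : bool) (e : hmove) : option (hmove * (bool * option (hmove + bool))) :=
  match e with
  | MStay => Some (MStay, (lm, None))
  | MRight => if lm then Some (MStay, (false, Some (inr true)))
              else if last then None else Some (MRight, (false, Some (inr true)))
  | MLeft => if lm then None
             else if first then Some (MStay, (true, None)) else Some (MLeft, (false, Some (inr false)))
  end.

Definition sim_tr (k : simQ) (s : bool * option (option A)) (y : option C) (d : hmove) (k' : simQ) : bool :=
  let: (lm, q, pend, ph) := k in
  match ph with
  | None =>
      [&& y == None, d == MStay &
      if cell_sym lm s.2 is Some sg then
        has (fun t => (i_p t == q) &&
          let: (q1, a, e) := instr_out t sg in k' == mkQ lm q1 a (Some (inl e))) (gdelta M)
      else false]
  | Some (inl e) =>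
      if val pend is b :: rest then
        [&& y == Some b, d == MStay & k' == mkQ lm q rest ph]
      else (y == None) &&
        if move_step s.1 lm (s.2 == None) e is Some (d', (lm', ph')) then
          (d == d') && (k' == mkQ lm' q [::] ph') else false
  | Some (inr b) =>
      (y == None) &&
        if skip_step s.1 lm (s.2 == Some None) b is Some (d', (lm', ph')) then
          (d == d') && (k' == mkQ lm' q [::] ph') else false
  end.

Definition sim : smach (option A) (option C) :=
  @Smach (option A) (option C) simQ (mkQ true (gqin M) [::] None)
    (fun k => (k.2 == None) && (k.1.1.2 == gqf M)) sim_tr.

Lemma size_maxout t s q a e : inlist t (gdelta M) -> instr_out t s = (q, a, e) -> size a <= maxout.
Proof.
rewrite /maxout /instr_out; elim: (gdelta M) => //= x l IH [->|/IH h /h h'].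
  by case: ifP => _ [_ <- _]; lia.
by move: h'; lia.
Qed.

Section Word.
Variable w : seq (option A).
Let W := erase w.
Let x := nodeword w.
(** A letter in cell [k] of the padded word has position [(cnt k).+1] on the tape of [M]. *)
Definition cnt k := size (erase (take k w)).

Lemma cntS k : cnt k.+1 = cnt k + (if onth w k is Some (Some _) then 1 else 0).
Proof.
rewrite /cnt; case e: (onth w k) => [o|].
  by rewrite (take_onth e) -cats1 erase_cat size_cat; case: o {e} => [a|].
by rewrite !take_oversize ?addn0 // ?leqW // -onthNE e.
Qed.

Lemma cnt_leq k : cnt k <= size W.
Proof.
rewrite /W -[in size (erase w)](cat_take_drop k w) erase_cat size_cat.
exact: leq_addr.
Qed.

Lemma cnt_le_mono j k : j <= k -> cnt j <= cnt k.
Proof.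
elim: k => [|k IH]; first by rewrite leqn0 => /eqP ->.
rewrite leq_eqVlt ltnS cntS => /orP [/eqP ->|/IH h]; rewrite ?cntS //; lia.
Qed.

Lemma tape_cell lm i sg : i <= size w -> cell_sym lm (onth w i) = Some sg ->
  tape W (if lm then 0 else (cnt i).+1) = sg.
Proof.
case: lm => hi /=; first by case.
rewrite /tape /=; case e: (onth w i) => [[a|]|] // [<-].
  have := cntS i; rewrite e => h; have := cnt_leq i.+1; rewrite h addn1 => ->.
  rewrite /W -[in erase w](cat_take_drop i w) erase_cat drop_size_cat //.
  have -> : drop i w = Some a :: drop i.+1 w.
    by rewrite (drop_nth None (onth_lt e)) (onth_nth _ _ _ _ e).
  by [].
have -> : cnt i = size W by rewrite /cnt take_oversize // -onthNE e.
by rewrite ltnn.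
Qed.

(** While blanks are skipped to the left, the cell sought is the last letter at or before cell [i].
    Its tape position is [cnt i.+1], which becomes 0, the left end marker, if there is no such
    letter. *)
Definition simpos (lm : bool) (ph : option (hmove + bool)) i :=
  if lm then 0 else if ph is Some (inr false) then cnt i.+1 else (cnt i).+1.

Local Notation reach := (star (gstep M W) (gqin M, 0, [::])).

(** In the writing phase an instruction is only half simulated: the invariant then speaks of the
    configuration of [M] after the pending letters and the pending move. *)
Definition siminv (k : simQ * nat) (z : seq C) : Prop :=
  let: (lm, q, pend, ph, i) := k in
  [/\ lm -> i = 0, i <= size w,
    if ph is Some (inr b) then ~~ lm /\ (b = false -> i < size w) else lm || (onth w i != Some None) &
    if ph is Some (inl e) then
      forall j, move_head (size W) (simpos lm ph i) e = Some j -> reach (q, j, z ++ val pend)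
    else reach (q, simpos lm ph i, z)].

Lemma star_rcons (T : Type) (R : T -> T -> Prop) a b c : star R a b -> R b c -> star R a c.
Proof.
by elim=> [y h|y z u h _ IH /IH]; [apply: star_step h _; apply: star_refl | apply: star_step h].
Qed.

Lemma val_mk s : size s <= maxout -> val (insub_bseq maxout s : {bseq maxout of C}) = s.
Proof. by move=> h; rewrite /insub_bseq insubdK. Qed.

Lemma size_onth_w i s : onth x i = Some s -> i <= size w /\ s = (i == 0, onth w i).
Proof. by rewrite onth_nodeword; case: ifP => // h [<-]. Qed.

Lemma siminv_step k y k' z : scan (N := sim) x k y k' -> siminv k z ->
  siminv k' (z ++ (if y is Some b then [:: b] else [::])).
Proof.
case: k k' => [[[[lm q] pend] ph] i] [k' i'].
rewrite /scan size_nodeword /= ltnS => /andP [hi' /existsP [d /andP [/eqP hd]]].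
case e: (onth x i) => [s|] //; have [hi es] := size_onth_w e; rewrite es /=.
case: ph => [[e0|b]|] tr [h1 _ h2 h3].
- case ep: (val pend) tr h3 => [|b rest] /=.
    case/andP => /eqP ->; rewrite ?cats0.
    case: e0 => /=.
    + case: lm h1 h2 => // h1 h2.
      case: i e hd hi es h1 h2 => [|i] e hd hi es h1 h2 /=.
        case/andP => /eqP ed /eqP -> /= /(_ 0); rewrite /cnt take0 /= ?cats0 => h3.
        have -> : i' = 0 by move: hd; rewrite ed /=; lia.
        by split=> //; apply: h3.
      case/andP => /eqP ed /eqP -> /= /(_ (cnt i.+1) erefl); rewrite ?cats0 => h3.
      have -> : i' = i by move: hd; rewrite ed /=; lia.
      by split=> //; lia.
    + case/andP => /eqP ed /eqP -> /= /(_ _ erefl); rewrite ?cats0 => h3.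
      have -> : i' = i by move: hd; rewrite ed /=; lia.
      by split.
    + case: lm h1 h2 => h1 h2.
        case/andP => /eqP ed /eqP -> /= /(_ 1 erefl); rewrite ?cats0 => h3.
        have -> : i' = i by move: hd; rewrite ed /=; lia.
        by split=> //; rewrite (h1 erefl) /cnt take0 /=.
      case ew : (onth w i) h2 => [[a|]|] // _ /=.
      case/andP => /eqP ed /eqP -> /=.
      have -> : i' = i.+1 by move: hd; rewrite ed /=; lia.
      have hc := cntS i; rewrite ew addn1 in hc.
      have := cnt_leq i.+1; rewrite hc => hc' /(_ (cnt i).+2); rewrite /= ltnS hc' ?cats0 => h3.
      by split=> //; [apply: onth_lt ew | rewrite ?hc; apply: h3].
  case/and3P => /eqP -> /eqP ed /eqP -> h3.
  have -> : i' = i by move: hd; rewrite ed /=; lia.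
  split=> // j hj; rewrite val_mk; first by rewrite -catA; apply: h3.
  by have := size_bseq pend; rewrite ep /=; lia.
- case: h2 => /negbTE el hb; rewrite {}el /= in h1 tr h3 *.
  case/andP: tr => /eqP ->; rewrite ?cats0.
  rewrite /skip_step; case: eqP => [ew|ew].
    have hs : i < size w by apply: onth_lt ew.
    have hc := cntS i; rewrite ew addn0 in hc.
    case: b hb h3 => hb h3.
      case/andP => /eqP ed /eqP -> /=.
      have -> : i' = i.+1 by move: hd; rewrite ed /=; lia.
      by split=> //=; rewrite hc.
    case: i e hd hi es h1 hb h3 ew hs hc => [|i] e hd hi es h1 hb h3 ew hs hc /=.
      case/andP => /eqP ed /eqP -> /=.
      have -> : i' = 0 by move: hd; rewrite ed /=; lia.
      by split=> //; move: h3; rewrite hc /cnt take0.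
    case/andP => /eqP ed /eqP -> /=.
    have -> : i' = i by move: hd; rewrite ed /=; lia.
    by split=> //; [apply: ltnW hi | rewrite -hc].
  case/andP => /eqP ed /eqP -> /=.
  have -> : i' = i by move: hd; rewrite ed /=; lia.
  split=> //=; first by apply/eqP.
  case: b hb h3 => // hb; have [o ho] := ltn_onth (hb erefl).
  by rewrite cntS; case: o ho ew => [a|] -> // _; rewrite addn1.
- case/and3P: tr => /eqP -> /eqP ed; rewrite ?cats0.
  case ec: (cell_sym lm (onth w i)) => [sg|] // /inlist_has [t ht /andP [/eqP ep]].
  case eo: (instr_out t sg) => [[q1 a] e1] /eqP -> /=.
  have -> : i' = i by move: hd; rewrite ed /=; lia.
  split=> // j hj; rewrite val_mk ?(size_maxout ht eo) //.
  apply: star_rcons h3 _; exists t => //; split=> //.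
  rewrite /simpos (tape_cell hi ec) -[if _ then _ else _]/(instr_out t sg) eo.
  by split.
Qed.

Lemma sim_sound ys : srel sim w ys -> gsm_rel M W (erase ys).
Proof.
case/srel_sreach => k h fk.
suff : siminv k ([::] ++ erase ys).
  case: k h fk => [[[[lm q] pend] ph] i] h /= /andP [/eqP -> /eqP ->] /= [_ _ _ r].
  by exists (simpos lm None i).
have : siminv (sq0 sim, 0) [::] by rewrite /= ; split=> //; apply: star_refl.
elim: h [::] => {k fk ys} [k z|k y k1 ys k2 s _ IH z]; first by rewrite cats0.
move/(siminv_step s)/IH; rewrite -catA; congr (siminv _ (_ ++ _)).
by case: (y).
Qed.

Definition runpos (lm : bool) i p :=
  [/\ i <= size w, lm -> i = 0, lm || (onth w i != Some None) & p = if lm then 0 else (cnt i).+1].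

Lemma sreach_one k y k' : scan (N := sim) x k y k' -> sreach x k [:: y] k'.
Proof. by move=> h; apply: sreach_step h (sreach_refl _ _). Qed.

Lemma scanI (k : simQ) i y d k' i' : i <= size w -> i' <= size w -> i + hcode d = i'.+1 ->
  sim_tr k (i == 0, onth w i) y d k' -> scan (N := sim) x (k, i) y (k', i').
Proof.
move=> h1 h2 h3 h4; rewrite /scan size_nodeword /= ltnS h2 /=.
by apply/existsP; exists d; rewrite h3 eqxx onth_nodeword h1.
Qed.

Lemma sim_emit lm q a e i : size a <= maxout -> i <= size w ->
  sreach (N := sim) x (mkQ lm q a (Some (inl e)), i) (map Some a) (mkQ lm q [::] (Some (inl e)), i).
Proof.
elim: a => [|b a IH] /= h hi; first exact: sreach_refl.
apply: sreach_step (IH (ltnW h) hi).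
by apply: (scanI (d := MStay)) => //=; rewrite ?addn1 // val_mk //= !eqxx.
Qed.

Lemma sim_skipR q i : i <= size w -> exists ys i',
  [/\ sreach (N := sim) x (mkQ false q [::] (Some (inr true)), i) ys (mkQ false q [::] None, i'),
     runpos false i' (cnt i).+1 & erase ys = [::]].
Proof.
have [n] := ubnP (size w - i); elim: n i => // n IH i hn hi.
case: (boolP (onth w i == Some None)) => [/eqP e|e]; last first.
  exists [:: None], i; split=> //; apply: sreach_one.
  by apply: (scanI (d := MStay)) => //=; rewrite ?addn1 // /skip_step (negbTE e) !eqxx.
have := onth_lt e => hs; have h0 : size w - i.+1 < n.
  by rewrite -ltnS; apply: leq_trans hn; rewrite ltnS; apply: ltn_sub2l.
have [ys [i' [h1 h2 h3]]] := IH i.+1 h0 hs.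
have hc := cntS i; rewrite e addn0 in hc; rewrite hc in h2.
exists (None :: ys), i'; split=> //; apply: sreach_step h1.
by apply: (scanI (d := MRight)) => //=; rewrite ?addn2 // /skip_step e !eqxx.
Qed.

Lemma sim_skipL q i : i < size w -> exists ys lm i',
  [/\ sreach (N := sim) x (mkQ false q [::] (Some (inr false)), i) ys (mkQ lm q [::] None, i'),
     runpos lm i' (cnt i.+1) & erase ys = [::]].
Proof.
elim: i => [|i IH] hi.
  case: (boolP (onth w 0 == Some None)) => [/eqP e|e]; last first.
    exists [:: None], false, 0; split=> //.
      apply: sreach_one.
      by apply: (scanI (d := MStay)) => //=; rewrite ?addn1 // /skip_step (negbTE e) !eqxx.
    split=> //=; have [o ho] := ltn_onth hi.
    by rewrite cntS ho; case: o ho e => [a|] -> //; rewrite addn1.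
  exists [:: None], true, 0; split=> //.
    apply: sreach_one.
    by apply: (scanI (d := MStay)) => //=; rewrite ?addn1 // /skip_step e !eqxx.
  by split=> //=; rewrite cntS e addn0 /cnt take0.
case: (boolP (onth w i.+1 == Some None)) => [/eqP e|e]; last first.
  exists [:: None], false, i.+1; split=> //.
    apply: sreach_one.
    by apply: (scanI (d := MStay)) => //=; rewrite ?addn1 ?(ltnW hi) // /skip_step (negbTE e) !eqxx.
  split=> //=; first exact: ltnW.
  have [o ho] := ltn_onth hi.
  by rewrite cntS ho; case: o ho e => [a|] -> //; rewrite addn1.
have [ys [lm [i' [h1 h2 h3]]]] := IH (ltnW hi).
have hc := cntS i.+1; rewrite e addn0 in hc; rewrite -hc in h2.
exists (None :: ys), lm, i'; split=> //; apply: sreach_step h1.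
apply: (scanI (d := MLeft)); first exact: ltnW.
- exact: ltnW (ltnW hi).
- by rewrite /= addn0.
- by rewrite /= /skip_step e eqxx /= !eqxx.
Qed.

Lemma sim_move lm q e i p j : runpos lm i p -> move_head (size W) p e = Some j ->
  exists ys lm' i', [/\ sreach (N := sim) x (mkQ lm q [::] (Some (inl e)), i) ys (mkQ lm' q [::] None, i'),
    runpos lm' i' j & erase ys = [::]].
Proof.
case=> hi h1 h2 ->; case: e => /=.
- case: lm h1 h2 => // h1 h2 [<-].
  case: i hi h1 h2 => [|i] hi h1 h2.
    exists [:: None], true, 0; split=> //; last by split=> //=; rewrite /cnt take0.
    apply: sreach_one.
    by apply: (scanI (d := MStay)) => //=; rewrite ?addn1 // val_mk //= !eqxx.
  have [ys [lm [i' [h3 h4 h5]]]] := sim_skipL q hi.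
  exists (None :: ys), lm, i'; split=> //; apply: sreach_step h3.
  by apply: (scanI (d := MLeft)) => //=; rewrite ?addn0 ?(ltnW hi) // val_mk //= !eqxx.
- case=> <-; exists [:: None], lm, i; split=> //.
  apply: sreach_one.
  by apply: (scanI (d := MStay)) => //=; rewrite ?addn1 // val_mk //= !eqxx.
- case: lm h1 h2 => h1 h2.
    rewrite /= => -[<-]; have [ys [i' [h3 h4 h5]]] := sim_skipR q hi.
    have i0 := h1 erefl; subst i.
    have c0 : cnt 0 = 0 by rewrite /cnt take0.
    rewrite c0 in h4.
    exists (None :: ys), false, i'; split=> //; apply: sreach_step h3.
    by apply: (scanI (d := MStay)) => //=; rewrite ?addn1 // val_mk //= !eqxx.
  case: ifP => // hj [<-].
  case e: (onth w i) h2 => [[a|]|] // _; last first.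
    move: hj; have -> : cnt i = size W by rewrite /cnt take_oversize // -onthNE e.
    by rewrite ltnn.
  have hs := onth_lt e; have [ys [i' [h3 h4 h5]]] := sim_skipR q hs.
  have hc := cntS i; rewrite e addn1 in hc; rewrite hc in h4.
  exists (None :: ys), false, i'; split=> //; apply: sreach_step h3.
  by apply: (scanI (d := MRight)) => //=; rewrite ?addn2 // val_mk //= e /= ?eqxx.
Qed.

Lemma sim_step lm q i p z q' p' z' : runpos lm i p -> gstep M W (q, p, z) (q', p', z') ->
  exists ys lm' i', [/\ sreach (N := sim) x (mkQ lm q [::] None, i) ys (mkQ lm' q' [::] None, i'),
    runpos lm' i' p' & z' = z ++ erase ys].
Proof.
move=> hr [t ht [ep]]; case: (hr) => hi h1 h2 hp.
have [sg ec] : exists sg, cell_sym lm (onth w i) = Some sg.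
  case: lm h2 {hr h1 hp} => /= h2; first by exists LMark.
  by case: (onth w i) h2 => [[a|]|] //= _; [exists (Letter a)|exists RMark].
rewrite hp (tape_cell hi ec) -[if _ then _ else _]/(instr_out t sg).
case eo: (instr_out t sg) => [[q1 a] e] [-> -> hm]; rewrite -hp in hm.
have [ys [lm' [i' [h3 h4 h5]]]] := sim_move q1 hr hm.
exists (None :: map Some a ++ ys), lm', i'; split=> //; last first.
  by rewrite -[erase (None :: _)]/(erase (map Some a ++ ys)) erase_cat h5 cats0 erase_Some.
apply: sreach_step (sreach_cat (sim_emit lm q1 e (size_maxout ht eo) hi) h3).
apply: (scanI (d := MStay)) => //=; rewrite ?addn1 // ec /=.
by apply/inlist_has; exists t => //; rewrite ep eqxx eo /=.
Qed.

Lemma sim_complete z : gsm_rel M W z -> exists2 ys, srel sim w ys & erase ys = z.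
Proof.
case=> p.
suff key c c' : star (gstep M W) c c' -> forall lm i, runpos lm i c.1.2 ->
    exists ys lm' i', [/\ sreach (N := sim) x (mkQ lm c.1.1 [::] None, i) ys (mkQ lm' c'.1.1 [::] None, i'),
    runpos lm' i' c'.1.2 & c'.2 = c.2 ++ erase ys].
  move=> /key /= /(_ true 0) [//|ys [lm [i [h1 h2 h3]]]].
  exists ys => //; apply/srel_sreach.
  by exists (mkQ lm (gqf M) [::] None, i) => //=; rewrite !eqxx.
elim=> {c c' z p} [c lm i h|[[q p] z] [[q1 p1] z1] c' hs _ IH lm i h].
  by exists [::], lm, i; split=> //; [apply: sreach_refl | rewrite cats0].
have [ys [lm1 [i1 [h1 h2 h3]]]] := sim_step h hs.
have [ys' [lm2 [i2 [h4 h5 h6]]]] := IH _ _ h2.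
exists (ys ++ ys'), lm2, i2; split=> //; first exact: sreach_cat h1 h4.
by rewrite h6 /= h3 erase_cat catA.
Qed.

End Word.
End FromGsm.

(** * Runs with boundedly many visits *)

Lemma path_onthP (X : Type) (e : rel X) a r : path e a r <->
  forall l u v, onth (a :: r) l = Some u -> onth (a :: r) l.+1 = Some v -> e u v.
Proof.
elim: r a => [|b r IH] a /=; first by split=> // _ [|l] u v.
split=> [/andP [h /IH p] [|l] u v /=|h].
- by case=> <- [<-].
- exact: p.
- by rewrite (h 0 a b) //=; apply/IH => l u v h1 h2; apply: (h l.+1).
Qed.

Lemma onth_last (X : Type) (a : X) r : onth (a :: r) (size r) = Some (last a r).
Proof. by elim: r a => [|b r IH] a //=; rewrite -IH. Qed.

Definition bounded_run (Q : eqType) (Y : Type) n (r : seq (Q * Y)) :=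
  forall k, count (fun a => a.1 == k) r <= n.

Section RunTransducer.
Variables (X Y : finType) (N : smach X Y) (n : nat).

Definition runC : finType := (sQ N * 'I_n.+1)%type.
Definition runT : finType :=
  ((bool * option X) *
   {ffun runC -> option ((bool * option Y) * (option (hmove * runC) * option (hmove * runC)))})%type.

Definition runG : pgs runT runC :=
  Pgs (fun (a : runT) (c : runC) => a.2 c : bool)
    (fun b (a : runT) (c : runC) =>
       if a.2 c is Some (_, (pr, nx)) then if b then nx else pr else None).

Definition runlab (a : runT) (c : runC) : bool * option Y :=
  if a.2 c is Some (l, _) then l else (false, None).

Definition runok (a : runT) : bool := [forall c : runC,
  if a.2 c is Some (l, (pr, nx)) then
    [&& l.1 == (pr == None), (pr == None) ==> (c.1 == sq0 N) && a.1.1 &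
    if nx is Some (d, c') then
      if l.2 is Some y then str N c.1 a.1 y d c'.1 else false
    else (l.2 == None) && sfin N c.1]
  else true].

Definition runL (t : seq runT) := (exists w, unzip1 t = nodeword w) /\ all runok t.

Lemma recog_runL : recog runL.
Proof. exact: recog_and (recog_map _ (recog_nodeword X)) (recog_all _). Qed.

Definition runK : ktr (bool * option X)%type (bool * option Y)%type :=
  Ktr runG (fun a : runT => a.1) runlab recog_runL.

(** Visit numbers only keep copies apart. Along any path of present copies [runok] checks each
    transition, so the path is a run, and the flags make its labels a node word. *)
Lemma runK_sound w yy : kt_rel runK (nodeword w) yy ->
  exists2 y, yy = nodeword y & srel N w y.
Proof.
case=> t [p [[_ /allP ok] ht hp hy]].
case: (hp) => p0 _ _ hl.
pose cf (m : nat * runC) : (sQ N * nat) * option Y :=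
  ((m.2.1, m.1), if olab runlab t m is Some l then l.2 else None).
have data l m : onth p l = Some m -> exists a lb pr nx,
  [/\ onth t m.1 = Some a, a.2 m.2 = Some (lb, (pr, nx)), onth yy l = Some lb,
     cf m = ((m.2.1, m.1), lb.2) & a.1 = (m.1 == 0, onth w m.1)].
  case: m => i c h; have /npresE [a ea] := path_onth_pres hp h.
  rewrite /=; case e: (a.2 c) => [[lb [pr nx]]|] // _.
  have el : olab runlab t (i, c) = Some lb by rewrite /olab /= ea /runlab e.
  exists a, lb, pr, nx; split=> //; last first.
  - have := congr1 (fun s => onth s i) ht; rewrite /= onth_map ea onth_nodeword /=.
    by case: ifP => // _ [].
  - by rewrite /cf el.
  by rewrite -(map_eq_onth hy h).
have okd a c lb pr nx i : onth t i = Some a -> a.2 c = Some (lb, (pr, nx)) ->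
    [/\ lb.1 = (pr == None), pr = None -> c.1 = sq0 N /\ a.1.1 & is_true (
    if nx is Some (d, c') then
      if lb.2 is Some y then str N c.1 a.1 y d c'.1 else false
    else (lb.2 == None) && sfin N c.1)].
  move=> ea ec; have : a \in t by apply/onthP; exists i.
  move/ok/forallP/(_ c); rewrite ec => /and3P [/eqP h1 /implyP h2 h3]; split=> //.
  by move=> e; move: h2; rewrite e => /(_ isT) /andP [/eqP].
have hsz : size yy = size p by move/(congr1 size): hy; rewrite !size_map.
have st l m m' : onth p l = Some m -> onth p l.+1 = Some m' ->
    rstep (N := N) (nodeword w) (cf m) (cf m').
  move=> h h'; have [a [lb [pr [nx [ea ec ey -> es]]]]] := data _ _ h.
  have [+ _] := hl _ _ h; rewrite h' /nptr ea /= ec.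
  case: nx ec => [[d c']|] //= ec [ei ec'].
  have [_ _] := okd _ _ _ _ _ _ ea ec; rewrite /rstep /=.
  case: lb.2 => // y hs; rewrite /scan /=.
  have [a' [? [? [? [ea' _ _ _ _]]]]] := data _ _ h'.
  have -> : size (nodeword w) = size t by rewrite -ht size_map.
  rewrite (onth_lt ea'); apply/existsP; exists d; rewrite ei eqxx /=.
  rewrite -ht onth_map ea /=.
  by rewrite -ec'.
have e0 m : onth p 0 = Some m -> (cf m).1 = (sq0 N, 0).
  move=> h; have [a [lb [pr [nx [ea ec ey -> es]]]]] := data _ _ h.
  have [_] := hl _ _ h; rewrite /nptr ea /= ec.
  case: pr ec => //= ec _; have [_ /(_ erefl) [-> +] _] := okd _ _ _ _ _ _ ea ec.
  by rewrite es /= => /eqP ->.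
have elast l m : onth p l = Some m -> ((cf m).2 = None <-> l.+1 = size p) /\
    ((cf m).2 = None -> sfin N m.2.1).
  move=> h; have [a [lb [pr [nx [ea ec ey -> es]]]]] := data _ _ h.
  have [+ _] := hl _ _ h; rewrite /nptr ea /= ec.
  have [_ _] := okd _ _ _ _ _ _ ea ec.
  case: nx ec => [[d c']|] ec /=.
    case: lb.2 => // y _; case e: (onth p l.+1) => [m'|] // _.
    by split=> //; split=> // h2; have := onth_lt e; rewrite h2 ltnn.
  move/andP => [/eqP -> fn]; case e: (onth p l.+1) => //= _; split=> //.
  split=> // _; have := onth_lt h; have : size p <= l.+1 by rewrite -onthNE e.
  by move=> h1 h2; apply/eqP; rewrite eqn_leq h1 h2.
have [y hyy] : exists y, map snd (map cf p) = rcons (map Some y) None.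
  apply: rcons_None; first by case: (p) p0.
  move=> l o; rewrite !onth_map !size_map.
  by case e: (onth p l) => [m|] //= [<-]; have [] := elast _ _ e.
exists y; last first.
  exists (map cf p) => //; case: (p) p0 e0 st elast => // m p' _ e0 st elast /=.
  split; first exact: e0.
  - apply/path_onthP => l u v.
    rewrite -[cf m :: _]/(map cf (m :: p')) !onth_map.
    case e1: (onth _ l) => [m1|] //= [<-]; case e2: (onth _ l) => [m2|] //= [<-].
    exact: st e1 e2.
  - have := onth_last m p' => h; rewrite last_map.
    by have [[_ h1] _] := elast _ _ h; apply: h1.
  - have := onth_last m p' => h; rewrite last_map.
    by have [[_ h1] h2] := elast _ _ h; apply: h2; apply: h1.
have sy : size yy = (size y).+1.
  by rewrite hsz; have := congr1 size hyy; rewrite !size_map size_rcons size_map.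
apply: eq_from_onth => l; rewrite onth_nodeword -ltnS -sy hsz.
case: ltnP => h; last by rewrite onth_default // hsz.
have [m hm] := ltn_onth h; have [a [lb [pr [nx [ea ec ey ecf es]]]]] := data _ _ hm.
rewrite ey; case: lb ey ec ecf => f o ey ec ecf; congr (Some (_, _)).
  have [/= -> _ _] := okd _ _ _ _ _ _ ea ec.
  have [_] := hl _ _ hm; rewrite /nptr ea /= ec /=.
  case: l h hm ey {ecf} => [|l] h hm ey /=; first by case: (pr).
  by have [m' ->] := ltn_onth (ltnW h); case: (pr).
have := congr1 (fun s => onth s l) hyy; have := congr1 snd ecf.
rewrite /= !onth_map hm /= => ->.
rewrite -cats1 onth_cat size_map onth_map; case: ltnP => hly.
  by have [z ->] := ltn_onth hly; case.
rewrite [onth y l]onth_default //; have -> : l = size y by lia.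
by rewrite subnn /= => -[].
Qed.

Definition dirof (i j : nat) : hmove :=
  if j < i then MLeft else if i < j then MRight else MStay.

Lemma dirofP i j d : i + hcode d = j.+1 -> dirof i j = d.
Proof.
rewrite /dirof; case: d => /= e; case: (ltnP j i) => h1 //; try lia;
  by case: (ltnP i j) => h2 //; lia.
Qed.

Lemma dirof_rev i j d : i + hcode d = j.+1 -> j + hcode (dirof j i) = i.+1.
Proof.
move=> e; rewrite (@dirofP j i (hopp d)); case: d e => /= e; lia.
Qed.

Lemma runK_complete w y r : srun (N := N) (nodeword w) r ->
  map snd r = rcons (map Some y) None -> bounded_run n.+1 r ->
  kt_rel runK (nodeword w) (nodeword y).
Proof.
case: r => // a0 r0 [ea0 /path_onthP hst hlast hfin]; set r := a0 :: r0 => hy hb.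
have sr : size r = (size y).+1 by move/(congr1 size): hy; rewrite size_map size_rcons size_map.
have st l : l.+1 < size r -> exists z d, [/\ (nth a0 r l).2 = Some z,
   (nth a0 r l).1.2 + hcode d = (nth a0 r l.+1).1.2.+1, (nth a0 r l.+1).1.2 < size (nodeword w) &
   exists2 s, onth (nodeword w) (nth a0 r l).1.2 = Some s &
     str N (nth a0 r l).1.1 s z d (nth a0 r l.+1).1.1].
  move=> h; have [u hu] := ltn_onth (ltnW h); have [v hv] := ltn_onth h.
  have := hst _ _ _ hu hv; rewrite (onth_nth a0 _ _ _ hu) (onth_nth a0 _ _ _ hv) /rstep.
  case: u.2 => // z /andP [h1 /existsP [d /andP [/eqP h2 h3]]].
  by exists z, d; split=> //; case: (onth _ u.1.2) h3 => // s h3; exists s.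
have rng l : l < size r -> (nth a0 r l).1.2 < size (nodeword w).
  case: l => [|l] h; first by rewrite /= ea0 size_nodeword.
  by have [z [d [_ _ ]]] := st _ h.
(* The number of earlier visits to the configuration of step [l]. The bound on the run keeps it
   below [n.+1], so that [inord] is faithful. *)
pose vis l := count (fun b => b.1 == (nth a0 r l).1) (take l r).
have visP l : l < size r -> vis l < n.+1.
  move=> h; apply: leq_trans (hb (nth a0 r l).1).
  have -> (q : pred _) : count q r = count q (take l r) + count q (drop l r).
    by rewrite -count_cat cat_take_drop.
  by rewrite (drop_nth a0 h) /= eqxx add1n addnS ltnS leq_addr.
pose node l : nat * runC := ((nth a0 r l).1.2, ((nth a0 r l).1.1, inord (vis l))).
(* If the configurations agree, step [l] itself counts among the visits before [l'], so the visit
   numbers differ. *)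
have node_lt l l' : l < l' -> l' < size r -> node l <> node l'.
  move=> h h' [e1 e2 e3].
  have e : (nth a0 r l).1 = (nth a0 r l').1 by apply: injective_projections.
  have := congr1 (@nat_of_ord _) e3; rewrite !inordK ?visP //; last exact: ltn_trans h h'.
  rewrite /vis -e.
  have -> (q : pred _) : count q (take l' r) = count q (take l r) + count q (drop l (take l' r)).
    by rewrite -count_cat -[in LHS](cat_take_drop l (take l' r)) take_takel // ltnW.
  rewrite (drop_nth a0) ?size_take ?h' // nth_take // /= eqxx add1n => /eqP.
  by rewrite -{1}[count _ (take l r)]addn0 eqn_add2l.
have node_inj l l' : l < size r -> l' < size r -> node l = node l' -> l = l'.
  move=> h h' e; case: (ltngtP l l') => // hl; last by case: (node_lt _ _ hl h).
  by case: (node_lt _ _ hl h').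
pose p := mkseq node (size r).
have hp l : onth p l = if l < size r then Some (node l) else None by rewrite onth_mkseq.
have up : uniq p.
  apply: onth_inj_uniq => l l' m; rewrite !hp; case: ifP => // h /Some_inj <-; case: ifP => // h' /Some_inj e.
  by rewrite (node_inj _ _ h' h e).
have inp m : m \in p -> exists2 l, l < size r & m = node l /\ index m p = l.
  case/onthP => l hl; have := hl; rewrite hp; case: ifP => // h /Some_inj e.
  by exists l => //; rewrite (onth_index up hl).
pose info (m : nat * runC) :=
  let l := index m p in
  ((l == 0, (nth a0 r l).2),
   (if l is l'.+1 then Some (dirof (node l).1 (node l').1, (node l').2) else None,
    if l.+1 < size r then Some (dirof (node l).1 (node l.+1).1, (node l.+1).2) else None)).
pose f i : runT := ((i == 0, onth w i), [ffun c : runC => if (i, c) \in p then Some (info (i, c)) else None]).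
pose t := mkseq f (size w).+1.
have ht i : onth t i = if i <= size w then Some (f i) else None by rewrite onth_mkseq.
have pos m : m \in p -> m.1 <= size w.
  by case/inp=> l h [-> _]; have := rng _ h; rewrite size_nodeword ltnS.
have hdir l : l.+1 < size r -> (node l).1 + hcode (dirof (node l).1 (node l.+1).1) = (node l.+1).1.+1 /\
   (node l.+1).1 + hcode (dirof (node l.+1).1 (node l).1) = (node l).1.+1.
  move=> h; have [z [d [_ e _ _]]] := st _ h; split; last exact: dirof_rev e.
  by rewrite (dirofP e).
have hpath : ispath runG t p.
  split=> //.
  - move=> [i c]; apply/idP/idP.
      move=> h; have hi := pos _ h; apply/npresE; exists (f i); first by rewrite ht hi.
      by rewrite /= ffunE h.
    by case/npresE => a; rewrite ht; case: ifP => // _ [<-]; rewrite /= ffunE; case: ifP.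
  - move=> l m hl; have hm : m \in p by apply/onthP; exists l.
    have il := onth_index up hl.
    move: (hl); rewrite hp; case: ifP => // h /Some_inj em.
    have tab b : nptr runG b t m = omap (fun x => (m.1 + hcode x.1, x.2))
        (if b then (info m).2.2 else (info m).2.1).
      by rewrite /nptr ht (pos _ hm) /= ffunE -surjective_pairing hm; case: m {hl hm il em}.
    split; rewrite tab /info il.
      rewrite hp; case: (ltnP l.+1 (size r)) => // h'; have [e1 e2] := hdir _ h'.
      by rewrite -em; congr (Some (_, _)).
    case: l hl h em {il hm tab} => [|l] hl h em //.
    have -> : cell p l.+1 = onth p l by [].
    rewrite hp (ltnW h); have [e1 e2] := hdir _ h.
    by rewrite -em; congr (Some (_, _)).
have hsym : unzip1 t = nodeword w.
  apply: eq_from_onth => i; rewrite onth_map ht onth_nodeword.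
  by case: ifP.
exists t, p; split=> //.
- split; first by exists w.
  apply/allP => a /onthP [i]; rewrite ht; case: ifP => // hi [<-].
  apply/forallP => c; rewrite ffunE; case: ifP => // hc.
  have [l hl [em il]] := inp _ hc; case: em => ei ec; rewrite /info il /=.
  apply/and3P; split.
  + by case: (l).
  + apply/implyP; case: l hl ei ec il => // hl ei ec _ _.
    by rewrite ec /= ei ea0 !eqxx.
  + case: ifP => h.
      have [z [d [-> e1 _ [s hs1 hs2]]]] := st _ h.
      have -> : dirof (nth a0 r l).1.2 (nth a0 r l.+1).1.2 = d.
        exact: dirofP e1.
      move: hs1; rewrite onth_nodeword -ei hi => -[->].
      by rewrite ec.
    have el : l = size r0 by move: h hl; rewrite /r /=; lia.
    have := onth_last a0 r0; rewrite -el -/r => /(onth_nth a0) en.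
    by rewrite ec /= en hlast hfin eqxx.
- apply: eq_from_onth => l; rewrite [LHS]onth_map [RHS]onth_map onth_nodeword hp sr ltnS.
  case: ifP => // hl /=; rewrite /olab.
  have hl' : l < size r by rewrite sr ltnS.
  have h : onth p l = Some (node l) by rewrite hp hl'.
  have hm : node l \in p by apply/onthP; exists l.
  rewrite ht (pos _ hm) /= /runlab /= ffunE hm /info (onth_index up h) /=.
  congr (Some (Some (_, _))).
  have : onth (map snd r) l = onth (rcons (map Some y) None) l by rewrite hy.
  rewrite onth_map -cats1 onth_cat size_map onth_map.
  have [u hu] := ltn_onth hl'; rewrite hu (onth_nth a0 _ _ _ hu) /=.
  case: ltnP => h2; first by have [v ->] := ltn_onth h2; case.
  rewrite [onth y l]onth_default //; have -> : l = size y by lia.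
  by rewrite subnn /= => -[].
Qed.

End RunTransducer.

(** * Bounding the number of visits by pumping *)

Lemma pigeon (S : finType) (f : nat -> S) (ls : seq nat) k :
  #|S| * k < size ls -> exists s, k < size [seq l <- ls | f l == s].
Proof.
move=> h; apply/existsP; apply: contraLR h; rewrite negb_exists => /forallP h.
have -> : size ls = \sum_(s : S) size [seq l <- ls | f l == s].
  elim: ls {h} => [|l ls IH]; first by rewrite big1.
  rewrite /= IH (bigD1 (f l)) //= [in RHS](bigD1 (f l)) //= eqxx /= addSn; congr (_ + _).+1.
  by apply: eq_bigr => s; rewrite eq_sym => /negbTE ->.
rewrite -leqNgt -sum_nat_const; apply: leq_sum => s _.
by rewrite leqNgt; apply: h.
Qed.

(** * The order of two nodes on the path *)

Section Marks.
Variables (T C : finType) (G : pgs T C).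
Implicit Types (t : seq T) (x y : nat * C).

Definition mset i x : {set C} := [set c | (i, c) == x].

(** The offset is the position of the first cell of [t]; it lets the factors of a word be marked
    separately. *)
Fixpoint marked off t x y : seq (T * ({set C} * {set C})) :=
  if t is a :: t' then (a, (mset off x, mset off y)) :: marked off.+1 t' x y else [::].

Definition unmarked t : seq (T * ({set C} * {set C})) := [seq (a, (set0, set0)) | a <- t].

Lemma marked_cat off u v x y :
  marked off (u ++ v) x y = marked off u x y ++ marked (off + size u) v x y.
Proof. by elim: u off => [|a u IH] off /=; rewrite ?addn0 // IH addSnnS. Qed.

Lemma marked_ext off off' v x y x' y' :
  (forall j, j < size v -> mset (off + j) x = mset (off' + j) x') ->
  (forall j, j < size v -> mset (off + j) y = mset (off' + j) y') ->
  marked off v x y = marked off' v x' y'.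
Proof.
elim: v off off' => //= a v IH off off' h1 h2.
have := h1 0; have := h2 0; rewrite !addn0 => -> // -> //; congr (_ :: _).
by apply: IH => j hj; rewrite !addSnnS; [apply: h1|apply: h2].
Qed.

Lemma marked_unmarked off v x y :
  (forall j, j < size v -> mset (off + j) x = set0) ->
  (forall j, j < size v -> mset (off + j) y = set0) ->
  marked off v x y = unmarked v.
Proof.
elim: v off => //= a v IH off h1 h2.
have := h1 0; have := h2 0; rewrite !addn0 => -> // -> //; congr (_ :: _).
by apply: IH => j hj; rewrite addSnnS; [apply: h1|apply: h2].
Qed.

Lemma onth_marked off t x y i : onth (marked off t x y) i =
  omap (fun a => (a, (mset (off + i) x, mset (off + i) y))) (onth t i).
Proof. by elim: t off i => [|a t IH] off [|i] //=; rewrite ?addn0 // IH addSnnS. Qed.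

Lemma size_marked off t x y : size (marked off t x y) = size t.
Proof. by elim: t off => //= a t IH off; rewrite IH. Qed.

Lemma unzip1_marked off t x y : unzip1 (marked off t x y) = t.
Proof. by elim: t off => //= a t IH off; rewrite IH. Qed.

(* A set closed under successors contains the node marked first but not the node marked second,
   so the second one comes earlier on the path. *)
Definition before_rel (w : seq (T * ({set C} * {set C}))) : Prop :=
  exists2 r : seq {set C}, size r = size w &
   annotates G (fun _ _ _ => true)
     (fun b _ (A : {set C}) c _ A' c' => b ==> (c \in A) ==> (c' \in A')) (unzip1 w) r /\
   all (fun z : T * ({set C} * {set C}) * {set C} => z.1.2.1 \subset z.2) (zip w r) /\
   has (fun z : T * ({set C} * {set C}) * {set C} =>
     [exists c, (c \in z.1.2.2) && (c \notin z.2)]) (zip w r).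

Lemma recog_before_rel : recog before_rel.
Proof.
pose f (z : (T * ({set C} * {set C})) * {set C}) := (z.1.1, z.2).
pose R (b : bool) (_ : T) (A : {set C}) (c : C) (_ : T) (A' : {set C}) (c' : C) :=
  b ==> (c \in A) ==> (c' \in A').
have r1 := recog_map f (recog_annotates G (fun _ _ _ => true) R).
apply: recog_ext (recog_proj (recog_and r1 (recog_and
  (recog_all (fun z : T * ({set C} * {set C}) * {set C} => z.1.2.1 \subset z.2))
  (recog_has (fun z : T * ({set C} * {set C}) * {set C} => [exists c, (c \in z.1.2.2) && (c \notin z.2)]))))) => w.
have e1 (r : seq {set C}) : size r = size w -> unzip1 (map f (zip w r)) = unzip1 w.
  by elim: w r => [|a w IH] [|c r] //= [h]; rewrite IH.
have e2 (r : seq {set C}) : size r = size w -> unzip2 (map f (zip w r)) = r.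
  by elim: w r {e1} => [|a w IH] [|c r] //= [h]; rewrite IH.
by split=> -[r sr h]; exists r => //; move: h; rewrite e1 ?e2.
Qed.

Lemma before_relP t p x y : ispath G t p -> x \in p -> y \in p ->
  before_rel (marked 0 t x y) <-> index y p < index x p.
Proof.
move=> hp hx hy; case: (hp) => p0 u m h; split.
- case=> r; rewrite size_marked => sr []; rewrite unzip1_marked => ann [/allP h1 /has_onth].
  case=> i [[[a [A1 A2]] A] [e]] /existsP [c] /=; rewrite ltnNge => h2.
  apply/negP => hxy; move: h2 => /andP [].
  move: e; rewrite onth_zip ?size_marked // onth_marked.
  case ea: (onth t i) => [a'|] //=; case eA: (onth r i) => [A'|] //= [_ _ <- <-].
  rewrite inE add0n => /eqP ey.
  suff key l n : index x p <= l -> onth p l = Some n -> inset r n.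
    by have := key _ _ hxy (index_onth hy); rewrite -ey /inset /= eA => ->.
  elim: l n => [|l IH] n.
    rewrite leqn0 => /eqP hi hl.
    have exn : x = n by apply: Some_inj; rewrite -hl -hi index_onth.
    have /npresE [b eb pb] : npres G t (n.1, n.2) by rewrite -surjective_pairing -m -exn.
    have [B eB] : exists B, onth r n.1 = Some B by apply: ltn_onth; rewrite sr (onth_lt eb).
    rewrite /inset eB; have hin : ((b, (mset n.1 x, mset n.1 y)), B) \in zip (marked 0 t x y) r.
      by apply/onthP; exists n.1; rewrite onth_zip ?size_marked // onth_marked eb /= eB add0n.
    by move/subsetP: (h1 _ hin) => /= /(_ n.2) -> //; rewrite inE exn -surjective_pairing.
  rewrite leq_eqVlt => /orP [/eqP hi|] hl.
    have exn : x = n by apply: Some_inj; rewrite -hl -hi index_onth.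
    have /npresE [b eb pb] : npres G t (n.1, n.2) by rewrite -surjective_pairing -m -exn.
    have [B eB] : exists B, onth r n.1 = Some B by apply: ltn_onth; rewrite sr (onth_lt eb).
    rewrite /inset eB; have hin : ((b, (mset n.1 x, mset n.1 y)), B) \in zip (marked 0 t x y) r.
      by apply/onthP; exists n.1; rewrite onth_zip ?size_marked // onth_marked eb /= eB add0n.
    by move/subsetP: (h1 _ hin) => /= /(_ n.2) -> //; rewrite inE exn -surjective_pairing.
  move=> hl'; have [[j d] hn'] := ltn_onth (ltnW (onth_lt hl')).
  have := IH _ hl hn'; case: n hl' => i' c' hl'.
  have [+ _] := h _ _ hn'; rewrite hl' /=.
  have /npresE [b eb pb] : npres G t (j, d) by rewrite -m; apply/onthP; exists l.
  have /npresE [b' eb' pb'] : npres G t (i', c') by rewrite -m; apply/onthP; exists l.+1.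
  have [B eB] : exists B, onth r j = Some B by apply: ltn_onth; rewrite sr (onth_lt eb).
  have [B' eB'] : exists B, onth r i' = Some B by apply: ltn_onth; rewrite sr (onth_lt eb').
  rewrite /nptr /= eb /inset /= eB eB'; case en: (ptr G true b d) => [[mv d2]|] //= [ej ed].
  rewrite {}ed in en.
  by have [_ /(_ _ _ _ _ _ _ en ej eb' eB') /= /implyP] := ann _ _ _ _ eb eB pb.
(* The certificate is the set of all nodes from [x] on. *)
- move=> hlt; pose P : pred (nat * C) := fun n => (n \in p) && (index x p <= index n p).
  exists (mkseq (fun i => [set c | P (i, c)]) (size t)); first by rewrite size_mkseq size_marked.
  rewrite unzip1_marked; split; [|split].
  + apply: annotates_mkseq => // -[] i j a a' c c' //= pn nn ea ea'; rewrite !inE.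
    apply/implyP => /andP [hin hix].
    have hl := index_onth hin; have [+ _] := h _ _ hl; rewrite nn.
    case e: (onth p _) => [n'|] //= [e1 e2].
    have en : n' = (j, c') by apply: raw_inj; rewrite /raw e1 e2.
    rewrite en in e; apply/andP; split; first by apply/onthP; exists (index (i, c) p).+1.
    by rewrite (onth_index u e) leqW.
  + apply/allP => z /onthP [i]; rewrite onth_zip ?size_mkseq ?size_marked // onth_marked.
    case ea: (onth t i) => [a|] //=; rewrite onth_mkseq (onth_lt ea) /= => -[<-] /=.
    by apply/subsetP => c; rewrite !inE add0n => /eqP ->; rewrite /P hx leqnn.
  + apply/has_onth; case: y hy hlt => i c hy hlt.
    have /npresE [a ea pa] : npres G t (i, c) by rewrite -m.
    exists i, ((a, (mset i x, mset i (i, c))), [set c | P (i, c)]); split.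
      by rewrite onth_zip ?size_mkseq ?size_marked // onth_marked ea onth_mkseq (onth_lt ea).
    apply/existsP; exists c; rewrite !inE eqxx /= /P hy /=.
    by rewrite -ltnNge.
Qed.

End Marks.

(** * Pumping and cutting loops of a run *)

Section Pump.
Variables (X Y B : finType) (N : smach X Y)
  (K : ktr (bool * option Y)%type (bool * option (option B))%type).
Hypothesis K_dom : forall t, kL (k := K) t -> exists y, map (ksym (k := K)) t = nodeword y.

Local Notation config := (sQ N * nat)%type.
(** A run has one configuration per cell of its node word, so the run and the tiling of [K] zip into
    a single word, and repeating or cutting a factor acts on both at once. *)
Definition item := (config * kT K)%type.
Definition ilab (u : item) : option Y := (ksym u.2).2.

Definition nletter (t : seq (kT K)) (n : nat * kC K) : option B :=
  obind (fun l : bool * option (option B) => obind id l.2) (olab (klab (k := K)) t n).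

Lemma pmap_nletter t p z :
  map (olab (klab (k := K)) t) p = map Some (nodeword z) -> pmap (nletter t) p = erase z.
Proof.
move=> e.
have -> : pmap (nletter t) p =
    pmap (obind (fun l : bool * option (option B) => obind id l.2)) (map (olab (klab (k := K)) t) p).
  by elim: (p) => //= n p' ->.
rewrite {}e.
have -> (s : seq (bool * option (option B))) :
    pmap (obind (fun l : bool * option (option B) => obind id l.2)) (map Some s) =
    pmap (obind id) (map snd s) by elim: s => //= n p' ->.
rewrite map_snd_nodeword -cats1 pmap_cat /= cats0 /erase.
by elim: (z) => //= b s ->.
Qed.

Variable w : seq X.
Let x := nodeword w.

Fixpoint runs (k : config) (s : seq item) : Prop :=
  if s is u :: s' then u.1 = k /\
    match s' with
    | [::] => ilab u = None /\ sfin N k.1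
    | _ => exists k1 y, [/\ ilab u = Some y, scan x k y k1 & runs k1 s']
    end
  else False.

Fixpoint seg (k : config) (s : seq item) (k' : config) : Prop :=
  if s is u :: s' then u.1 = k /\
    exists k1 y, [/\ ilab u = Some y, scan x k y k1 & seg k1 s' k']
  else k = k'.

Lemma runs_cat k a s : s <> [::] -> runs k (a ++ s) <-> exists2 k', seg k a k' & runs k' s.
Proof.
move=> s0; elim: a k => [|u a IH] k.
  by split=> [h|[k' <-]] //; exists k.
have e : runs k (u :: a ++ s) <-> u.1 = k /\
    exists k1 y, [/\ ilab u = Some y, scan x k y k1 & runs k1 (a ++ s)].
  rewrite [runs _ _]/=; case ea: (a ++ s) => [|v s'] //.
  by case: a {IH} ea => //= ea; case: s0.
rewrite -/(cat (u :: a) s) in e *; rewrite [(u :: a) ++ s]/=; apply: (iff_trans e); split.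
- case=> eu [k1 [y [h1 h2 /IH [k' h3 h4]]]]; exists k' => //=; split=> //.
  by exists k1, y.
- case=> k' /= [eu [k1 [y [h1 h2 h3]]]] h4; split=> //; exists k1, y; split=> //.
  by apply/IH; exists k'.
Qed.

Lemma seg_cat k a b k' : seg k (a ++ b) k' <-> exists2 k1, seg k a k1 & seg k1 b k'.
Proof.
elim: a k => [|u a IH] k /=; first by split=> [h|[k1 <-]] //; exists k.
split.
- case=> eu [k1 [y [h1 h2 /IH [k2 h3 h4]]]]; exists k2 => //; split=> //.
  by exists k1, y.
- case=> k2 [eu [k1 [y [h1 h2 h3]]]] h4; split=> //; exists k1, y; split=> //.
  by apply/IH; exists k2.
Qed.

Lemma runs_head k u s : runs k (u :: s) -> u.1 = k. Proof. by case. Qed.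

Lemma seg_head k u s k' : seg k (u :: s) k' -> u.1 = k. Proof. by case. Qed.

Lemma runs_srun s : runs (sq0 N, 0) s <-> srun (N := N) x (map (fun u => (u.1, ilab u)) s).
Proof.
case: s => //= u s; split.
- suff : runs (sq0 N, 0) (u :: s) -> u.1 = (sq0 N, 0) /\
    [/\ path (rstep (N := N) x) (u.1, ilab u) [seq (u.1, ilab u) | u <- s],
    (last (u.1, ilab u) [seq (u.1, ilab u) | u <- s]).2 = None &
    sfin N (last (u.1, ilab u) [seq (u.1, ilab u) | u <- s]).1.1].
    by move=> h /h [h1 [h2 h3 h4]].
  elim: s u (sq0 N, 0) => [|v s IH] u k.
    by case=> -> [h1 h2]; split.
  case=> eu [k1 [y [h1 h2 h3]]]; have [e1 [e2 e3 e4]] := IH _ _ h3.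
  by split=> //; split=> //=; rewrite e2 andbT /rstep /= h1 eu e1.
- case=> eu h2 h3 h4; rewrite -[_ /\ _]/(runs (sq0 N, 0) (u :: s)) -eu {eu}.
  elim: s u h2 h3 h4 => [|v s IH] u /=; first by move=> _ h3 h4; split.
  case/andP => h1 h2 h3 h4; split=> //.
  move: h1; rewrite /rstep /=; case e: (ilab u) => [y|] // h1.
  by exists v.1, y; split=> //; apply: IH.
Qed.

Definition good (s : seq item) (z : seq (option B)) :=
  runs (sq0 N, 0) s /\ exists p, [/\ kL (unzip2 s), ispath (kG K) (unzip2 s) p &
    map (olab (klab (k := K)) (unzip2 s)) p = map Some (nodeword z)].

Lemma good_rel s z : good s z -> exists y r, [/\ srun (N := N) x r,
  map snd r = rcons (map Some y) None, kt_rel K (nodeword y) (nodeword z) &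
  forall k, count (fun a => a.1 == k) r = count (fun a : item => a.1 == k) s].
Proof.
case=> /runs_srun h [p [hL hp hz]]; have [y hy] := K_dom hL.
exists y, (map (fun u => (u.1, ilab u)) s); split=> //.
- by rewrite -map_snd_nodeword -hy -!map_comp.
- by exists (unzip2 s), p.
- by move=> k; rewrite count_map.
Qed.

Lemma rel_good y z : srel N w y -> kt_rel K (nodeword y) (nodeword z) -> exists s, good s z.
Proof.
case=> r hr er [t [p [hL ht hp hz]]].
have st : size t = size r.
  move/(congr1 size): er; rewrite size_map size_rcons size_map -size_nodeword -ht.
  by rewrite size_map.
exists (zip (unzip1 r) t); split; last first.
  by exists p; rewrite unzip2_zip ?size_map ?st.
apply/runs_srun; rewrite [map _ _](_ : _ = r) //.
have e2 : map (fun a => (ksym (k := K) a).2) t = map snd r.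
  by rewrite er -map_snd_nodeword -ht -!map_comp.
elim: r t {er hr hL ht hp hz} st e2 => [|[k l] r IH] [|a t] //= [st] [e e2].
by rewrite IH // /ilab /= e.
Qed.

(** The part of [good] that depends on the tiling alone. It is recognizable, so it survives changes
    that respect the states of its automaton, and it provides some output for the changed tiling. *)
Definition labelled (t : seq (kT K)) := kL t /\
  pulled (kG K) (klab (k := K)) (fun zz => exists z : seq (option B), zz = nodeword z) t.

Lemma good_labelled s z : good s z -> labelled (unzip2 s).
Proof.
case=> _ [p [h1 h2 h3]]; split=> //; exists p, (nodeword z); split=> //.
by exists z.
Qed.

Lemma labelled_good s : runs (sq0 N, 0) s -> labelled (unzip2 s) -> exists z, good s z.
Proof.
by move=> h [h1 [p [zz [h2 h3 [z ez]]]]]; exists z; split=> //; exists p; split=> //; rewrite h3 ez.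
Qed.

Lemma seg_pump k b j : seg k b k -> seg k (flatten (nseq j b)) k.
Proof. by move=> h; elim: j => //= j IH; apply/seg_cat; exists k. Qed.

Lemma onth_pump (U : Type) (b : seq U) j m i : m < j -> i < size b ->
  onth (flatten (nseq j b)) (m * size b + i) = onth b i.
Proof.
elim: j m => // j IH [|m] hm hi /=; first by rewrite mul0n add0n onth_cat hi.
rewrite onth_cat mulSn -addnA ltnNge leq_addr /=.
by rewrite addKn IH.
Qed.

Section Fixed.
Variable D : dfa (kT K).
Hypothesis hD : forall t, reflect (labelled t) (dlang D t).
Variable M : nat.
Hypothesis hM : forall s z, good s z -> size (erase z) <= M.

Lemma drun_pump v s j : drun (D := D) s v = s -> drun s (flatten (nseq j v)) = s.
Proof. by move=> h; elim: j => //= j IH; rewrite drun_cat h. Qed.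

Lemma nletter_tile t t' i i' c : onth t i = onth t' i' -> nletter t (i, c) = nletter t' (i', c).
Proof. by rewrite /nletter /olab /= => ->. Qed.

Lemma npres_tile (t t' : seq (kT K)) i i' c : onth t i = onth t' i' ->
  npres (kG K) t (i, c) = npres (kG K) t' (i', c).
Proof. by rewrite /npres /= => ->. Qed.

(** Repeating a loop that returns to the same state of [D] keeps the tiling labelled. A visible
    letter inside it would occur once per round in the output, more than [M] times in all. *)
Lemma no_letters a b c k z : good (a ++ b ++ c) z ->
  seg (sq0 N, 0) a k -> seg k b k -> runs k c ->
  drun (d0 D) (unzip2 (a ++ b)) = drun (d0 D) (unzip2 a) ->
  forall i ch, size a <= i < size a + size b ->
    npres (kG K) (unzip2 (a ++ b ++ c)) (i, ch) -> nletter (unzip2 (a ++ b ++ c)) (i, ch) = None.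
Proof.
move=> hg sa sb rc ed i ch /andP [h1 h2] pn; case el: (nletter _ _) => [l|] //; exfalso.
have c0 : c <> [::] by case: (c) rc.
(* One round more than the bound on the output; [J] is abstract to keep [nseq J] folded. *)
have [J hJ] : {J | J = M.+1} by exists M.+1.
pose s := a ++ flatten (nseq J b) ++ c.
have rs : runs (sq0 N, 0) s.
  apply/runs_cat; first by case: flatten => //; case: (c) c0.
  exists k => //; apply/runs_cat => //; exists k => //; exact: seg_pump.
have us : unzip2 s = unzip2 a ++ flatten (nseq J (unzip2 b)) ++ unzip2 c.
  rewrite /s /unzip2 !map_cat; congr (_ ++ (_ ++ _)).
  by rewrite map_flatten map_nseq.
have ls : labelled (unzip2 s).
  apply/hD; have /hD := good_labelled hg; rewrite /dlang us.
  have eb : drun (drun (d0 D) (unzip2 a)) (unzip2 b) = drun (d0 D) (unzip2 a).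
    by rewrite -drun_cat -ed /unzip2 map_cat.
  have -> : unzip2 (a ++ b ++ c) = unzip2 a ++ unzip2 b ++ unzip2 c by rewrite /unzip2 !map_cat.
  have e1 v : drun (drun (d0 D) (unzip2 a)) (v ++ unzip2 c) =
    drun (drun (drun (d0 D) (unzip2 a)) v) (unzip2 c) by rewrite drun_cat.
  by rewrite drun_cat e1 eb drun_cat e1 drun_pump.
have [z' hg'] := labelled_good rs ls.
have := hM hg'; case: hg' => _ [p [_ hp hz]].
rewrite -(pmap_nletter hz) size_pmap -size_filter leqNgt => /negP; apply; rewrite -hJ.
(* The copy of the visible node in round [m]; distinct rounds give distinct nodes of the pumped
   path. *)
pose f m := (size a + (m * size b + (i - size a)), ch).
have -> : J = size (map f (iota 0 J)) by rewrite size_map size_iota.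
have hb : i - size a < size b by lia.
apply: uniq_leq_size.
  rewrite map_inj_uniq ?iota_uniq // => m m' [].
  move/eqP; rewrite !eqn_add2l eqn_add2r eqn_mul2r; case/orP => /eqP //; lia.
move=> n /mapP [m]; rewrite mem_iota add0n => /andP [_ hm] ->; rewrite mem_filter.
have et : onth (unzip2 (a ++ b ++ c)) i = onth (unzip2 s) (f m).1.
  rewrite /unzip2 !onth_map /f /= /s !onth_cat ltnNge h1 hb /=.
  rewrite ltnNge leq_addr /= addKn.
  have -> : size (flatten (nseq J b)) = J * size b.
    by elim: (J) => //= j IH; rewrite size_cat IH mulSn.
  have -> : m * size b + (i - size a) < J * size b.
    apply: (@leq_trans (m.+1 * size b)); first by rewrite mulSn addnC ltn_add2r.
    by rewrite leq_mul2r hm orbT.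
  by rewrite onth_pump.
rewrite -(nletter_tile _ et) el /=.
case: hp => _ _ -> _; by rewrite -(npres_tile _ et).
Qed.

Section Cut.
Variable Db : dfa (kT K * ({set kC K} * {set kC K}))%type.
Hypothesis hDb : forall v, reflect (before_rel (kG K) v) (dlang Db v).
Variables (u v1 v2 u' : seq (kT K)).
Let t := u ++ v1 ++ v2 ++ u'.
Let t' := u ++ v1 ++ u'.
Variables (p p' : seq (nat * kC K)).
Hypotheses (hp : ispath (kG K) t p) (hp' : ispath (kG K) t' p').
Hypothesis hn : forall i ch, size u <= i < size u + (size v1 + size v2) ->
  npres (kG K) t (i, ch) -> nletter t (i, ch) = None.
Hypothesis hstep : forall st, drun (D := Db) st (unmarked (kC K) (v1 ++ v2)) =
  drun st (unmarked (kC K) v1).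

Definition outside (n : nat * kC K) :=
  (n.1 < size u) || (size u + size v1 + size v2 <= n.1).
Definition cutn (n : nat * kC K) : nat * kC K :=
  if n.1 < size u then n else (n.1 - size v2, n.2).

Lemma cut_tile n : outside n -> onth t n.1 = onth t' (cutn n).1.
Proof.
rewrite /outside /cutn /t /t' !onth_cat; case: ltnP => /= h; first by rewrite h.
move=> h'; have -> : n.1 - size v2 < size u = false by lia.
have -> : n.1 - size u < size v1 = false by lia.
have -> : n.1 - size u - size v1 < size v2 = false by lia.
have -> : n.1 - size v2 - size u < size v1 = false by lia.
by congr onth; lia.
Qed.

Lemma letter_outside n : n \in p -> nletter t n -> outside n.
Proof.
case: n => i c; case: (hp) => _ _ -> _ pn h; rewrite /outside /=.
by apply/negPn/negP => h'; move: h; rewrite hn //; lia.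
Qed.

Lemma mset0 i (n : nat * kC K) : i <> n.1 -> mset i n = set0.
Proof.
case: n => j c h; apply/setP => d; rewrite !inE; apply/eqP => -[e _].
exact: h.
Qed.

(** Nodes outside the loop leave [v1] and [v2] unmarked, and by [hstep] reading [v2] after [v1] does
    not change the state of [Db]. So the automaton for the order cannot notice that [v2] is gone. *)
Lemma cut_marked n m : outside n -> outside m ->
  dlang Db (marked 0 t n m) = dlang Db (marked 0 t' (cutn n) (cutn m)).
Proof.
move=> hno hmo; rewrite /t /t' !marked_cat /dlang !drun_cat !add0n.
have e1 q : outside q -> forall j, j < size u -> mset (0 + j) q = mset (0 + j) (cutn q).
  move=> ho j hj; rewrite /cutn; case: ltnP => h //.
  by rewrite !mset0 //=; move: ho; rewrite /outside; lia.
have e2 q : outside q -> forall j, j < size v1 -> mset (size u + j) q = set0.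
  by move=> ho j hj; rewrite mset0 //; move: ho; rewrite /outside; lia.
have e3 q : outside q -> forall j, j < size v2 -> mset (size u + size v1 + j) q = set0.
  by move=> ho j hj; rewrite mset0 //; move: ho; rewrite /outside; lia.
have e4 q : outside q -> forall j, j < size v1 -> mset (size u + j) (cutn q) = set0.
  move=> ho j hj; rewrite mset0 //; move: ho; rewrite /outside /cutn.
  by case: ifP => /=; lia.
have e5 q : outside q -> forall j, j < size u' ->
    mset (size u + size v1 + size v2 + j) q = mset (size u + size v1 + j) (cutn q).
  move=> ho j hj; move: (ho); rewrite /outside /cutn; case: ltnP => /= h h'.
    by rewrite !mset0 //; lia.
  apply/setP => c; rewrite !inE; case: (q) h h' => i d /= h h'; rewrite !xpair_eqE; congr (_ && _).
  lia.
rewrite (marked_ext (e1 _ hno) (e1 _ hmo)) (marked_ext (e5 _ hno) (e5 _ hmo)).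
rewrite (marked_unmarked (e2 _ hno) (e2 _ hmo)) (marked_unmarked (e3 _ hno) (e3 _ hmo)).
rewrite (marked_unmarked (e4 _ hno) (e4 _ hmo)).
have e st : drun (D := Db) (drun st (unmarked (kC K) v1)) (unmarked (kC K) v2) =
    drun st (unmarked (kC K) v1).
  by rewrite -drun_cat -[in RHS]hstep /unmarked map_cat.
by rewrite e.
Qed.

Lemma sorted_index (s : seq (nat * kC K)) : uniq s ->
  sorted (fun n m => index n s < index m s) s.
Proof.
move=> us; have -> : sorted (fun n m => index n s < index m s) s = sorted ltn (map (index^~ s) s).
  by rewrite sorted_map.
have -> : map (index^~ s) s = iota 0 (size s).
  case es: s us => [//|n0 s'] us; rewrite -es in us *.
  apply: (@eq_from_nth _ 0); rewrite ?size_map ?size_iota // => i hi.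
  by rewrite (nth_map n0) // index_uniq // nth_iota.
exact: iota_ltn_sorted.
Qed.

(** Blank nodes may be strung together quite differently on [p'], so only visible nodes are
    compared. They correspond under [cutn] and appear on both sides in the order of the respective
    path, which [cut_marked] shows to be the same. *)
Lemma cut_letters : pmap (nletter t) p = pmap (nletter t') p'.
Proof.
have pf (g : nat * kC K -> option B) s : pmap g s = pmap g (filter g s).
  by elim: s => //= n s ->; case e: (g n) => [l|] //=; rewrite e.
rewrite pf [RHS]pf.
case: (hp) => _ up mp _; case: (hp') => _ up' mp' _.
have ho n : n \in [seq n <- p | nletter t n] -> outside n.
  by rewrite mem_filter => /andP [h1 h2]; apply: letter_outside.
have hl n : outside n -> nletter t n = nletter t' (cutn n).
  case: n => i c h; have := cut_tile h; rewrite /cutn; case: ifP => _ e; exact: nletter_tile e.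
have hpr n : outside n -> npres (kG K) t n = npres (kG K) t' (cutn n).
  case: n => i c h; have := cut_tile h; rewrite /cutn; case: ifP => _ e; exact: npres_tile e.
suff <- : map cutn [seq n <- p | nletter t n] = [seq n <- p' | nletter t' n].
  elim: [seq n <- p | nletter t n] ho => //= n s IH ho.
  rewrite hl ?ho ?mem_head // IH // => m hm; apply: ho; by rewrite inE hm orbT.
apply: (@irr_sorted_eq _ (fun n m => index n p' < index m p')).
- by move=> a b c h1 h2; apply: ltn_trans h1 h2.
- by move=> a; rewrite ltnn.
- rewrite sorted_map.
  apply: (@sub_in_sorted _ (mem [seq n <- p | nletter t n]) (fun n m => index n p < index m p)).
  + move=> n m hn1 hm1 /=.
    have hin q : q \in [seq n <- p | nletter t n] -> q \in p /\ cutn q \in p'.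
      move=> hq; have := ho _ hq; move: hq; rewrite mem_filter => /andP [_ hq] hoq.
      by split=> //; rewrite mp' -hpr // -mp.
    have [n1 n2] := hin _ hn1; have [m1 m2] := hin _ hm1.
    move/(before_relP hp m1 n1)/hDb; rewrite cut_marked ?ho //.
    by move/hDb/(before_relP hp' m2 n2).
  + by apply/allP.
  + apply: sorted_filter; last exact: sorted_index.
    by move=> a b c h1 h2; apply: ltn_trans h1 h2.
- apply: sorted_filter; last exact: sorted_index.
  by move=> a b c h1 h2; apply: ltn_trans h1 h2.
- move=> n; apply/mapP/idP.
  + case=> m hm ->; have := ho _ hm; move: hm; rewrite !mem_filter => /andP [h1 h2] hom.
    by rewrite -hl // h1 mp' -hpr // -mp.
  + rewrite mem_filter => /andP [h1 h2].
    pose m := if n.1 < size u then n else (n.1 + size v2, n.2).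
    have hom : outside m.
      rewrite /outside /m; case: (ltnP n.1 (size u)) => h /=; first by rewrite h.
      apply/orP; right; rewrite leqNgt; apply/negP => h'.
      (* A cell of [t'] within [v1] is the same cell of [t], where no present node is visible. *)
      have et : onth t n.1 = onth t' n.1.
        rewrite /t /t' !onth_cat ltnNge h /=.
        pose q : nat := n.1.
        have -> : n.1 - size u < size v1; last by [].
        by rewrite -/q; rewrite -/q in h h'; move: q h h' => q; lia.
      move: h1 h2; rewrite mp'; case: (n) et h h' => i c /= et h h'.
      rewrite -(nletter_tile c et) -(npres_tile c et) => h1 h2.
      by move: h1; rewrite hn //; lia.
    have em : cutn m = n.
      rewrite /cutn /m; case: (ltnP n.1 (size u)) => h; first by rewrite h.
      rewrite /= ltnNge (leq_trans h (leq_addr _ _)) /= addnK.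
      by case: (n).
    exists m => //; rewrite mem_filter hl // em h1 mp hpr // em.
    by rewrite -mp'.
Qed.

End Cut.
End Fixed.
End Pump.

(** As long as some configuration is visited too often, a loop can be cut that leaves the visible
    output alone, and the run gets shorter. The intermediate word may change on the way, and so may
    the blanks in the output. *)
Lemma pump (X Y B : finType) (N : smach X Y)
  (K : ktr (bool * option Y)%type (bool * option (option B))%type) :
  (forall t, kL (k := K) t -> exists y, map (ksym (k := K)) t = nodeword y) ->
  exists n, forall w M y z,
  (forall y z, srel N w y -> kt_rel K (nodeword y) (nodeword z) -> size (erase z) <= M) ->
  srel N w y -> kt_rel K (nodeword y) (nodeword z) ->
  exists y' r z', [/\ srun (N := N) (nodeword w) r, map snd r = rcons (map Some y') None,
    bounded_run n.+1 r, kt_rel K (nodeword y') (nodeword z') & erase z' = erase z].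
Proof.
move=> K_dom.
have [D hD] : recog (@labelled Y B K).
  by apply: recog_and; [apply: krec | apply: recog_pulled (recog_nodeword _)].
have [Db hDb] := recog_before_rel (kG K).
pose F : finType := {ffun dS Db -> dS Db}.
(* More visits than this leave more than [#|F|.+1] of them with the same state of [D]. Apart from
   the first one, [l0], these are more than [#|F|], so two of them have the same effect on [Db]. *)
exists (#|dS D| * #|F|.+1) => w M y z hM hy hz.
have hMg s z' : good (N := N) (K := K) w s z' -> size (erase z') <= M.
  by move/(good_rel K_dom) => [y' [r [h1 h2 h3 _]]]; apply: (hM y') => //; exists r.
suff [s [z' [hs eb hbd]]] : exists s z', [/\ good (N := N) (K := K) w s z', erase z' = erase z &
    forall k, count (fun a : item N K => a.1 == k) s <= (#|dS D| * #|F|.+1).+1].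
  have [y' [r [h1 h2 h3 h4]]] := good_rel K_dom hs.
  by exists y', r, z'; split=> // k; rewrite h4.
have [s0 hs0] := rel_good hy hz.
have : exists z', good (N := N) (K := K) w s0 z' /\ erase z' = erase z by exists z.
have [m] := ubnP (size s0); elim: m s0 {hs0} => // m IH s hm [z' [hs ez]].
set n := #|dS D| * #|F|.+1.
case hb : (has (fun a => n.+1 < count (fun b : item N K => b.1 == a.1) s) s); last first.
  exists s, z'; split=> // k; rewrite leqNgt; apply/negP => hc.
  have : has (fun b : item N K => b.1 == k) s by rewrite has_count; apply: leq_ltn_trans hc.
  case/has_onth => i [a [ea /eqP ek]]; move/negP: hb; apply.
  by apply/has_onth; exists i, a; rewrite ek.
move/has_onth: hb => [i0 [a [_]]]; set k := a.1 => hc.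
pose ls := [seq l <- iota 0 (size s) | (nth a s l).1 == k].
have hls : n < size ls.
  apply: ltnW; move: hc; rewrite -[in X in count _ X](mkseq_nth a s) /mkseq count_map size_filter.
  by rewrite (eq_count (a2 := fun l => (nth a s l).1 == k)).
pose f l := drun (d0 D) (unzip2 (take l s)).
have [st hst] := pigeon f hls.
set ls1 := [seq l <- ls | f l == st] in hst.
have so : sorted ltn ls1 by do 2!apply: (sorted_filter ltn_trans); exact: iota_ltn_sorted.
have inls l : l \in ls1 -> [/\ l < size s, (nth a s l).1 = k & f l = st].
  rewrite !mem_filter mem_iota add0n => /andP [/eqP h1 /andP [/eqP h2 h3]].
  by split.
case els : ls1 hst so => [//|l0 rest] /= hst so.
(* The effect on [Db] of the tiles between [l0] and [l]. Equal effects at [qi] and [qj] say that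
   [V1 ++ V2] acts like [V1], so [V2] can be cut while [V1] stays. *)
pose g l : F := [ffun q => drun (D := Db) q (unmarked (kC K) (unzip2 (drop l0 (take l s))))].
have : ~~ uniq (map g rest).
  apply: contraL hst => ug; rewrite -leqNgt ltnS.
  have := max_card (mem (map g rest)); by move/card_uniqP: ug => ->; rewrite size_map.
case/(uniqPn (g 0)) => i [j [hij]]; rewrite size_map => hj.
rewrite !(nth_map 0) //; last exact: ltn_trans hij hj.
have hi := ltn_trans hij hj.
set qi := nth 0 rest i; set qj := nth 0 rest j => eg.
have [h0s h0k h0f] : [/\ l0 < size s, (nth a s l0).1 = k & f l0 = st].
  by apply: inls; rewrite els mem_head.
have [his hik hif] : [/\ qi < size s, (nth a s qi).1 = k & f qi = st].
  by apply: inls; rewrite els inE mem_nth ?orbT.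
have [hjs hjk hjf] : [/\ qj < size s, (nth a s qj).1 = k & f qj = st].
  by apply: inls; rewrite els inE mem_nth ?orbT.
have l0i : l0 < qi.
  by have /allP := order_path_min ltn_trans so; apply; apply: mem_nth.
have qij : qi < qj.
  by apply: (sorted_ltn_nth ltn_trans 0 (path_sorted so)).
pose A := take l0 s; pose V1 := drop l0 (take qi s); pose V2 := drop qi (take qj s).
pose E := drop qj s.
have eqi : take qi s = A ++ V1.
  by rewrite -[LHS](cat_take_drop l0) take_takel // ltnW.
have eqj : take qj s = take qi s ++ V2.
  by rewrite -[LHS](cat_take_drop qi) take_takel // ltnW.
have ed : drop l0 (take qj s) = V1 ++ V2.
  by rewrite eqj eqi -catA drop_size_cat // size_take h0s.
have es : s = A ++ (V1 ++ V2) ++ E.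
  by rewrite -[LHS](cat_take_drop qj) eqj eqi -!catA.
have hr : runs w (sq0 N, 0) s by case: hs.
have split_at l : l < size s -> (nth a s l).1 = k ->
    seg w (sq0 N, 0) (take l s) k /\ runs w k (drop l s).
  move=> hl hk; have e := drop_nth a hl.
  have := hr; rewrite -[in X in X -> _](cat_take_drop l s) => /runs_cat [|k1 h1 h2].
    by rewrite e.
  by move: (h2); rewrite {1}e => /runs_head; rewrite hk => ->.
have [sA rA] := split_at _ h0s h0k.
have [si ri] := split_at _ his hik.
have [sj rj] := split_at _ hjs hjk.
have sV1 : seg w k V1 k.
  move: si; rewrite eqi => /seg_cat [k1 _ h2].
  move: (h2); rewrite {1}/V1 (drop_nth a) ?size_take ?his // => /seg_head.
  by rewrite nth_take // h0k => e; move: h2; rewrite -e.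
have sV2 : seg w k V2 k.
  move: sj; rewrite eqj => /seg_cat [k1 _ h2].
  move: (h2); rewrite {1}/V2 (drop_nth a) ?size_take ?hjs // => /seg_head.
  by rewrite nth_take // hik => e; move: h2; rewrite -e.
have hs2 : good w (A ++ (V1 ++ V2) ++ E) z' by rewrite -es.
have sV12 : seg w k (V1 ++ V2) k by apply/seg_cat; exists k.
(* The loop pumped here is [V1 ++ V2], since [V1] has to be silent too: its visible nodes would
   carry marks, while equal effects are known for unmarked factors only. *)
have hn := no_letters hD hMg hs2 sA sV12 rj.
have hn' : forall ic ch, size A <= ic < size A + size (V1 ++ V2) ->
   npres (kG K) (unzip2 s) (ic, ch) -> nletter (unzip2 s) (ic, ch) = None.
  rewrite [in unzip2 s]es; apply: hn.
  by rewrite -ed -[A ++ _]/(A ++ _) ed catA -eqi -eqj -/(f qj) -/(f l0) hjf h0f.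
have rs' : runs w (sq0 N, 0) (take qi s ++ E).
  by apply/runs_cat; [rewrite /E (drop_nth a) | exists k].
have [z2 hz2] : exists z2, good w (take qi s ++ E) z2.
  apply: labelled_good rs' _; apply/hD.
  have /hD := good_labelled hs; rewrite /dlang -[in X in X -> _](cat_take_drop qj s).
  rewrite /unzip2 !map_cat !drun_cat -/unzip2.
  by rewrite -/(f qj) -/(f qi) hjf hif.
have ez2 : erase z2 = erase z'.
  case: (hs) => _ [p1 [_ hp1 hz1]]; case: hz2 => _ [p2 [_ hp2 hzz2]].
  rewrite -(pmap_nletter hz1) -(pmap_nletter hzz2).
  have e1 : unzip2 s = unzip2 A ++ unzip2 V1 ++ unzip2 V2 ++ unzip2 E.
    by rewrite es /unzip2 !map_cat -!catA.
  have e2 : unzip2 (take qi s ++ E) = unzip2 A ++ unzip2 V1 ++ unzip2 E.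
    by rewrite eqi /unzip2 !map_cat -!catA.
  rewrite e1 in hp1 hn' *; rewrite e2 in hp2 *; symmetry.
  apply: (cut_letters hDb hp1 hp2).
    by move=> ic ch h; apply: hn'; move: h; rewrite size_cat !size_map.
  move=> q; have := congr1 (fun h : F => h q) eg; rewrite !ffunE ed -/V1 => ->.
  by rewrite /unzip2 map_cat.
apply: (IH (take qi s ++ E)); last by exists z2; rewrite ez2.
rewrite size_cat size_take his size_drop; move: hm; lia.
Qed.

(** * Path transducers for compositions of 2gsm's *)

Section Identity.
Variable Y : finType.
Local Notation cellY := (bool * option (option Y))%type.

Definition idG : pgs cellY unit :=
  Pgs (fun _ _ => true) (fun b (a : cellY) _ =>
    if b then if a.2 is None then None else Some (MRight, tt)
    else if a.1 then None else Some (MLeft, tt)).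

Definition kid : ktr cellY cellY :=
  Ktr idG id (fun (a : cellY) _ => a) (recog_nodeword (option Y)).

Lemma kid_rel (y : seq (option Y)) zz : kt_rel kid (nodeword y) zz <-> zz = nodeword y.
Proof.
pose p := mkseq (fun i => (i, tt)) (size y).+1.
have hp : ispath idG (nodeword y) p.
  split=> //.
  - by apply: mkseq_uniq => i j [].
  - move=> [i []]; rewrite /npres /= onth_nodeword; apply/idP/idP.
      by case/mapP => j; rewrite mem_iota add0n => /andP [_]; rewrite ltnS => hj [->]; rewrite hj.
    by case: ifP => // hi _; apply/mapP; exists i; rewrite // mem_iota.
  - move=> l n; rewrite !onth_mkseq ltnS; case: ifP => // hl [<-]; split.
      rewrite /nptr /= onth_nodeword hl /=; case: ltnP => h.
        by have [o ->] := ltn_onth h; rewrite /= /raw /= addn2.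
      by rewrite onth_default.
    rewrite /nptr /= onth_nodeword hl /=; case: l hl => //= l hl.
    by rewrite onth_mkseq ltnS (ltnW hl) /= /raw /= addn0.
have hl : map (olab (klab (k := kid)) (nodeword y)) p = map Some (nodeword y).
  apply: eq_from_onth => i; rewrite [LHS]onth_map [RHS]onth_map onth_mkseq ltnS.
  by rewrite /olab /=; case: leqP => hi; rewrite /= onth_nodeword ?hi //= leqNgt hi.
split=> [[t [p' [_ /= ht hp' hz]]]|->].
  rewrite map_id in ht; subst t.
  by move: hz; rewrite -(path_uniq hp hp') hl => /(inj_map (@Some_inj _)).
by exists (nodeword y), p; split=> //=; [exists y | rewrite map_id].
Qed.

End Identity.

(* [K] computes [m] on padded words, completely only where [m] is finite. *)
Definition implements (A B : finType)
    (K : ktr (bool * option (option A))%type (bool * option (option B))%type)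
    (m : seq A -> seq B -> Prop) :=
  (forall t, kL (k := K) t -> exists y, map (ksym (k := K)) t = nodeword y) /\
  forall w, (forall z, kt_rel K (nodeword w) (nodeword z) -> m (erase w) (erase z)) /\
   ((exists s : seq (seq B), forall z, m (erase w) z -> z \in s) ->
    forall z, m (erase w) z -> exists2 z', kt_rel K (nodeword w) (nodeword z') & erase z' = z).

Lemma kid_implements (B : finType) : implements (kid B) eq.
Proof.
split=> [t [y ->]|w]; first by exists y; rewrite /= map_id.
split=> [z /kid_rel /nodeword_inj -> //|_ z <-].
by exists w => //; apply/kid_rel.
Qed.

(** If the composition is finite at the input, then [m] is finite at every intermediate word that
    [M] reaches from it, so [K] is complete there. The outputs of the composition are thus bounded
    in length, and [pump] supplies a run with few visits. *)
Lemma implements_comp (A C B : finType) (M : gsm2 A C) K (m : seq C -> seq B -> Prop) :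
  implements K m ->
  exists K', implements K' (fun (w : seq A) z => exists y, gsm_rel M w y /\ m y z).
Proof.
case=> K_dom hK; have [n hn] := pump (sim M) K_dom.
exists (kcomp (runK (sim M) n) K); split.
  move=> t [[[w hw] _] _]; exists w.
  by rewrite -hw /unzip1 -map_comp.
move=> w; split.
  move=> z /kcompP [yy /runK_sound [y -> hy] hz]; exists (erase y); split.
    exact: sim_sound.
  by case: (hK y) => h _; apply: h.
case=> s hs z [y [/sim_complete [ys hys <-] hm]].
have [z' hz' <-] : exists2 z', kt_rel K (nodeword ys) (nodeword z') & erase z' = z.
  case: (hK ys) => _ h; apply: h => //; exists s => z1 hz1; apply: hs.
  by exists (erase ys); split=> //; apply: sim_sound.
(* The bound on the outputs is the greatest length in the finite list [s]. *)
have [|y' [r [z2 [h1 h2 h3 h4 h5]]]] := hn w (foldr (fun u n => maxn (size u) n) 0 s) ys z' _ hys hz'.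
  move=> y1 z1 hy1 hz1.
  have : erase z1 \in s.
    apply: hs; exists (erase y1); split; first exact: sim_sound.
    by case: (hK y1) => h _; apply: h.
  elim: (s) => //= u s' IH; rewrite inE => /orP [/eqP ->|/IH h]; first exact: leq_maxl.
  by apply: leq_trans h (leq_maxr _ _).
exists z2 => //; apply/kcompP; exists (nodeword y') => //.
exact: runK_complete h1 h2 h3.
Qed.

Lemma implements_ext (A B : finType) K (m m' : seq A -> seq B -> Prop) :
  (forall w z, m w z <-> m' w z) -> implements K m -> implements K m'.
Proof.
move=> e [h1 h2]; split=> // w; have [h3 h4] := h2 w; split=> [z /h3 /e //|[s hs] z /e hz].
by apply: h4 => //; exists s => z' /e /hs.
Qed.

(** The induction starts at the last machine, which is put in front of the identity; each further
    machine is put in front of the transducer obtained so far. *)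
Lemma NGSMk_implements (A B : finType) k (m : seq A -> seq B -> Prop) :
  NGSMk k m -> exists K, implements K m.
Proof.
elim=> {A B k m} [A B M m hm|A C B k M m' m _ [K hK] hm].
  have [K hK] := implements_comp M (kid_implements B).
  exists K; apply: implements_ext hK => w z; rewrite hm; split=> [[y [h <-]]|h] //.
  by exists z.
have [K' hK'] := implements_comp M hK.
by exists K'; apply: implements_ext hK' => w z; rewrite hm.
Qed.

(** * Formulas for automata *)

Section Formulas.
Variables (S : eqType) (G : Type).
Implicit Types (f : mso S G).

(** The syntax has no constants. This sentence has no free variables and holds in the empty graph as
    well. *)
Definition ftrue : mso S G := FNot (FEx1 0 (FNot (FEq S G 0 0))).
Definition fall1 x f : mso S G := FNot (FEx1 x (FNot f)).
Definition fall2 x f : mso S G := FNot (FEx2 x (FNot f)).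
Definition fimp f f' : mso S G := FOr (FNot f) f'.
Definition fands (fs : seq (mso S G)) : mso S G := foldr (@FAnd S G) ftrue fs.
Definition fors (fs : seq (mso S G)) : mso S G := FNot (fands (map (@FNot S G) fs)).
Definition fexs2 (xs : seq nat) f : mso S G := foldr (@FEx2 S G) f xs.

Variable g : graph S G.
Implicit Types (nu : nat -> option (gV g)) (mu : nat -> {set gV g}).

Lemma sat_true nu mu : sat nu mu ftrue.
Proof. by apply/negP => /existsP [v]; rewrite /= eqxx. Qed.

Lemma sat_all1 nu mu x f : sat nu mu (fall1 x f) = [forall v, sat (upd nu x (Some v)) mu f].
Proof.
by rewrite /fall1 /fall2 /= negb_exists; apply: eq_forallb => v; rewrite negbK.
Qed.

Lemma sat_all2 nu mu x f : sat nu mu (fall2 x f) = [forall A, sat nu (upd mu x A) f].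
Proof.
by rewrite /fall1 /fall2 /= negb_exists; apply: eq_forallb => v; rewrite negbK.
Qed.

Lemma sat_imp nu mu f f' : sat nu mu (fimp f f') = (sat nu mu f ==> sat nu mu f').
Proof. by rewrite /fimp /= implybE. Qed.

Lemma sat_ands nu mu fs : sat nu mu (fands fs) = all (sat nu mu) fs.
Proof. by elim: fs => [|f fs IH]; [rewrite sat_true | rewrite /= -IH]. Qed.

Lemma sat_ors nu mu fs : sat nu mu (fors fs) = has (sat nu mu) fs.
Proof.
rewrite /fors -[LHS]/(~~ sat nu mu (fands _)) sat_ands all_map -[RHS]negbK -all_predC.
by congr negb; apply: eq_all.
Qed.

Lemma sat_exs2 nu mu n k f : sat nu mu (fexs2 (iota n k) f) <->
  exists F : nat -> {set gV g}, sat nu (fun i => if n <= i < n + k then F i else mu i) f.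
Proof.
elim: k n mu => [|k IH] n mu.
  have e F : (fun i => if n <= i < n + 0 then F i else mu i) = mu.
    by apply: functional_extensionality => i; case: ifP => //; lia.
  split=> [h|[F]]; last by rewrite e.
  by exists (fun=> set0); rewrite e.
rewrite /=; split.
- case/existsP => A /IH [F h]; exists (fun i => if i == n then A else F i).
  move: h; congr (sat _ _ _); apply: functional_extensionality => i; rewrite /upd.
  case: (eqVneq i n) => [->|ne]; first by rewrite ltnn leqnn /= addnS ltnS leq_addr.
  by have -> : (n.+1 <= i < n.+1 + k) = (n <= i < n + k.+1) by lia.
- case=> F h; apply/existsP; exists (F n); apply/IH; exists F.
  move: h; congr (sat _ _ _); apply: functional_extensionality => i; rewrite /upd.
  case: (eqVneq i n) => [->|ne]; first by rewrite ltnn leqnn /= addnS ltnS leq_addr.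
  by have -> : (n.+1 <= i < n.+1 + k) = (n <= i < n + k.+1) by lia.
Qed.

Lemma fvn_ands (P : pred nat) fs : all P (fvn (fands fs)) = all (fun f => all P (fvn f)) fs.
Proof. by elim: fs => //= f fs <-; rewrite /fands /= all_cat. Qed.

Lemma fvs_ands (P : pred nat) fs : all P (fvs (fands fs)) = all (fun f => all P (fvs f)) fs.
Proof. by elim: fs => //= f fs <-; rewrite /fands /= all_cat. Qed.

Lemma fvn_ors (P : pred nat) fs : all P (fvn (fors fs)) = all (fun f => all P (fvn f)) fs.
Proof. by rewrite /fors /= fvn_ands all_map. Qed.

Lemma fvs_ors (P : pred nat) fs : all P (fvs (fors fs)) = all (fun f => all P (fvs f)) fs.
Proof. by rewrite /fors /= fvs_ands all_map. Qed.

Lemma sat_and nu mu f f' : sat nu mu (FAnd f f') = sat nu mu f && sat nu mu f'.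
Proof. by []. Qed.

Lemma fvn_true : fvn ftrue = [::]. Proof. by []. Qed.
Lemma fvs_true : fvs ftrue = [::]. Proof. by []. Qed.

Lemma fvn_all1 (P : pred nat) x f :
  all P (fvn (fall1 x f)) = all (fun y => (y != x) ==> P y) (fvn f).
Proof. by rewrite /= all_filter. Qed.

Lemma fvs_all1 x f : fvs (fall1 x f) = fvs f. Proof. by []. Qed.

Lemma fvn_all2 x f : fvn (fall2 x f) = fvn f. Proof. by []. Qed.

Lemma fvs_all2 (P : pred nat) x f :
  all P (fvs (fall2 x f)) = all (fun y => (y != x) ==> P y) (fvs f).
Proof. by rewrite /= all_filter. Qed.

Lemma fvn_imp (P : pred nat) f f' : all P (fvn (fimp f f')) = all P (fvn f) && all P (fvn f').
Proof. by rewrite /= all_cat. Qed.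

Lemma fvs_imp (P : pred nat) f f' : all P (fvs (fimp f f')) = all P (fvs f) && all P (fvs f').
Proof. by rewrite /= all_cat. Qed.

Lemma fvn_exs2 xs f : fvn (fexs2 xs f) = fvn f.
Proof. by elim: xs. Qed.

Lemma fvs_exs2 (P : pred nat) xs f : all (fun X => (X \in xs) || P X) (fvs f) ->
  all P (fvs (fexs2 xs f)).
Proof.
elim: xs P => //= x xs IH P h; rewrite all_filter.
apply: (IH (fun X => (X != x) ==> P X)).
by apply: sub_all h => X; rewrite inE; case: eqP => //=; case: (X \in xs).
Qed.

Lemma sat_iso (h : graph S G) (F : gV g -> gV h) f nu mu : bijective F ->
  (forall v, glab h (F v) = glab g v) ->
  (forall u c v, gE h (F u) c (F v) = gE g u c v) ->
  sat (g := h) (fun x => omap F (nu x)) (fun X => F @: mu X) f = sat nu mu f.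
Proof.
move=> bF hl he; have injF := bij_inj bF; case: (bF) => F' FK F'K.
have eu nu1 x v : (fun y => omap F (upd nu1 x (Some v) y)) = upd (fun y => omap F (nu1 y)) x (Some (F v)).
  by apply: functional_extensionality => y; rewrite /upd; case: eqP.
have em mu1 X (A : {set gV g}) : (fun y => F @: (upd mu1 X A y)) = upd (fun y => F @: mu1 y) X (F @: A).
  by apply: functional_extensionality => y; rewrite /upd; case: eqP.
elim: f nu mu => [s x|c x y|x y|x X|f IH|f IH f' IH'|f IH f' IH'|x f IH|X f IH] nu mu /=.
- by case: (nu x) => //= v; rewrite hl.
- by case: (nu x) (nu y) => [u|] [v|] //=; rewrite he.
- by case: (nu x) (nu y) => [u|] [v|] //=; rewrite (inj_eq injF).
- by case: (nu x) => //= v; rewrite mem_imset.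
- by rewrite IH.
- by rewrite IH IH'.
- by rewrite IH IH'.
- apply/existsP/existsP => -[v].
    by rewrite -{1}(F'K v) -eu IH => h1; exists (F' v).
  by rewrite -IH eu => h1; exists (F v).
- apply/existsP/existsP => -[A].
    have -> : A = F @: (F' @: A).
      by rewrite -imset_comp (eq_imset (g := id)) ?imset_id.
    by rewrite -em IH => h1; exists (F' @: A).
  by rewrite -IH em => h1; exists (F @: A).
Qed.

End Formulas.

#[global] Opaque ftrue fall1 fall2 fimp fands fors fexs2.

(** * String graphs in monadic second-order logic *)

Section WordFormulas.
Variable A : finType.
Local Notation form := (mso unit A).

Definition fedge x y : form := fors [seq FEdge unit c x y | c <- enum A].
Lemma fvn_edge (P : pred nat) x y : P x -> P y -> all P (fvn (fedge x y)).
Proof. by move=> hx hy; rewrite fvn_ors all_map; apply/allP => c _ /=; rewrite hx hy. Qed.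

Lemma fvs_edge (P : pred nat) x y : all P (fvs (fedge x y)).
Proof. by rewrite fvs_ors all_map; apply/allP. Qed.

Definition ffirst x y : form := fall1 y (FNot (fedge y x)).
Definition flast x y : form := fall1 y (FNot (fedge x y)).

Lemma fvn_first (P : pred nat) x y : P x -> all P (fvn (ffirst x y)).
Proof.
move=> hx; rewrite fvn_all1; apply: fvn_edge; last by rewrite hx implybT.
by rewrite eqxx.
Qed.

Lemma fvn_last (P : pred nat) x y : P x -> all P (fvn (flast x y)).
Proof.
move=> hx; rewrite fvn_all1; apply: fvn_edge; first by rewrite hx implybT.
by rewrite eqxx.
Qed.

Lemma fvs_first (P : pred nat) x y : all P (fvs (ffirst x y)).
Proof. exact: fvs_edge. Qed.

Lemma fvs_last (P : pred nat) x y : all P (fvs (flast x y)).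
Proof. exact: fvs_edge. Qed.

Section Sem.
Variable g : graph unit A.
Definition gadj (u v : gV g) := [exists c, gE g u c v].

Lemma sat_edge nu mu x y u v : nu x = Some u -> nu y = Some v ->
  sat (g := g) nu mu (fedge x y) = gadj u v.
Proof.
move=> hx hy; rewrite sat_ors has_map; apply/hasP/existsP => [[c _ /=]|[c h]].
  by rewrite hx hy; exists c.
by exists c; rewrite ?mem_enum //= hx hy.
Qed.

#[local] Opaque fedge.

Lemma sat_first nu mu x y u : x != y -> nu x = Some u ->
  sat (g := g) nu mu (ffirst x y) = [forall v, ~~ gadj v u].
Proof.
move=> ne hx; rewrite sat_all1; apply: eq_forallb => v.
rewrite /= (@sat_edge _ _ _ _ v u) // /upd ?eqxx //.
by rewrite (negbTE ne).
Qed.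

Lemma sat_last nu mu x y u : x != y -> nu x = Some u ->
  sat (g := g) nu mu (flast x y) = [forall v, ~~ gadj u v].
Proof.
move=> ne hx; rewrite sat_all1; apply: eq_forallb => v.
rewrite /= (@sat_edge _ _ _ _ u v) // /upd ?eqxx //.
by rewrite (negbTE ne).
Qed.
End Sem.

#[global] Opaque fedge ffirst flast.

(** Graph transductions receive arbitrary input graphs, so the domain formula has to reject those
    that are not of the form [ed w]. The last conjunct, induction over sets from a source, excludes
    closed cycles beside the path. *)
Definition is_string : form := fands [::
  fall1 2 (fall1 3 (fall1 4 (fimp (fands [:: fedge 2 3; fedge 2 4]) (FEq _ _ 3 4))));
  fall1 2 (fall1 3 (fall1 4 (fimp (fands [:: fedge 3 2; fedge 4 2]) (FEq _ _ 3 4))));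
  fall1 2 (fall1 3 (fands [seq (if p.1 == p.2 then ftrue _ _ else
     FNot (FAnd (FEdge unit p.1 2 3) (FEdge unit p.2 2 3))) | p <- enum {: A * A}]));
  FEx1 2 (FAnd (ffirst 2 3) (fall2 0 (fimp (fands [:: FIn _ _ 2 0;
     fall1 3 (fall1 4 (fimp (fands [:: FIn _ _ 3 0; fedge 3 4]) (FIn _ _ 4 0)))])
     (fall1 3 (FIn _ _ 3 0)))))].

Definition string_graph (g : graph unit A) :=
  [/\ forall u v w : gV g, gadj u v -> gadj u w -> v = w,
      forall u v w : gV g, gadj v u -> gadj w u -> v = w,
      forall (u v : gV g) c d, gE g u c v -> gE g u d v -> c = d &
      exists2 u : gV g, (forall v, ~~ gadj v u) &
        forall X : {set gV g}, u \in X -> (forall v w, v \in X -> gadj v w -> w \in X) -> forall v, v \in X].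

Lemma fvn_is_string : fvn is_string = [::].
Proof.
suff : all pred0 (fvn is_string) by case: (fvn is_string).
rewrite fvn_ands /= andbT; apply/and4P; split.
- by rewrite !fvn_all1 fvn_imp fvn_ands /= !fvn_edge.
- by rewrite !fvn_all1 fvn_imp fvn_ands /= !fvn_edge.
- rewrite !fvn_all1 fvn_ands all_map; apply/allP => -[c d] _ /=.
  by case: ifP => _ //=; rewrite fvn_true.
- rewrite all_filter all_cat fvn_first //= fvn_all2 fvn_imp fvn_ands /= fvn_all1 /=.
  by rewrite !fvn_all1 fvn_imp fvn_ands /= fvn_edge.
Qed.

Lemma fvs_is_string (P : pred nat) : all P (fvs is_string).
Proof.
rewrite fvs_ands /= andbT; apply/and4P; split.
- by rewrite !fvs_all1 fvs_imp fvs_ands /= !fvs_edge.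
- by rewrite !fvs_all1 fvs_imp fvs_ands /= !fvs_edge.
- rewrite !fvs_all1 fvs_ands all_map; apply/allP => -[c d] _ /=.
  by case: ifP => _ //=; rewrite fvs_true.
- rewrite all_cat fvs_first /= fvs_all2 fvs_imp fvs_ands /= !fvs_all1 /=.
  by rewrite fvs_imp fvs_ands /= fvs_edge.
Qed.

Lemma is_stringP g nu mu : sat (g := g) nu mu is_string <-> string_graph g.
Proof.
rewrite sat_ands /= andbT; split.
- case/and4P => h1 h2 h3 /existsP [u /andP [h4 h5]]; split.
  + move=> x y z hy hz; move: h1; rewrite sat_all1 => /forallP /(_ x).
    rewrite sat_all1 => /forallP /(_ y); rewrite sat_all1 => /forallP /(_ z).
    rewrite sat_imp sat_ands /= andbT (@sat_edge g _ _ _ _ x y) // (@sat_edge g _ _ _ _ x z) //.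
    by rewrite hy hz /= => /eqP.
  + move=> x y z hy hz; move: h2; rewrite sat_all1 => /forallP /(_ x).
    rewrite sat_all1 => /forallP /(_ y); rewrite sat_all1 => /forallP /(_ z).
    rewrite sat_imp sat_ands /= andbT (@sat_edge g _ _ _ _ y x) // (@sat_edge g _ _ _ _ z x) //.
    by rewrite hy hz /= => /eqP.
  + move=> x y c d hc hd; move: h3; rewrite sat_all1 => /forallP /(_ x).
    rewrite sat_all1 => /forallP /(_ y); rewrite sat_ands all_map => /allP /(_ (c, d)).
    rewrite mem_enum => /(_ isT) /=; case: eqP => //= ne.
    by rewrite hc hd.
  + exists u.
      by move: h4; rewrite (@sat_first g _ _ _ _ u) // => /forallP.
    move=> X hu hX v; move: h5; rewrite sat_all2 => /forallP /(_ X).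
    rewrite sat_imp sat_ands /= andbT hu /=.
    suff -> : sat (upd nu 2 (Some u)) (upd mu 0 X)
        (fall1 3 (fall1 4 (fimp (fands [:: FIn _ _ 3 0; fedge 3 4]) (FIn _ _ 4 0)))).
      by rewrite /= => h; have := h; rewrite sat_all1 => /forallP /(_ v).
    rewrite sat_all1; apply/forallP => x; rewrite sat_all1; apply/forallP => y.
    rewrite sat_imp sat_ands /= andbT (@sat_edge g _ _ _ _ x y) //.
    by apply/implyP => /andP [hx hxy]; apply: hX hxy.
- case=> h1 h2 h3 [u h4 h5]; apply/and4P; split.
  + rewrite sat_all1; apply/forallP => x; rewrite sat_all1; apply/forallP => y.
    rewrite sat_all1; apply/forallP => z; rewrite sat_imp sat_ands /= andbT.
    rewrite (@sat_edge g _ _ _ _ x y) // (@sat_edge g _ _ _ _ x z) //.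
    by apply/implyP => /andP [hy hz]; apply/eqP; apply: h1 hy hz.
  + rewrite sat_all1; apply/forallP => x; rewrite sat_all1; apply/forallP => y.
    rewrite sat_all1; apply/forallP => z; rewrite sat_imp sat_ands /= andbT.
    rewrite (@sat_edge g _ _ _ _ y x) // (@sat_edge g _ _ _ _ z x) //.
    by apply/implyP => /andP [hy hz]; apply/eqP; apply: h2 hy hz.
  + rewrite sat_all1; apply/forallP => x; rewrite sat_all1; apply/forallP => y.
    rewrite sat_ands all_map; apply/allP => -[c d] _ /=.
    case: eqP => [_|ne]; first exact: sat_true.
    by apply/negP => /andP [hc hd]; apply: ne; apply: h3 hc hd.
  + apply/existsP; exists u; apply/andP; split.
      by rewrite (@sat_first g _ _ _ _ u) //; apply/forallP.
    rewrite sat_all2; apply/forallP => X; rewrite sat_imp sat_ands /= andbT.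
    apply/implyP => /andP [hu h6]; rewrite sat_all1; apply/forallP => v.
    apply: h5 => // x y hx hxy; move: h6; rewrite sat_all1 => /forallP /(_ x).
    rewrite sat_all1 => /forallP /(_ y); rewrite sat_imp sat_ands /= andbT.
    by rewrite (@sat_edge g _ _ _ _ x y) // hx hxy.
Qed.

Lemma onth_build (X : Type) (F : nat -> option X) n : (forall i, i < n -> F i) ->
  exists w, size w = n /\ forall i, i < n -> onth w i = F i.
Proof.
elim: n F => [|n IH] F h; first by exists [::].
have [|w [sw hw]] := IH (fun i => F i.+1); first by move=> i hi; apply: h.
have := h 0 isT; case e: (F 0) => [c|] // _; exists (c :: w); split; first by rewrite /= sw.
by move=> [|i] hi //=; rewrite hw.
Qed.

(** The edges are followed from the source as long as possible. The nodes met are distinct and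
    closed under edges, so by the set induction in [string_graph] they are all nodes. *)
Lemma string_graph_ed g : string_graph g -> exists w : seq A, giso g (ed w).
Proof.
case=> h1 h2 h3 [u0 h4 h5].
have [p [[hp up] hl]] : exists p, (path (@gadj g) u0 p /\ uniq (u0 :: p)) /\
    forall v, ~~ gadj (last u0 p) v.
  suff key k p : path (@gadj g) u0 p -> uniq (u0 :: p) -> #|gV g| < size p + k ->
      exists p, (path (@gadj g) u0 p /\ uniq (u0 :: p)) /\ forall v, ~~ gadj (last u0 p) v.
    by apply: (key #|gV g|.+1 [::]).
  elim: k p => [|k IH] p hp up hk.
    have := max_card (mem (u0 :: p)); move/card_uniqP: (up) => -> h.
    by move: hk; rewrite addn0 ltnNge (ltnW h).
  case: (boolP [exists v, gadj (last u0 p) v]) => [/existsP [v hv]|]; last first.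
    by rewrite negb_exists => /forallP h; exists p.
  apply: (IH (rcons p v)); last by rewrite size_rcons; lia.
    by rewrite rcons_path hp.
  rewrite -rcons_cons rcons_uniq up andbT inE negb_or; apply/andP; split.
    by apply: contraTneq hv => ->; apply: h4.
  (* A repeated [v] would have the last node as a second predecessor; both predecessors coincide, so
     a node would occur twice in [p]. *)
  apply/negP => hvp.
  have [s1 [s2 ep]] : exists s1 s2, p = s1 ++ v :: s2.
    by case/splitPr: hvp => s1 s2; exists s1, s2.
  move: hp; rewrite ep cat_path /= => /and3P [_ hlv _].
  have e := h2 _ _ _ hv hlv; rewrite ep last_cat /= in e.
  have : uniq ((u0 :: s1) ++ v :: s2) by rewrite cat_cons -ep.
  rewrite cat_uniq => /and3P [_ /hasPn h _].
  by have := h _ (mem_last v s2); rewrite e mem_last.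
have all_in v : v \in u0 :: p.
  have : v \in [set x | x \in u0 :: p].
    apply: h5; first by rewrite inE mem_head.
    move=> x y; rewrite !inE -!in_cons => /(nthP u0) [i hi ex] hxy.
    case: (ltnP i (size p)) => hip.
      have := (pathP u0 hp) i hip; rewrite ex => e.
      by rewrite (h1 _ _ _ hxy e); rewrite in_cons mem_nth ?orbT.
    have ei : i = size p by move: hi => /=; lia.
    have := hl y; by rewrite (last_nth u0) -ei ex hxy.
  by rewrite inE.
have [P [sP uP allP adjP lastP]] : exists P : seq (gV g), [/\ size P = (size p).+1, uniq P,
    forall v, v \in P, forall i, i < size p -> gadj (nth u0 P i) (nth u0 P i.+1) &
    forall v, ~~ gadj (nth u0 P (size p)) v].
  exists (u0 :: p); split=> // [i hi|v]; first exact: (pathP u0 hp).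
  by rewrite -last_nth.
pose c0 v := [pick c | [exists w, gE g v c w]].
have c0P u v c : gE g u c v -> c0 u = Some c.
  move=> he; have huv : gadj u v by apply/existsP; exists c.
  rewrite /c0; case: pickP => [d /existsP [v' hd]|/(_ c) /existsP []]; last by exists v.
  have huv' : gadj u v' by apply/existsP; exists d.
  by rewrite (h1 _ _ _ huv' huv) in hd; rewrite (h3 _ _ _ _ hd he).
have [|w [sw hw]] := @onth_build A (fun i => c0 (nth u0 P i)) (size p).
  by move=> i /adjP /existsP [c /c0P ->].
have iP v : index v P < (size w).+1 by rewrite sw -sP index_mem.
have eP v : nth u0 P (index v P) = v by rewrite nth_index.
exists w, (fun v => Ordinal (iP v) : gV (ed w)); split=> //.
  exists (fun i : gV (ed w) => nth u0 P i); first exact: eP.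
  by case=> i hi; apply: val_inj; rewrite /= index_uniq // sP -sw.
  by move=> v; case: (glab g v).
move=> u c v; rewrite /=; apply/andP/idP.
- case=> /eqP e1 /eqP e2; have hi : index u P < size p.
    by have := iP v; rewrite e1 ltnS sw.
  have := adjP _ hi; rewrite -e1 !eP => /existsP [d hd].
  have := hw _ hi; rewrite eP (c0P _ _ _ hd) => hn.
  by rewrite -e2 (onth_nth c _ _ _ hn).
- move=> he; have hadj : gadj u v by apply/existsP; exists c.
  have hi : index u P < size p.
    have := iP u; rewrite sw ltnS leq_eqVlt => /orP [/eqP e|//].
    by have := lastP v; rewrite -e eP hadj.
  have := adjP _ hi; rewrite eP => hadj'.
  have evv := h1 _ _ _ hadj hadj'; split.
    by rewrite {1}evv index_uniq // sP ltnS.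
  have := hw _ hi; rewrite eP (c0P _ _ _ he) => hn.
  by rewrite (onth_nth c _ _ _ hn).
Qed.

End WordFormulas.

#[global] Opaque is_string.

(** * Automata as formulas *)

Section DfaFormula.
Variables (A : finType) (n km : nat).
Local Notation form := (mso unit A).

(** Letter, parameter bits and two marks. Only the first [km] marks are active, so that the same
    construction gives domain, node and edge formulas for [km] equal to 0, 1 and 2; an inactive mark
    is false and its variable is not mentioned. *)
Definition letter := (option A * {ffun 'I_n -> bool} * (bool * bool))%type.

Definition node_letter (w : seq A) (nu : nat -> option 'I_(size w).+1)
    (mu : nat -> {set 'I_(size w).+1}) (i : 'I_(size w).+1) : letter :=
  (onth w i, [ffun k : 'I_n => i \in mu k],
   ((0 < km) && (nu 0 == Some i), (1 < km) && (nu 1 == Some i))).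

Definition encode w nu mu : seq letter := [seq @node_letter w nu mu i | i <- enum 'I_(size w).+1].

Lemma size_encode w nu mu : size (@encode w nu mu) = (size w).+1.
Proof. by rewrite size_map -cardE card_ord. Qed.

Lemma onth_enum_ord m (i : 'I_m) : onth (enum 'I_m) i = Some i.
Proof.
have /ltn_onth [j hj] : i < size (enum 'I_m) by rewrite -cardE card_ord.
by rewrite hj -(onth_nth i _ _ _ hj) nth_ord_enum.
Qed.

Lemma onth_encode w nu mu (i : 'I_(size w).+1) :
  onth (@encode w nu mu) i = Some (node_letter nu mu i).
Proof. by rewrite onth_map onth_enum_ord. Qed.

(** Node variables 0 and 1 are the marks, 2 and 3 are bound in [fdfa]; hence the choice of 4. *)
Definition fbase (o : option A) x : form :=
  if o is Some c then FEx1 4 (FEdge unit c x 4) else flast A x 4.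
Definition fbits (b : {ffun 'I_n -> bool}) x : form :=
  fands [seq (if b k then FIn _ _ x (val k) else FNot (FIn _ _ x (val k))) | k <- enum 'I_n].
Definition fmark j (m : bool) x : form :=
  if j < km then (if m then FEq _ _ x j else FNot (FEq _ _ x j))
  else (if m then FNot (ftrue _ _) else ftrue _ _).
Definition fletter (z : letter) x : form :=
  fands [:: fbase z.1.1 x; fbits z.1.2 x; fmark 0 z.2.1 x; fmark 1 z.2.2 x].

Lemma gadj_ed (w : seq A) (i j : 'I_(size w).+1) : gadj (g := ed w) i j = (val j == (val i).+1).
Proof.
apply/existsP/idP => [[c /andP [] //]|/eqP e].
have hi : i < size w by have := ltn_ord j; rewrite [nat_of_ord j]e ltnS.
have [c hc] := ltn_onth hi; exists c; apply/andP; split; first exact/eqP.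
by rewrite (onth_nth c _ _ _ hc).
Qed.

Lemma sat_letter w nu mu z x i : x < 4 -> nu x = Some i ->
  sat (g := ed w) nu mu (fletter z x) = (node_letter nu mu i == z).
Proof.
move=> hx4 hx; rewrite sat_ands /= andbT; case: z => [[o b] [m0 m1]] /=.
have e1 : sat (g := ed w) nu mu (fbase o x) = (onth w i == o).
  case: o => [c|] /=.
    apply/existsP/eqP => [[j]|hc].
      rewrite /upd /= (_ : x == 4 = false) ?hx; last by apply/eqP => e; move: hx4; rewrite e.
      case/andP => /eqP e1 /eqP e2; have hi : i < size w by rewrite -ltnS -e1.
      by have [d hd] := ltn_onth hi; rewrite hd -(onth_nth c _ _ _ hd) e2.
    have hi : i.+1 < (size w).+1 by rewrite ltnS (onth_lt hc).
    exists (Ordinal hi); rewrite /upd /= (_ : x == 4 = false) ?hx; last by apply/eqP => e; move: hx4; rewrite e.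
    by rewrite /= eqxx (onth_nth c _ _ _ hc) eqxx.
  rewrite (@sat_last _ (ed w) _ _ _ _ i) //; last by apply/eqP => e; move: hx4; rewrite e.
  apply/forallP/eqP => [h|h j].
    apply/onth_default; rewrite leqNgt; apply/negP => hi.
    have hi' : i.+1 < (size w).+1 by rewrite ltnS.
    by have := h (Ordinal hi'); rewrite gadj_ed eqxx.
  rewrite gadj_ed; apply/eqP => e; have := ltn_ord j; rewrite e ltnS -onthTE.
  by rewrite h.
have e2 : sat (g := ed w) nu mu (fbits b x) = ([ffun k : 'I_n => i \in mu k] == b).
  rewrite sat_ands all_map; apply/allP/eqP => [h|<- k _ /=].
    apply/ffunP => k; rewrite ffunE; have := h k (mem_enum _ _) => /=.
    by case: (b k) => /=; rewrite hx //; case: (i \in _).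
  by rewrite ffunE; case e: (i \in mu k) => /=; rewrite hx e.
have e3 j m : sat (g := ed w) nu mu (fmark j m x) = ((j < km) && (nu j == Some i) == m).
  rewrite /fmark; case: (j < km); case: m => /=; rewrite ?sat_true ?hx //.
    by case: (nu j) => [v|] //=; rewrite eqb_id eq_sym.
  by case: (nu j) => [v|] //=; rewrite eqbF_neg eq_sym.
by rewrite e1 e2 !e3 !xpair_eqE -!andbA.
Qed.

Section Dfa.
Variable D : dfa letter.

Definition fstate (s : dS D) : nat := n + enum_rank s.

(** Büchi's formula for an accepting run: the set of a state holds the nodes before whose letter it
    is reached. The sets may overlap: they contain the actual run in any case, and the last clause
    asks every state at the last node to lead to acceptance. *)
Definition fdfa : form := fexs2 (iota n #|dS D|) (fands [::
  fall1 2 (fimp (ffirst A 2 3) (FIn _ _ 2 (fstate (d0 D))));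
  fall1 2 (fall1 3 (fimp (fedge A 2 3) (fands
    [seq fimp (fands [:: FIn _ _ 2 (fstate p.1); fletter p.2 2])
       (FIn _ _ 3 (fstate (dstep D p.1 p.2))) | p <- enum {: dS D * letter}])));
  fall1 2 (fimp (flast A 2 3) (fands
    [seq fimp (fands [:: FIn _ _ 2 (fstate p.1); fletter p.2 2])
       (if dacc D (dstep D p.1 p.2) then ftrue _ _ else FNot (ftrue _ _)) | p <- enum {: dS D * letter}]))]).

Lemma sat_dfa w nu mu : sat (g := ed w) nu mu fdfa = dlang D (@encode w nu mu).
Proof.
have nlE (mu' : nat -> {set gV (ed w)}) nu' i : (forall k : 'I_n, mu' k = mu k) -> nu' 0 = nu 0 -> nu' 1 = nu 1 ->
    node_letter nu' mu' i = @node_letter w nu mu i.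
  move=> h h0 h1; rewrite /node_letter h0 h1; congr (_, _, _).
  by apply/ffunP => k; rewrite !ffunE h.
pose mux F i := if n <= i < n + #|dS D| then F i else mu i.
have muk F (k : 'I_n) : mux F k = mu k by rewrite /mux leqNgt ltn_ord.
have must F s : mux F (fstate s) = F (fstate s).
  by rewrite /mux /fstate leq_addr ltn_add2l ltn_ord.
apply/idP/idP.
- case/sat_exs2 => F; rewrite -/(mux F) sat_ands /= andbT => /and3P [h1 h2 h3].
  have key (i : 'I_(size w).+1) : i \in F (fstate (drun (d0 D) (take i (encode nu mu)))).
    case: i => i; elim: i => [|i IH] hi.
      move: h1; rewrite sat_all1 => /forallP /(_ (Ordinal hi)); rewrite sat_imp.
      rewrite (@sat_first _ (ed w) _ _ _ _ (Ordinal hi)) //.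
      have -> : [forall v, ~~ gadj (g := ed w) v (Ordinal hi)] by apply/forallP => v; rewrite gadj_ed.
      by rewrite /= must take0.
    pose i' : 'I_(size w).+1 := Ordinal (ltnW hi).
    move: h2; rewrite sat_all1 => /forallP /(_ i'); rewrite sat_all1 => /forallP /(_ (Ordinal hi)).
    rewrite sat_imp (@sat_edge _ (ed w) _ _ _ _ i' (Ordinal hi)) // gadj_ed eqxx.
    rewrite sat_ands all_map => /allP /(_ (drun (d0 D) (take i (encode nu mu)), node_letter nu mu i')).
    rewrite mem_enum => /(_ isT) /=; rewrite sat_imp sat_ands /= andbT !must.
    rewrite (@sat_letter _ _ _ _ _ i') // nlE // eqxx andbT.
    have := IH (ltnW hi); rewrite -/i' => -> /=.
    by rewrite (take_onth (onth_encode nu mu i')) -cats1 drun_cat.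
  move: h3; rewrite sat_all1 => /forallP /(_ ord_max); rewrite sat_imp.
  rewrite (@sat_last _ (ed w) _ _ _ _ ord_max) //.
  have -> : [forall v, ~~ gadj (g := ed w) ord_max v].
    by apply/forallP => v; rewrite gadj_ed /= neq_ltn ltn_ord.
  rewrite sat_ands all_map => /allP /(_ (drun (d0 D) (take (size w) (encode nu mu)), node_letter nu mu ord_max)).
  rewrite mem_enum => /(_ isT) /=; rewrite sat_imp sat_ands /= andbT must.
  rewrite (@sat_letter _ _ _ _ _ ord_max) // nlE // eqxx andbT (key ord_max) /=.
  have ee : encode nu mu = rcons (take (size w) (encode nu mu)) (node_letter nu mu ord_max).
    by rewrite -(take_onth (onth_encode nu mu ord_max)) take_oversize // size_encode.
  rewrite /dlang; have -> : drun (d0 D) (encode nu mu) =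
      dstep D (drun (d0 D) (take (size w) (encode nu mu))) (node_letter nu mu ord_max).
    by rewrite {1}ee -cats1 drun_cat.
  by case: (dacc D _) => //=; rewrite sat_true.
- move=> acc; apply/sat_exs2.
  pose st (i : 'I_(size w).+1) := drun (d0 D) (take i (encode nu mu)).
  (* The sets given by the actual run, which are disjoint. *)
  pose F k : {set gV (ed w)} := [set i | fstate (st i) == k].
  exists F; rewrite -/(mux F).
  have inF i s : (i \in F (fstate s)) = (st i == s).
    by rewrite inE /fstate eqn_add2l -(inj_eq enum_rank_inj).
  rewrite sat_ands /= andbT; apply/and3P; split.
  + rewrite sat_all1; apply/forallP => i; rewrite sat_imp (@sat_first _ (ed w) _ _ _ _ i) //.
    rewrite /= must inF; apply/implyP => /forallP h.
    case: i h => [[|i] hi] h; first by rewrite /st /= take0.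
    by have := h (Ordinal (ltnW hi)); rewrite gadj_ed /= eqxx.
  + rewrite sat_all1; apply/forallP => i; rewrite sat_all1; apply/forallP => j.
    rewrite sat_imp (@sat_edge _ (ed w) _ _ _ _ i j) // gadj_ed; apply/implyP => /eqP eij.
    rewrite sat_ands all_map; apply/allP => -[s z] _ /=.
    rewrite sat_imp sat_ands /= andbT !must !inF (@sat_letter _ _ _ _ _ i) // nlE //.
    apply/implyP => /andP [/eqP <- /eqP <-].
    by rewrite /st eij (take_onth (onth_encode nu mu i)) -cats1 drun_cat.
  + rewrite sat_all1; apply/forallP => i; rewrite sat_imp (@sat_last _ (ed w) _ _ _ _ i) //.
    apply/implyP => /forallP h; rewrite sat_ands all_map; apply/allP => -[s z] _ /=.
    rewrite sat_imp sat_ands /= andbT must inF (@sat_letter _ _ _ _ _ i) // nlE //.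
    apply/implyP => /andP [/eqP <- /eqP <-].
    have ei : val i = size w.
      have := ltn_ord i; rewrite ltnS leq_eqVlt => /orP [/eqP //|hi].
      by have := h (Ordinal (hi : i.+1 < (size w).+1)); rewrite gadj_ed eqxx.
    suff -> : dacc D (dstep D (st i) (node_letter nu mu i)) by apply: sat_true.
    move: acc; rewrite /dlang -[encode nu mu](take_size) size_encode -ei.
    by rewrite (take_onth (onth_encode nu mu i)) -cats1 drun_cat.
Qed.

Lemma fvn_letter (P : pred nat) z x : x != 4 -> P x -> (forall v, v < km -> P v) -> all P (fvn (fletter z x)).
Proof.
move=> hx4 hx hP; rewrite fvn_ands /= andbT; apply/and4P; split.
- by case: z.1.1 => [c|]; [rewrite /= hx4 /= hx | apply: fvn_last].
- by rewrite fvn_ands all_map; apply/allP => k _ /=; case: (z.1.2 k); rewrite /= hx.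
- by rewrite /fmark; case: ifP => [/hP h|_]; case: (z.2.1) => //=; rewrite ?hx ?h ?fvn_true.
- by rewrite /fmark; case: ifP => [/hP h|_]; case: (z.2.2) => //=; rewrite ?hx ?h ?fvn_true.
Qed.

Lemma fvs_letter (P : pred nat) z x : (forall v, v < n -> P v) -> all P (fvs (fletter z x)).
Proof.
move=> hP; rewrite fvs_ands /= andbT; apply/and4P; split.
- by case: z.1.1 => [c|] //; apply: fvs_last.
- by rewrite fvs_ands all_map; apply/allP => k _ /=; case: (z.1.2 k); rewrite /= hP.
- by rewrite /fmark; case: ifP => _; case: (z.2.1) => //=; rewrite ?fvs_true.
- by rewrite /fmark; case: ifP => _; case: (z.2.2) => //=; rewrite ?fvs_true.
Qed.

Lemma fvn_dfa : all (fun v => v < km) (fvn fdfa).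
Proof.
rewrite fvn_exs2 fvn_ands /= andbT; apply/and3P; split.
- by rewrite fvn_all1 fvn_imp fvn_first.
- rewrite !fvn_all1 fvn_imp fvn_edge //= fvn_ands all_map; apply/allP => -[s z] _ /=.
  rewrite fvn_imp fvn_ands /= !andbT; apply: fvn_letter => // v ->.
  by rewrite !implybT.
- rewrite !fvn_all1 fvn_imp fvn_last //= fvn_ands all_map; apply/allP => -[s z] _ /=.
  rewrite fvn_imp fvn_ands /= !andbT; apply/andP; split; last by case: ifP => _ /=; rewrite fvn_true.
  by apply: fvn_letter => // v ->; rewrite implybT.
Qed.

Lemma fvs_dfa : all (fun X => X < n) (fvs fdfa).
Proof.
have hs s : (fstate s \in iota n #|dS D|) by rewrite mem_iota leq_addr ltn_add2l ltn_ord.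
apply: fvs_exs2; rewrite fvs_ands /= andbT; apply/and3P; split.
- by rewrite fvs_all1 fvs_imp fvs_first /= hs.
- rewrite !fvs_all1 fvs_imp fvs_edge //= fvs_ands all_map; apply/allP => -[s z] _ /=.
  rewrite fvs_imp fvs_ands /= !hs /= !andbT; apply: fvs_letter => // v ->.
  by rewrite orbT.
- rewrite !fvs_all1 fvs_imp fvs_last //= fvs_ands all_map; apply/allP => -[s z] _ /=.
  rewrite fvs_imp fvs_ands /= !hs /= !andbT; apply/andP; split; last by case: ifP => _ /=; rewrite fvs_true.
  by apply: fvs_letter => // v ->; rewrite orbT.
Qed.

End Dfa.
End DfaFormula.

#[global] Opaque fdfa.

(** * From path transducers to graph transductions *)

Lemma giso_sym (S G : Type) (g h : graph S G) : giso g h -> giso h g.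
Proof.
case=> f [[f' fK f'K] hl he]; exists f'; split; first by exists f.
  by move=> v; rewrite -hl f'K.
by move=> u c v; rewrite -he !f'K.
Qed.

Lemma msot_rel_iso (S1 : eqType) (G1 : Type) (S2 G2 : finType) (T : msot S1 G1 S2 G2)
    (g g' : graph S1 G1) (h : graph S2 G2) : giso g g' -> msot_rel T g h -> msot_rel T g' h.
Proof.
case=> F [bF hl he] [P [hdom [f [injf him hlab hed]]]].
have injF := bij_inj bF; case: (bF) => F' FK F'K.
pose P' k := F @: P k.
have eP : penv P' = (fun X => F @: penv P X).
  apply: functional_extensionality => X; rewrite /penv; case: insub => [k|] //=.
  by rewrite imset0.
have e1 u : nu1 (F u) = (fun x => omap F (nu1 u x)).
  by apply: functional_extensionality => x; rewrite /nu1; case: eqP.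
have e2 u v : nu2 (F u) (F v) = (fun x => omap F (nu2 u v x)).
  by apply: functional_extensionality => x; rewrite /nu2; case: eqP => // _; case: eqP.
exists P'; split.
  rewrite eP -[fun=> None]/(fun x : nat => omap F ((fun=> None) x)).
  by rewrite (sat_iso _ _ _ bF).
exists (fun v => (F (f v).1, (f v).2)); split.
- by move=> v v' [/injF e1' e2']; apply: injf; apply: injective_projections.
- move=> u c; rewrite -(F'K u) eP e1.
  have -> : #|[pred s | sat (g := g') (fun x => omap F (nu1 (F' u) x)) (fun X => F @: penv P X) (tnode T c s)]| =
    #|[pred s | sat (nu1 (F' u)) (penv P) (tnode T c s)]|.
    by apply: eq_card => s; rewrite !inE (sat_iso _ _ _ bF).
  rewrite -him; split=> -[v].
    by move=> [/injF eu ev]; exists v; rewrite -eu -ev -surjective_pairing.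
  by move=> ev; exists v; rewrite ev.
- by move=> v; rewrite eP e1 (sat_iso _ _ _ bF) //; apply: hlab.
- by move=> v e v'; rewrite eP e2 (sat_iso _ _ _ bF) //; apply: hed.
Qed.

(** String graphs have a single node label, so the uniqueness demanded of it reduces to the truth of
    one formula. *)
Lemma unit_card1 (p : pred unit) : #|p| = 1 <-> p tt.
Proof.
rewrite (eq_card (B := fun x => p tt)); last by case.
by rewrite cardE /enum_mem unlock /=; case: (p tt).
Qed.

Section VisiblePositions.
Variables (B : finType) (z : seq (option B)).

Lemma cnt_letter l b : onth z l = Some (Some b) -> onth (erase z) (cnt z l) = Some b.
Proof.
rewrite /cnt; elim: z l => [|o s IH] [|l] //=; first by case=> ->.
by case: o => [a|] /= /IH.
Qed.

Lemma cnt_surj k : k <= size (erase z) ->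
  exists l, [/\ l <= size z, onth z l != Some None & cnt z l = k].
Proof.
rewrite /cnt; elim: z k => [|o s IH] k /=; first by case: k => // _; exists 0.
case: o => [b|] /=.
  case: k => [|k] hk; first by exists 0.
  have [l [h1 h2 h3]] := IH k hk; exists l.+1; split=> //=.
  by rewrite h3.
by case/IH => l [h1 h2 h3]; exists l.+1; split.
Qed.

Lemma cnt_lt l l' : l < l' -> l' <= size z -> onth z l != Some None -> cnt z l < cnt z l'.
Proof.
move=> h h' hv; apply: (@leq_trans (cnt z l.+1)); last exact: cnt_le_mono.
have [o ho] := ltn_onth (leq_trans h h').
by rewrite cntS ho; case: o ho hv => [b|] -> //; rewrite addn1.
Qed.

Lemma cnt_inj l l' : l <= size z -> l' <= size z -> onth z l != Some None ->
  onth z l' != Some None -> cnt z l = cnt z l' -> l = l'.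
Proof.
move=> h h' hv hv' e; case: (ltngtP l l') => // hl.
  by have := cnt_lt hl h' hv; rewrite e ltnn.
by have := cnt_lt hl h hv'; rewrite e ltnn.
Qed.

(** How an edge of [ed (erase z)] appears on the padded word: [cnt] grows exactly behind letters, so
    consecutive values mean that nothing visible lies in between. *)
Lemma cnt_next l l' b : l' <= size z -> onth z l' != Some None ->
  (onth z l = Some (Some b) /\ l < l' /\ forall k, l < k < l' -> onth z k = Some None) <->
  onth z l != Some None /\ (cnt z l' = (cnt z l).+1 /\ onth (erase z) (cnt z l) = Some b).
Proof.
move=> h' hv'; split.
- case=> hb [hl hk]; rewrite hb; split=> //; rewrite (cnt_letter hb); split=> //.
  have -> : (cnt z l).+1 = cnt z l.+1 by rewrite cntS hb addn1.
  have [d ed] : exists d, l' = l.+1 + d by exists (l' - l.+1); lia.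
  rewrite {}ed in hk *; elim: d hk => [|d IH] hk; first by rewrite addn0.
  rewrite addnS cntS hk ?addn0; last by lia.
  by apply: IH => k hk'; apply: hk; lia.
- case=> hv [hc hb]; case hz: (onth z l) hv => [[b'|]|] // _.
    move: (cnt_letter hz); rewrite hb => -[->].
    have hl : l < l' by rewrite ltnNge; apply/negP => /cnt_le_mono h; have := h _ z; lia.
    split=> //; split=> // k /andP [h1 h2].
    apply/eqP/negPn/negP => hk; have h3 := cnt_lt h2 h' hk.
    have : onth z l != Some None by rewrite hz.
    by move/(cnt_lt h1 (ltnW (leq_trans h2 h'))); lia.
  have ce : cnt z l = size (erase z) by rewrite /cnt take_oversize // -onthNE hz.
  by have := onth_lt hb; rewrite ce ltnn.
Qed.

End VisiblePositions.

Lemma ed_string_graph (A : finType) (w : seq A) : string_graph (ed w).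
Proof.
split.
- move=> u v v'; rewrite !gadj_ed => /eqP e /eqP e'; apply: val_inj.
  by rewrite e e'.
- move=> u v v'; rewrite !gadj_ed => /eqP e /eqP e'; apply: val_inj; apply: succn_inj.
  by rewrite -e -e'.
- move=> u v c d /andP [/eqP e1 /eqP <-] /andP [_ /eqP <-].
  by apply: set_nth_default; have := ltn_ord v; rewrite e1.
- exists ord0 => [v|X h0 hX [i hi]]; first by rewrite gadj_ed.
  elim: i hi => [|i IH] hi.
    by have -> : Ordinal hi = ord0 by apply: val_inj.
  by apply: (hX (Ordinal (ltnW hi)) _ (IH (ltnW hi))); rewrite gadj_ed.
Qed.

(** * The graph transduction of a path transducer *)

Section ToMso.
Variables (A B : finType)
  (K : ktr (bool * option (option A))%type (bool * option (option B))%type).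
Local Notation T := (kT K).
Local Notation C := (kC K).
Local Notation n := #|T|.
Local Notation letters := (letter A n).

(** One parameter per tile: an assignment encodes a tiling when each node lies in exactly one
    parameter set. *)
Definition tbits (a : T) : {ffun 'I_n -> bool} := [ffun k => enum_val k == a].

Lemma tbits_inj : injective tbits.
Proof.
move=> a b /ffunP /(_ (enum_rank a)); rewrite !ffunE !enum_rankK eqxx.
by move/esym/eqP.
Qed.

Definition visible (l : bool * option (option B)) := l.2 != Some None.

(** The transduction reads unpadded words, so [K] is run on [map Some w]: the input symbol of a tile
    must be a real letter or the end of the word. *)
Definition dom_lang (s : seq letters) := exists2 t : seq T, size t = size s &
  all (fun p => (p.1.1.2 == tbits p.2) && ((ksym p.2).2 == omap Some p.1.1.1)) (zip s t) /\
  labelled (unzip2 (zip s t)).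

Lemma recog_dom_lang : recog dom_lang.
Proof.
have r : recog (@labelled (option A) B K).
  by apply: recog_and; [apply: krec | apply: recog_pulled (recog_nodeword _)].
exact: (recog_proj (recog_and (recog_all (fun p : letters * T =>
  (p.1.1.2 == tbits p.2) && ((ksym p.2).2 == omap Some p.1.1.1))) (recog_map snd r))).
Qed.

Definition node_lang (c : C) (s : seq letters) : Prop :=
  has (fun x : letters => x.2.1 &&
    [exists a : T, [&& x.1.2 == tbits a, pres (kG K) a c & visible (klab a c)]]) s.

Lemma recog_node_lang c : recog (node_lang c).
Proof. exact: recog_has. Qed.

(** In [y], the first component is the guessed set, the second the marks of source and target. A
    member of the set that is not the target must be blank and have a successor, which [edgeR] puts
    into the set too. *)
Definition edgeQ (c' : C) (a : T) (y : {set C} * (bool * bool)) (d : C) : bool :=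
  (d \in y.1) ==> (y.2.2 && (d == c')) ||
    (~~ visible (klab a d) && (ptr (kG K) true a d != None)).
Definition edgeR (c c' : C) (b : bool) (a : T) (y : {set C} * (bool * bool)) (d : C)
    (a' : T) (y' : {set C} * (bool * bool)) (d' : C) : bool :=
  [&& b & (y.2.1 && (d == c)) || ((d \in y.1) && ~~ (y.2.2 && (d == c')))] ==> (d' \in y'.1).

(* The set [X] guessed here contains the nodes strictly after the source, up to
   the target: all of them but the target are blank. *)
Definition edge_lang (c c' : C) (b : B) (s : seq letters) : Prop :=
  exists2 r : seq (T * {set C}), size r = size s &
   all (fun p => p.1.1.2 == tbits p.2.1) (zip s r) /\
   (has (fun p => [&& p.1.2.1, pres (kG K) p.2.1 c, (klab p.2.1 c).2 == Some (Some b) &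
       ptr (kG K) true p.2.1 c != None]) (zip s r) /\
   (has (fun p => p.1.2.2 && pres (kG K) p.2.1 c') (zip s r) /\
    annotates (kG K) (edgeQ c') (edgeR c c')
      (unzip1 (map (fun p => (p.2.1, (p.2.2, p.1.2))) (zip s r)))
      (unzip2 (map (fun p => (p.2.1, (p.2.2, p.1.2))) (zip s r))))).

Lemma recog_edge_lang c c' b : recog (edge_lang c c' b).
Proof.
exact: (recog_proj (Y := (T * {set C})%type) (recog_and (recog_all
  (fun p : letters * (T * {set C}) => p.1.1.2 == tbits p.2.1)) (recog_and (recog_has
  (fun p : letters * (T * {set C}) => [&& p.1.2.1, pres (kG K) p.2.1 c,
     (klab p.2.1 c).2 == Some (Some b) & ptr (kG K) true p.2.1 c != None]))
  (recog_and (recog_has (fun p : letters * (T * {set C}) => p.1.2.2 && pres (kG K) p.2.1 c'))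
  (recog_map (fun p : letters * (T * {set C}) => (p.2.1, (p.2.2, p.1.2)))
     (recog_annotates (kG K) (edgeQ c') (edgeR c c'))))))).
Qed.

Definition to_msot : msot unit A unit B := @Msot unit A unit B n C
  (FAnd (is_string A) (fdfa 0 (projT1 recog_dom_lang)))
  (fun c _ => fdfa 1 (projT1 (recog_node_lang c)))
  (fun c c' b => fdfa 2 (projT1 (recog_edge_lang c c' b))).

Lemma to_msot_wf : msot_wf to_msot.
Proof.
split.
- split; last by rewrite /= all_cat fvs_is_string; apply: fvs_dfa.
  rewrite /= fvn_is_string /=.
  by case: (fvn _) (@fvn_dfa A n 0 (projT1 recog_dom_lang)).
- move=> c s; split; last exact: fvs_dfa.
  by apply: sub_all (fvn_dfa _ _) => v; rewrite ltnS leqn0.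
- by move=> c1 c2 e; split; [apply: fvn_dfa | apply: fvs_dfa].
Qed.

Section Word.
Variable w : seq A.
Variable P : 'I_n -> {set 'I_(size w).+1}.
Local Notation enc nu := (@encode A n _ w nu (penv P)).

Lemma penvE (k : 'I_n) : penv P k = P k.
Proof. by rewrite /penv valK. Qed.

Definition tiling (t : seq T) := size t = (size w).+1 /\
  forall (i : 'I_(size w).+1) a, onth t i = Some a -> [ffun k => i \in P k] = tbits a.

Lemma node_letterE km nu i : @node_letter A n km w nu (penv P) i =
  (onth w i, [ffun k => i \in P k], ((0 < km) && (nu 0 == Some i), (1 < km) && (nu 1 == Some i))).
Proof.
by rewrite /node_letter; congr (_, _, _); apply/ffunP => k; rewrite !ffunE penvE.
Qed.

Lemma onth_enc km nu (i : 'I_(size w).+1) : onth (@encode A n km w nu (penv P)) i =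
  Some (onth w i, [ffun k => i \in P k], ((0 < km) && (nu 0 == Some i), (1 < km) && (nu 1 == Some i))).
Proof. by rewrite onth_encode node_letterE. Qed.

Hypothesis K_dom : forall t, kL (k := K) t -> exists y, map (ksym (k := K)) t = nodeword y.

Lemma dom_langP km nu : dom_lang (@encode A n km w nu (penv P)) <->
  exists t, [/\ tiling t, map (ksym (k := K)) t = nodeword (map Some w) & labelled t].
Proof.
split.
- case=> t; rewrite size_encode => st [/allP h hl]; exists t.
  rewrite unzip2_zip ?size_encode ?st // in hl.
  have key (i : 'I_(size w).+1) : exists a, [/\ onth t i = Some a,
      [ffun k => i \in P k] = tbits a & (ksym a).2 = omap Some (onth w i)].
    have [a ea] : exists a, onth t i = Some a by apply: ltn_onth; rewrite st.
    have hin : (@node_letter A n km w nu (penv P) i, a) \in zip (@encode A n km w nu (penv P)) t.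
      by apply/onthP; exists i; rewrite onth_zip ?size_encode // onth_encode ea.
    have := h _ hin; rewrite node_letterE => /andP [/eqP /= h1 /eqP /= h2].
    by exists a.
  have [y hy] := K_dom hl.1.
  have sy : size y = size w.
    by move/(congr1 size): hy; rewrite size_map size_nodeword st => -[->].
  split=> //.
    by split=> // i a ea; have [a' [ea' -> _]] := key i; move: ea'; rewrite ea => -[->].
  rewrite hy; congr nodeword; apply: eq_from_onth => i; rewrite onth_map.
  case: (ltnP i (size w)) => hi; last by rewrite !onth_default // sy.
  have [a [ea _ es]] := key (Ordinal (leqW hi)).
  have := congr1 (fun s => onth s i) hy; rewrite /= onth_map ea onth_nodeword sy (ltnW hi) /=.
  by case=> e; move: es; rewrite e.
- case=> t [[st ht] hs hl]; exists t; rewrite ?size_encode // unzip2_zip ?size_encode ?st //; split=> //.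
  apply/allP => -[x a] /onthP [i]; rewrite onth_zip ?size_encode //.
  case e: (onth _ i) => [x'|] //; have hi := onth_lt e; rewrite size_encode in hi.
  move: e; rewrite (onth_enc km nu (Ordinal hi)) => /Some_inj <-.
  case ea: (onth t i) => [a'|] //= [<- <-] /=.
  rewrite -(ht (Ordinal hi) _ ea) eqxx /=.
  have := congr1 (fun s => onth s i) hs; rewrite /= onth_map ea onth_nodeword size_map onth_map -ltnS hi.
  by case=> ->.
Qed.

Lemma ltn_between l k : (l < k < l.+1) = false.
Proof. by rewrite ltnS ltnNge andNb. Qed.

Section Tiled.
Variables (t : seq T) (p : seq (nat * C)) (z : seq (option B)).
Hypotheses (ht : tiling t) (hp : ispath (kG K) t p)
  (hz : map (olab (klab (k := K)) t) p = map Some (nodeword z)).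

Lemma size_p : size p = (size z).+1.
Proof. by have := congr1 size hz; rewrite size_map [RHS]size_map size_nodeword. Qed.

Lemma tile_at (i : 'I_(size w).+1) : exists2 a, onth t i = Some a & [ffun k => i \in P k] = tbits a.
Proof.
have [st hb] := ht; have [a ea] : exists a, onth t i = Some a by apply: ltn_onth; rewrite st.
by exists a => //; apply: hb.
Qed.

Lemma path_node_data l i c : onth p l = Some (i, c) -> exists a,
  [/\ onth t i = Some a, pres (kG K) a c, i < (size w).+1, l <= size z & klab a c = (l == 0, onth z l)].
Proof.
move=> h; have /npresE [a ea pa] := path_onth_pres hp h.
exists a; split=> //; first by have [st _] := ht; rewrite -st (onth_lt ea).
  by rewrite -ltnS -size_p (onth_lt h).
have := map_eq_onth hz h; rewrite /olab /= ea onth_nodeword -ltnS -size_p (onth_lt h).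
by case.
Qed.

Lemma node_langP km nu c (u : 'I_(size w).+1) : 0 < km -> (forall i, nu 0 == Some i = (u == i)) ->
  node_lang c (@encode A n km w nu (penv P)) <->
  exists l, onth p l = Some (val u, c) /\ onth z l != Some None.
Proof.
move=> hk hnu; split.
- case/has_onth => i [x [ex]] /andP [hx /existsP [a /and3P [/eqP hb pa hv]]].
  have hi := onth_lt ex; rewrite size_encode in hi.
  move: ex; rewrite (onth_enc km nu (Ordinal hi)) => -[ex]; move: hx hb; rewrite -ex /= hk hnu.
  move/eqP => eu; subst u; have [a' ea' ->] := tile_at (Ordinal hi).
  move/tbits_inj => e; subst a'.
  have : (i, c) \in p by case: (hp) => _ _ -> _; apply/npresE; exists a.
  case/onthP => l hl; exists l; split=> //.
  have [a' [ea2 _ _ _ hlab]] := path_node_data hl; move: ea2; rewrite ea' => -[e]; subst a'.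
  by move: hv; rewrite hlab.
- case=> l [hl hv]; have [a [ea pa hi _ hlab]] := path_node_data hl.
  apply/has_onth; exists (val u); rewrite onth_enc; eexists; split; first by [].
  rewrite /= hk hnu eqxx; apply/existsP; exists a; rewrite pa /visible hlab hv andbT andbT.
  by have [a' ea' ->] := tile_at u; move: ea'; rewrite ea => -[->].
Qed.

(** From the source on, the guessed set can only be left through the target; since the path is
    finite, the target is met, and all nodes before it are blank. *)
Lemma edge_langP nu c c' b (u v : 'I_(size w).+1) : (forall i, nu 0 == Some i = (u == i)) ->
  (forall i, nu 1 == Some i = (v == i)) ->
  edge_lang c c' b (@encode A n 2 w nu (penv P)) <->
  exists l l', [/\ onth p l = Some (val u, c), onth p l' = Some (val v, c') &
    onth z l = Some (Some b) /\ l < l' /\ forall k, l < k < l' -> onth z k = Some None].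
Proof.
move=> hu hv; have [st hb] := ht; case: (hp) => _ up mp hnx.
have hen (i : 'I_(size w).+1) : onth (@encode A n 2 w nu (penv P)) i =
    Some (onth w i, [ffun k => i \in P k], (u == i, v == i)).
  by rewrite onth_enc /= hu hv.
split.
- case=> r; rewrite size_encode => sr [/allP h1 [h2 [h3]]].
  have hz2 (i : 'I_(size w).+1) : exists a X, [/\ onth t i = Some a, onth r i = Some (a, X) &
      onth (zip (@encode A n 2 w nu (penv P)) r) i =
      Some ((onth w i, [ffun k => i \in P k], (u == i, v == i)), (a, X))].
    have [a ea eb] := tile_at i; have [[a' X] eX] : exists x, onth r i = Some x.
      by apply: ltn_onth; rewrite sr.
    have e : onth (zip (@encode A n 2 w nu (penv P)) r) i =
        Some ((onth w i, [ffun k => i \in P k], (u == i, v == i)), (a', X)).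
      by rewrite onth_zip ?size_encode // hen eX.
    have : ((onth w i, [ffun k => i \in P k], (u == i, v == i)), (a', X)) \in
        zip (@encode A n 2 w nu (penv P)) r by apply/onthP; exists i.
    move/h1 => /= /eqP e'; rewrite eb in e'; have {}e' := tbits_inj e'; subst a'.
    by exists a, X.
  set q := map _ (zip _ r).
  have hq (i : 'I_(size w).+1) : exists a X, [/\ onth t i = Some a,
      onth (unzip1 q) i = Some a & onth (unzip2 q) i = Some (X, (u == i, v == i))].
    have [a [X [e1 _ e3]]] := hz2 i; exists a, X.
    by rewrite /q /unzip1 /unzip2 -!map_comp !onth_map e3.
  move=> ann.
  have [l [hl [hlb hne]]] : exists l, onth p l = Some (val u, c) /\ onth z l = Some (Some b) /\
      l.+1 < size p.
    case/has_onth: h2 => i [x [ex]] /and4P [m1 pa /eqP lb nx].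
    have hi := onth_lt ex; rewrite size_zip sr size_encode minnn in hi.
    have [a [X [ea _ e]]] := hz2 (Ordinal hi); move: ex; rewrite e => -[ex]; move: m1 pa lb nx.
    rewrite -ex /= => /eqP eu pa lb nx; subst u.
    have : (i, c) \in p by rewrite mp; apply/npresE; exists a.
    case/onthP => l hl; exists l; split=> //.
    have [a' [ea' _ _ _ hlab]] := path_node_data hl; move: ea'; rewrite ea => -[e']; subst a'.
    split; first by move: lb; rewrite hlab.
    have [+ _] := hnx _ _ hl; rewrite /nptr /= ea; case: (ptr _ true a c) nx => // y _.
    by rewrite /= -onthTE; case: (onth p l.+1).
  have pv : (val v, c') \in p.
    case/has_onth: h3 => i [x [ex]] /andP [m1 pa].
    have hi := onth_lt ex; rewrite size_zip sr size_encode minnn in hi.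
    have [a [X [ea _ e]]] := hz2 (Ordinal hi); move: ex; rewrite e => -[ex]; move: m1 pa.
    by rewrite -ex /= => /eqP -> pa; rewrite mp; apply/npresE; exists a.
  have inX k i d : onth p k = Some (i, d) -> exists a X, [/\ onth t i = Some a, pres (kG K) a d,
      onth (unzip1 q) i = Some a & onth (unzip2 q) i = Some (X, (val u == i, val v == i))].
    move=> hk; have [a [ea pa hi _ _]] := path_node_data hk.
    by have [a' [X [ea' e1 e2]]] := hq (Ordinal hi); move: ea'; rewrite ea => -[e]; subst a'; exists a, X.
  have step k i d i2 d2 a X a2 X2 : onth p k = Some (i, d) -> onth p k.+1 = Some (i2, d2) ->
      onth (unzip1 q) i = Some a -> onth (unzip2 q) i = Some X ->
      onth (unzip1 q) i2 = Some a2 -> onth (unzip2 q) i2 = Some X2 -> edgeR c c' true a X d a2 X2 d2.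
    move=> hk hk' e1 e2 e3 e4.
    have [a' [X' [ea pa e1' e2']]] := inX _ _ _ hk; move: e1' e2'; rewrite e1 e2 => -[e1'] [e2']; subst a' X.
    have [_ +] := ann _ _ _ _ e1 e2 pa.
    have [+ _] := hnx _ _ hk; rewrite /nptr /= ea hk'; case en: (ptr _ true a d) => [[mv dd]|] //= [ej ed].
    by rewrite {}ed in en; move/(_ _ _ _ _ _ _ en ej e3 e4).
  (* After [d] blank nodes either the target has been met or the walk goes on inside the set. For
     [d = size p] the second case would run past the end of the path. *)
  have key d : (exists l', [/\ l < l' <= l + d, onth p l' = Some (val v, c') &
        forall k, l < k < l' -> onth z k = Some None]) \/
      (exists i e a X, [/\ onth p (l + d).+1 = Some (i, e), onth (unzip1 q) i = Some a,
         onth (unzip2 q) i = Some X, e \in X.1 & forall k, l < k < (l + d).+1 -> onth z k = Some None]).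
    elim: d => [|d [[l' [h4 h5 h6]]|[i [e [a [X [h4 h5 h6 h7 h8]]]]]]].
    + right; have [[i e] he] := ltn_onth hne; have [a [X [ea pa e1 e2]]] := inX _ _ _ he.
      have [a1 [X1 [ea1 pa1 e3 e4]]] := inX _ _ _ hl.
      exists i, e, a, (X, (val u == i, val v == i)); rewrite addn0; split=> //; last by move=> k; rewrite ltn_between.
      by have := step _ _ _ _ _ _ _ _ _ hl he e3 e4 e1 e2; rewrite /edgeR /= eqxx eqxx.
    + by left; exists l'; split=> //; rewrite addnS; case/andP: h4 => -> /leqW.
    + have [a' [X' [ea pa e1 e2]]] := inX _ _ _ h4.
      move: e1 e2; rewrite h5 h6 => -[e1] [e2]; subst a' X.
      have [hQ _] := ann _ _ _ _ h5 h6 pa; move: hQ; rewrite /edgeQ h7 /=.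
      case ev: ((val v == i) && (e == c')) => /=.
        move=> _; left; exists (l + d).+1; split; [by rewrite addnS leqnn andbT ltnS leq_addr| |exact: h8].
        by case/andP: ev => /eqP -> /eqP <-.
      case/andP => hbl nx; right.
      have [[i2 e2] h9] : exists x, onth p (l + d.+1).+1 = Some x.
        have [+ _] := hnx _ _ h4; rewrite /nptr /= ea addnS; case: (ptr _ true a e) nx => // y _.
        by case: (onth p (l + d).+2) => [x|] //; exists x.
      have [a2 [X2 [ea2 pa2 e3 e4]]] := inX _ _ _ h9.
      exists i2, e2, a2, (X2, (val u == i2, val v == i2)); split=> //.
        rewrite addnS in h9; have := step _ _ _ _ _ _ _ _ _ h4 h9 h5 h6 e3 e4.
        by rewrite /edgeR /= h7 ev /= orbT.
      move=> k hk; case: (ltnP k (l + d).+1) => hk'; first by apply: h8; case/andP: hk => ->.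
      have ek : k = (l + d).+1.
        by apply/eqP; rewrite eqn_leq hk' andbT -ltnS -addnS; case/andP: hk.
      have [a3 [ea3 _ _ _ hlab]] := path_node_data h4; move: ea3; rewrite ea => -[e3']; subst a3.
      by move: hbl; rewrite /visible hlab negbK /= ek => /eqP.
  have [[l' [h4 h5 h6]]|[i [e [a [X [h4 _ _ _ _]]]]]] := key (size p).
    by exists l, l'; split=> //; split=> //; split=> //; case/andP: h4.
  by have := onth_lt h4; rewrite ltnNge leqW ?leq_addl.
- case=> l [l' [hl hl' [hlb [hlt hbl]]]].
  (* The set of all nodes strictly after index [l] and up to index [l']. *)
  pose Xs := mkseq (fun i => [set d | ((i, d) \in p) && (l < index (i, d) p <= l')]) (size t).
  exists (zip t Xs); first by rewrite size_zip size_mkseq minnn st size_encode.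
  have hzq (i : 'I_(size w).+1) : exists a X, [/\ onth t i = Some a, onth Xs i = Some X,
      [ffun k => i \in P k] = tbits a,
      X = [set d | ((val i, d) \in p) && (l < index (val i, d) p <= l')] &
      onth (zip (@encode A n 2 w nu (penv P)) (zip t Xs)) i =
      Some ((onth w i, [ffun k => i \in P k], (u == i, v == i)), (a, X))].
    have [a ea eb] := tile_at i; have eX : onth Xs i =
        Some [set d | ((val i, d) \in p) && (l < index (val i, d) p <= l')].
      by rewrite onth_mkseq (onth_lt ea).
    exists a, [set d | ((val i, d) \in p) && (l < index (val i, d) p <= l')]; split=> //.
    by rewrite onth_zip ?size_encode ?size_zip ?size_mkseq ?minnn // hen onth_zip ?size_mkseq // ea eX.
  have sz : size (zip (@encode A n 2 w nu (penv P)) (zip t Xs)) = (size w).+1.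
    by rewrite !size_zip size_encode size_mkseq st !minnn.
  split; [|split; [|split]].
  + apply/allP => x /onthP [i ex]; have hi := onth_lt ex; rewrite sz in hi.
    have [a [X [_ _ eb _ e]]] := hzq (Ordinal hi); move: ex; rewrite e => -[<-] /=.
    by rewrite eb.
  + apply/has_onth; exists (val u); have [a [X [ea _ eb _ ->]]] := hzq u.
    eexists; split; first by []; rewrite /= eqxx.
    have [a' [ea' pa _ _ hlab]] := path_node_data hl; move: ea'; rewrite ea => -[e]; subst a'.
    rewrite pa hlab /= hlb eqxx /=.
    have [+ _] := hnx _ _ hl; rewrite /nptr /= ea.
    have [x ->] : exists x, onth p l.+1 = Some x.
      by apply: ltn_onth; apply: leq_ltn_trans hlt (onth_lt hl').
    by case: (ptr _ true a c).
  + apply/has_onth; exists (val v); have [a [X [ea _ eb _ ->]]] := hzq v.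
    eexists; split; first by []; rewrite /= eqxx.
    by have [a' [ea' pa _ _ hlab]] := path_node_data hl'; move: ea'; rewrite ea => -[e]; subst a'.
  + set q := map _ (zip _ _).
    have hq i : i < (size w).+1 -> exists a X, [/\ onth t i = Some a, onth (unzip1 q) i = Some a,
      onth (unzip2 q) i = Some (X, (val u == i, val v == i)) &
      X = [set d | ((i, d) \in p) && (l < index (i, d) p <= l')]].
      move=> hi; have [a [X [e1 _ _ e2 e3]]] := hzq (Ordinal hi); exists a, X.
      by rewrite /q /unzip1 /unzip2 -!map_comp !onth_map e3.
    have szq : size (unzip1 q) = (size w).+1 by rewrite /q !size_map sz.
    move=> i a y d ea ey pa.
    have hi : i < (size w).+1 by rewrite -szq (onth_lt ea).
    have [a' [X [e1 e2 e3 eX]]] := hq i hi.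
    move: ea ey; rewrite e2 e3 => -[ea] [ey]; subst a' y.
    have pin : (i, d) \in p by rewrite mp; apply/npresE; exists a.
    have hk := index_onth pin; have [+ _] := hnx _ _ hk.
    have [a' [ea' _ _ _ hlab]] := path_node_data hk; move: ea'; rewrite e1 => -[e]; subst a'.
    rewrite /nptr /= e1 => hnxt; split.
      rewrite /edgeQ /=; apply/implyP; rewrite eX inE pin /= => /andP [h1].
      rewrite leq_eqVlt => /orP [/eqP h2|h2].
        by move: hk; rewrite h2 hl' => -[-> ->]; rewrite !eqxx.
      apply/orP; right; rewrite /visible hlab negbK /= hbl ?h1 // eqxx /=.
      have [x hx] : exists x, onth p (index (i, d) p).+1 = Some x.
        by apply: ltn_onth; apply: leq_ltn_trans h2 (onth_lt hl').
      by move: hnxt; rewrite hx; case: (ptr _ true a d).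
    move=> b0 mv d' j a2 y2 en ej ea2 ey2; rewrite /edgeR; apply/implyP => /andP [hb0].
    case: b0 en hb0 => // en _; move: hnxt; rewrite en /= ej.
    case ex: (onth p _) => [[j' d2]|] //= [ejj edd]; subst j' d2.
    have hj : j < (size w).+1 by rewrite -szq (onth_lt ea2).
    have [a' [X2 [e1' e2' e3' eX2]]] := hq j hj.
    move: ey2; rewrite e3' => -[<-] /=; rewrite eX2 inE (onth_index up ex).
    have -> : (j, d') \in p by apply/onthP; exists (index (i, d) p).+1.
    case/orP => [/andP [/eqP ei /eqP ec]|/andP []].
      by rewrite -ei ec (onth_index up hl) ltnSn.
    rewrite eX inE pin /= => /andP [h1 h2] h3; rewrite leqW //= ltn_neqAle h2 andbT.
    apply/eqP => h4; move: h3; move: hk; rewrite h4 hl' => -[-> ->].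
    by rewrite !eqxx.
Qed.

End Tiled.

Lemma node_sat t p z c s (u : 'I_(size w).+1) : tiling t -> ispath (kG K) t p ->
  map (olab (klab (k := K)) t) p = map Some (nodeword z) ->
  sat (g := ed w) (nu1 u) (penv P) (tnode to_msot c s) <->
  exists l, onth p l = Some (val u, c) /\ onth z l != Some None.
Proof.
move=> ht hp hz; rewrite -[tnode to_msot c s]/(fdfa 1 (projT1 (recog_node_lang c))) sat_dfa.
rewrite -(@node_langP t p z ht hp hz 1 (nu1 u) c u isT (fun=> erefl)).
by split=> /(projT2 (recog_node_lang c) _).
Qed.

Lemma edge_sat t p z c c' b (u v : 'I_(size w).+1) : tiling t -> ispath (kG K) t p ->
  map (olab (klab (k := K)) t) p = map Some (nodeword z) ->
  sat (g := ed w) (nu2 u v) (penv P) (tedge to_msot c c' b) <->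
  exists l l', [/\ onth p l = Some (val u, c), onth p l' = Some (val v, c') &
    onth z l = Some (Some b) /\ l < l' /\ forall k, l < k < l' -> onth z k = Some None].
Proof.
move=> ht hp hz; rewrite -[tedge to_msot c c' b]/(fdfa 2 (projT1 (recog_edge_lang c c' b))) sat_dfa.
rewrite -(@edge_langP t p z ht hp hz (nu2 u v) c c' b u v (fun=> erefl) (fun=> erefl)).
by split=> /(projT2 (recog_edge_lang c c' b) _).
Qed.

End Word.

Hypothesis K_dom : forall t, kL (k := K) t -> exists y, map (ksym (k := K)) t = nodeword y.

(** An output node [(u, c)] is a visible node of the path of [K], and [cnt z] of its index on the
    path is its number in [ed (erase z)]; this numbering is the isomorphism. *)
Lemma to_msot_ed (w : seq A) (h : graph unit B) : msot_rel to_msot (ed w) h <->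
  exists z, kt_rel K (nodeword (map Some w)) (nodeword z) /\ giso h (ed (erase z)).
Proof.
split.
- case=> P [+ [f [injf him hlab hed]]].
  rewrite -[tdom to_msot]/(FAnd _ _) sat_and sat_dfa => /andP [_ hd]; move/(projT2 recog_dom_lang _)/(dom_langP P K_dom): hd.
  case=> t [ht hs [hL [p [zz [hp hpz [z ez]]]]]]; subst zz.
  exists z; split; first by exists t, p.
  have pos v : exists l, onth p l = Some (val (f v).1, (f v).2) /\ onth z l != Some None.
    by apply/(node_sat (f v).2 (glab h v) (f v).1 ht hp hpz); apply: hlab.
  have [l hl] := fin_all_exists pos.
  have lsz v : l v <= size z by rewrite -ltnS -(size_p hpz) (onth_lt (hl v).1).
  have ilt v : cnt z (l v) < (size (erase z)).+1 by rewrite ltnS cnt_leq.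
  exists (fun v => Ordinal (ilt v) : gV (ed (erase z))); split.
  + have inj : injective (fun v => Ordinal (ilt v)).
      move=> v v' [] e; have [h1 h2] := hl v; have [h1' h2'] := hl v'.
      have el := cnt_inj (lsz v) (lsz v') h2 h2' e.
      move: h1'; rewrite -el h1 => -[e1 e2]; apply: injf.
      by apply: injective_projections => //; apply: val_inj.
    have surj (k : 'I_(size (erase z)).+1) : exists v, cnt z (l v) = k.
      have [l0 [h1 h2 h3]] := @cnt_surj _ z k (ltn_ord k).
      have /ltn_onth [[i c] hl0] : l0 < size p by rewrite (size_p hpz) ltnS.
      have [a [ea pa hi _ _]] := path_node_data ht hp hpz hl0.
      have /(him (Ordinal hi) c) [v ev] : #|[pred s | sat (g := ed w) (nu1 (Ordinal hi)) (penv P)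
          (tnode to_msot c s)]| = 1.
        apply/(unit_card1 [pred s | sat (g := ed w) (nu1 (Ordinal hi)) (penv P) (tnode to_msot c s)]).
        by apply/(node_sat c tt (Ordinal hi) ht hp hpz); exists l0.
      exists v.
      have [h4 h5] := hl v; rewrite ev /= in h4; rewrite -h3; congr cnt.
      by case: (hp) => _ up _ _; apply: onth_eq_inj up h4 hl0.
    have [g hg] := fin_all_exists surj; exists g; last by move=> k; apply: val_inj; apply: hg.
    by move=> v; apply: inj; apply: val_inj; rewrite /= hg.
  + by move=> v; case: (glab h v).
  + move=> v b v'; rewrite hed; have [h1 h2] := hl v; have [h1' h2'] := hl v'.
    case: (hp) => _ up _ _; apply/idP/idP.
      rewrite /=; case/andP => /eqP e1 /eqP e2.
      apply/(edge_sat _ _ _ _ _ ht hp hpz); exists (l v), (l v'); split=> //.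
      apply/cnt_next => //; split=> //; split=> //.
      have /ltn_onth [b' hb'] : cnt z (l v) < size (erase z).
        by rewrite -ltnS; have := ilt v'; rewrite e1.
      by rewrite hb' -(onth_nth b _ _ _ hb') e2.
    move/(edge_sat _ _ _ _ _ ht hp hpz) => [l1 [l2 [h3 h4 h5]]].
    have e1 := onth_eq_inj up h1 h3; have e2 := onth_eq_inj up h1' h4; subst l1 l2.
    have [_ [e1 e2]] := (@cnt_next _ z _ _ b (lsz v') h2').1 h5.
    by rewrite /= e1 eqxx (onth_nth b _ _ _ e2) eqxx.
- case=> z [[t [p [hL ht hp hz]]] [f [bf _ hed]]].
  pose P (k : 'I_n) : {set 'I_(size w).+1} := [set i : 'I_(size w).+1 | onth t i == Some (enum_val k)].
  have st : size t = (size w).+1.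
    by have := congr1 size ht; rewrite size_map size_nodeword size_map.
  have til : tiling P t.
    split=> // i a ea; apply/ffunP => k; rewrite !ffunE inE ea.
    by apply/eqP/eqP => [[->]|->].
  have lab : labelled t by split=> //; exists p, (nodeword z); split=> //; exists z.
  exists P; split.
    rewrite -[tdom to_msot]/(FAnd _ _) sat_and sat_dfa; apply/andP; split.
      by apply/is_stringP; apply: ed_string_graph.
     apply/(projT2 recog_dom_lang _)/(dom_langP P K_dom).
    by exists t.
  have surj (k : 'I_(size (erase z)).+1) : exists x : nat * ('I_(size w).+1 * C),
      [/\ onth p x.1 = Some (val x.2.1, x.2.2), onth z x.1 != Some None, x.1 <= size z & cnt z x.1 = k].
    have [l0 [h1 h2 h3]] := @cnt_surj _ z k (ltn_ord k).
    have /ltn_onth [[i c] hl0] : l0 < size p by rewrite (size_p hz) ltnS.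
    have [a [ea pa hi _ _]] := path_node_data til hp hz hl0.
    by exists (l0, (Ordinal hi, c)).
  have [x hx] := fin_all_exists surj; exists (fun v => (x (f v)).2).
  case: (hp) => _ up _ _.
  have xinj k k' : (x k).2 = (x k').2 -> k = k'.
    move=> e; apply: val_inj; have [h1 h2 h3 h4] := hx k; have [h1' h2' h3' h4'] := hx k'.
    rewrite -[val k]h4 -[val k']h4'; congr cnt; rewrite e in h1; apply: onth_eq_inj up h1 h1'.
  split.
  + by move=> v v' /xinj; apply: bij_inj.
  + move=> u c; rewrite (unit_card1 [pred s | sat (g := ed w) (nu1 u) (penv P) (tnode to_msot c s)]).
    apply: (iff_trans _ (iff_sym (node_sat c tt u til hp hz))); split.
      case=> v ev; have [h1 h2 _ _] := hx (f v); exists (x (f v)).1.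
      by rewrite h1 ev.
    case=> l [h1 h2]; have [a [_ _ _ hls _]] := path_node_data til hp hz h1.
    have hk : cnt z l < (size (erase z)).+1 by rewrite ltnS cnt_leq.
    case: bf => f' fK f'K; exists (f' (Ordinal hk)); rewrite f'K.
    have [h3 h4 h5 h6] := hx (Ordinal hk); have el := cnt_inj h5 hls h4 h2 h6.
    rewrite el h1 in h3; case: h3 => e1 e2.
    by apply: injective_projections => //; apply: val_inj.
  + move=> v; apply/(node_sat _ _ _ til hp hz); have [h1 h2 _ _] := hx (f v).
    by exists (x (f v)).1.
  + move=> v b v'; have [h1 h2 h3 h4] := hx (f v); have [h1' h2' h3' h4'] := hx (f v').
    rewrite -hed /=; apply/idP/idP.
      case/andP => /eqP e1 /eqP e2; apply/(edge_sat _ _ _ _ _ til hp hz).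
      exists (x (f v)).1, (x (f v')).1; split=> //; apply/cnt_next => //; rewrite h4 h4'.
      split=> //; split=> //.
      have /ltn_onth [b' hb'] : f v < size (erase z).
        by rewrite -ltnS -e1; apply: ltn_ord.
      by rewrite hb' -(onth_nth b _ _ _ hb') e2.
    move/(edge_sat _ _ _ _ _ til hp hz) => [l1 [l2 [h5 h6 h7]]].
    have e1 := onth_eq_inj up h1 h5; have e2 := onth_eq_inj up h1' h6; subst l1 l2.
    have [_ [e1 e2]] := (@cnt_next _ z _ _ b h3' h2').1 h7.
    by rewrite h4 h4' in e1 e2; rewrite e1 eqxx (onth_nth b _ _ _ e2) eqxx.
Qed.

End ToMso.

(** Since [m] is finitary, [K] is complete on every word [map Some w]; [is_string] in the domain
    formula reduces an arbitrary input graph to some [ed w]. *)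
Theorem implements_NMSO (A B : finType) K (m : seq A -> seq B -> Prop) :
  implements K m -> finitary m -> NMSO_ed m.
Proof.
case=> K_dom hK hf.
have mE w z : m w z <-> exists2 z', kt_rel K (nodeword (map Some w)) (nodeword z') & erase z' = z.
  have [h1 h2] := hK (map Some w); rewrite erase_Some in h1 h2.
  split; last by case=> z' /h1 h <-.
  by apply: h2; apply: hf.
exists (to_msot K); split; first exact: to_msot_wf.
move=> g h; split.
- move=> hr; have [w hw] : exists w, giso g (ed w).
    case: hr => P [+ _]; rewrite -[tdom _]/(FAnd _ _) sat_and => /andP [/is_stringP hs _].
    exact: string_graph_ed.
  have /(to_msot_ed K_dom) [z [hz hi]] := msot_rel_iso hw hr.
  by exists w, (erase z); split=> //; apply/mE; exists z.
- case=> w [z [/mE [z' hz <-] hg hh]].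
  apply: msot_rel_iso (giso_sym hg) _; apply/(to_msot_ed K_dom).
  by exists z'.
Qed.

(** * From formulas to automata *)

(** Node quantifiers are treated as set quantifiers over singletons. The state [None] records a
    second occurrence. *)
Lemma recog_count1 : recog (fun r : seq bool => count id r == 1).
Proof.
pose D := @Dfa bool (option bool) (Some false)
  (fun s b => if b then if s is Some false then Some true else None else s)
  (fun s => s == Some true).
exists D => r.
have E s : dacc D (drun (D := D) s r) =
    (if s is Some b then count id r + b == 1 else false).
  elim: r s => [|[] r IH] s /=; first by case: s => [[]|].
    by rewrite [LHS]IH; case: s => [[]|] //; rewrite ?addn1 ?addn0 ?add1n ?addnS.
  by rewrite [LHS]IH; case: s => [[]|].
by rewrite /dlang E /= addn0; apply: (iffP idP).
Qed.

Section FormulaDfa.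
Variable A : finType.

(** The alphabet of a [dfa] may be any type, so a letter records the values of all variables at once
    and every subformula is read over the same alphabet. *)
Definition fletter_t := (option A * (nat -> bool) * (nat -> bool))%type.

Definition fenc (w : seq A) (nu : nat -> option 'I_(size w).+1)
    (mu : nat -> {set 'I_(size w).+1}) : seq fletter_t :=
  [seq (onth w (val i), (fun x => nu x == Some i), (fun X => i \in mu X)) | i <- enum 'I_(size w).+1].

Lemma has_enum_ord (k : nat) (p : pred 'I_k) : has p (enum 'I_k) = [exists i, p i].
Proof.
apply/hasP/existsP => [[i _ h]|[i h]]; first by exists i.
by exists i; rewrite ?mem_enum.
Qed.

Definition edgeq (l m r : option (bool * bool)) : bool :=
  if m is Some (p, _) then if r is Some (_, q) then ~~ (p && q) else true else true.

Lemma onth_fenc w nu mu (i : 'I_(size w).+1) : onth (@fenc w nu mu) i =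
  Some (onth w (val i), (fun x => nu x == Some i), (fun X => i \in mu X)).
Proof. by rewrite onth_map onth_enum_ord. Qed.

Lemma size_fenc w nu mu : size (@fenc w nu mu) = (size w).+1.
Proof. by rewrite size_map -cardE card_ord. Qed.

Lemma map_zip_enum (Y Z : Type) k (f : 'I_k -> Y) (g : 'I_k -> Z) :
  zip (map f (enum 'I_k)) (map g (enum 'I_k)) = [seq (f i, g i) | i <- enum 'I_k].
Proof. by elim: (enum 'I_k) => //= i s ->. Qed.

Lemma seq_ord_map k (Y : Type) (r : seq Y) : size r = k -> exists f : 'I_k -> Y, r = map f (enum 'I_k).
Proof.
move=> sr; case: r sr => [|y0 r] sr.
  subst k; have f0 : 'I_0 -> Y by case.
  by exists f0; case: (enum 'I_0) (size_enum_ord 0).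
exists (fun i => nth y0 (y0 :: r) i); apply: eq_from_onth => i; rewrite onth_map.
case: (ltnP i k) => h; last by rewrite !onth_default ?size_enum_ord ?sr.
rewrite -[i]/(val (Ordinal h)) onth_enum_ord /=.
have [y hy] : exists y, onth (y0 :: r) i = Some y by apply: ltn_onth; rewrite sr.
by rewrite hy -(onth_nth y0 _ _ _ hy).
Qed.

Lemma count1_ord k (f : 'I_k -> bool) : (count id (map f (enum 'I_k)) == 1) <->
  exists v, f = (fun i => i == v).
Proof.
have -> : count id (map f (enum 'I_k)) = #|[pred i | f i]|.
  by rewrite count_map cardE -(size_filter _ (enum 'I_k)) /enum_mem; congr size; rewrite -filter_predI; apply: eq_filter => i; rewrite /= andbT.
split.
- move/eqP => h; have /card1P : #|[pred i | f i]| == 1 by rewrite h.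
  case=> v hv; exists v; apply: functional_extensionality => i.
  by have := hv i; rewrite !inE.
- case=> v ->; apply/eqP; rewrite -(card1 v); exact: eq_card.
Qed.

Definition setx x (z : fletter_t * bool) : fletter_t := (z.1.1.1, upd z.1.1.2 x z.2, z.1.2).
Definition setX X (z : fletter_t * bool) : fletter_t := (z.1.1, upd z.1.2 X z.2).

Lemma fenc_upd1 w nu mu x v : @fenc w (upd nu x (Some v)) mu =
  map (setx x) (zip (fenc nu mu) (map (fun i => i == v) (enum 'I_(size w).+1))).
Proof.
rewrite /fenc map_zip_enum -map_comp; apply: eq_map => i; rewrite /setx /=.
congr (_, _, _); apply: functional_extensionality => y; rewrite /upd; case: (y == x) => //.
by rewrite -[LHS]/(v == i) eq_sym.
Qed.

Lemma fenc_upd2 w nu mu X (E : {set 'I_(size w).+1}) : @fenc w nu (upd mu X E) =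
  map (setX X) (zip (fenc nu mu) (map (fun i => i \in E) (enum 'I_(size w).+1))).
Proof.
rewrite /fenc map_zip_enum -map_comp; apply: eq_map => i; rewrite /setX /=.
by congr (_, _); apply: functional_extensionality => y; rewrite /upd; case: eqP.
Qed.

(** Büchi's translation by induction on the formula: connectives by products and complements,
    quantifiers by projection of a guessed track. *)
Lemma formula_recog (f : mso unit A) : { L : seq fletter_t -> Prop & recog L &
  forall w nu mu, sat (g := ed w) nu mu f <-> L (@fenc w nu mu) }.
Proof.
elim: f => [s x|c x y|x y|x X|f [L r h]|f [L r h] f' [L' r' h']|f [L r h] f' [L' r' h']|x f [L r h]|X f [L r h]].
- exists (fun s => has (fun z : fletter_t => z.1.2 x) s); first exact: recog_has.
  move=> w nu mu; rewrite has_map has_enum_ord /=.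
  case: (nu x) => [u|]; last by split=> // /existsP [].
  by case: s; split=> // _; apply/existsP; exists u => /=.
(* An edge is an existential pattern of two adjacent cells, so it is expressed as the failure of the
   local condition that forbids the pattern everywhere. *)
- pose g (z : fletter_t) := ((z.1.1 == Some c) && z.1.2 x, z.1.2 y).
  exists (fun s => ~ nbr edgeq (map g s)); first exact: (recog_not (recog_map g (recog_nbr _))).
  move=> w nu mu; have eg (i : 'I_(size w).+1) : onth (map g (fenc nu mu)) i =
      Some ((onth w i == Some c) && (nu x == Some i), nu y == Some i).
    by rewrite onth_map onth_fenc.
  rewrite /=; split.
    case ex: (nu x) => [u|] //; case ey: (nu y) => [v|] // /andP [/eqP e1 /eqP e2] H.
    have hu : u < size w by rewrite -ltnS -e1 ltn_ord.
    have [d hd] := ltn_onth hu; have ed' := onth_nth c _ _ _ hd.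
    have := H u; rewrite size_map size_fenc ltn_ord => /(_ isT); rewrite /edgeq /= eg.
    by rewrite -e1 eg ex ey hd -ed' e2 !eqxx.
  move=> H; have : ~~ [forall i : 'I_(size w).+1, edgeq (cell (map g (fenc nu mu)) i)
      (cell (map g (fenc nu mu)) i.+1) (cell (map g (fenc nu mu)) i.+2)].
    apply/negP => /forallP h; apply: H => i; rewrite size_map size_fenc => hi.
    exact: (h (Ordinal hi)).
  rewrite negb_forall => /existsP [i]; rewrite /edgeq /= eg.
  case e: (onth _ i.+1) => [[p q]|] //; rewrite negbK => /andP [/andP [/eqP e1 /eqP ->] hq].
  have hi := onth_lt e; rewrite size_map size_fenc in hi.
  move: e; rewrite (eg (Ordinal hi)) => -[_ e2]; rewrite -e2 in hq; rewrite (eqP hq) /=.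
  by rewrite eqxx (onth_nth c _ _ _ e1) eqxx.
- exists (fun s => has (fun z : fletter_t => z.1.2 x && z.1.2 y) s); first exact: recog_has.
  move=> w nu mu; rewrite has_map has_enum_ord /=; split.
    case ex: (nu x) => [u|] //; case ey: (nu y) => [v|] // /eqP <-.
    by apply/existsP; exists u; rewrite /= eqxx.
  by case/existsP => i /= /andP [/eqP -> /eqP ->]; rewrite eqxx.
- exists (fun s => has (fun z : fletter_t => z.1.2 x && z.2 X) s); first exact: recog_has.
  move=> w nu mu; rewrite has_map has_enum_ord /=; split.
    case ex: (nu x) => [u|] // hu.
    by apply/existsP; exists u; rewrite /= eqxx hu.
  by case/existsP => i /= /andP [/eqP -> ->].
- exists (fun s => ~ L s); first exact: recog_not.
  by move=> w nu mu; rewrite -h; split=> /negP.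
- exists (fun s => L s /\ L' s); first exact: recog_and.
  by move=> w nu mu; rewrite -h -h'; split=> /andP.
- exists (fun s => L s \/ L' s); first exact: recog_or.
  by move=> w nu mu; rewrite -h -h'; split=> /orP.
- exists (fun s => exists2 b : seq bool, size b = size s &
     (count id (unzip2 (zip s b)) == 1) /\ L (map (setx x) (zip s b))).
    exact: (recog_proj (recog_and (recog_map snd recog_count1) (recog_map (setx x) r))).
  move=> w nu mu; split.
    case/existsP => v /h; rewrite fenc_upd1 => hv.
    exists (map (fun i => i == v) (enum 'I_(size w).+1)).
      by rewrite size_map -cardE card_ord size_fenc.
    rewrite unzip2_zip; last by rewrite size_fenc size_map -cardE card_ord.
    split=> //.
    by apply/count1_ord; exists v.
  case=> b; rewrite size_fenc => sb; rewrite unzip2_zip; last by rewrite size_fenc sb.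
  case=> hc hL; have [g eg] := seq_ord_map sb; subst b.
  case/count1_ord: hc => v eg; subst g; apply/existsP; exists v; apply/h.
  by rewrite fenc_upd1.
- exists (fun s => exists2 b : seq bool, size b = size s & L (map (setX X) (zip s b))).
    exact: (recog_proj (recog_map (setX X) r)).
  move=> w nu mu; split.
    case/existsP => E /h; rewrite fenc_upd2 => hv.
    exists (map (fun i => i \in E) (enum 'I_(size w).+1)) => //.
    by rewrite size_map -cardE card_ord size_fenc.
  case=> b; rewrite size_fenc => sb hL; have [g eg] := seq_ord_map sb; subst b.
  apply/existsP; exists [set i | g i]; apply/h; rewrite fenc_upd2.
  move: hL; congr L; congr map; congr zip; apply: eq_map => i; by rewrite inE.
Qed.

End FormulaDfa.

(** * Following the output path with two 2gsm's *)

Definition tsym_encode (X : Type) (s : tsym X) : option (option X) :=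
  match s with LMark => None | RMark => Some None | Letter a => Some (Some a) end.
Definition tsym_decode (X : Type) (o : option (option X)) : tsym X :=
  match o with None => LMark | Some None => RMark | Some (Some a) => Letter a end.
Lemma tsym_encodeK (X : Type) : cancel (@tsym_encode X) (@tsym_decode X). Proof. by case. Qed.
HB.instance Definition _ (X : finType) := Finite.copy (tsym X) (can_type (@tsym_encodeK X)).

Lemma tsym_eqbP (X : eqType) (s t : tsym X) : reflect (s = t) (tsym_eqb s t).
Proof.
by case: s t => [||a] [||b] /=; apply: (iffP idP) => // [/eqP ->|[->]].
Qed.

Section RelationMachine.
Variables (X Y Q : finType) (qi qf : Q).
Variable tr : Q -> tsym X -> Q -> option Y -> hmove -> bool.

Definition olist (o : option Y) : seq Y := if o is Some y then [:: y] else [::].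

Inductive rreach (w : seq X) : Q * nat -> seq Y -> Q * nat -> Prop :=
| rreach_refl k : rreach w k [::] k
| rreach_step p i q o e j z k : p != qf -> tr p (tape w i) q o e ->
    move_head (size w) i e = Some j -> rreach w (q, j) z k -> rreach w (p, i) (olist o ++ z) k.

(* [None] is a dead state: it is entered when the instruction does not apply. *)
Definition rel_instr (x : Q * tsym X * Q * option Y * hmove) : instr (option Q) X Y :=
  let: (p, s, q, o, e) := x in Instr (Some p) s (Some q) (olist o) e None [::] MStay.

Definition rel_delta : seq (instr (option Q) X Y) :=
  [seq rel_instr x | x <- enum {: Q * tsym X * Q * option Y * hmove} &
    (x.1.1.1.1 != qf) && tr x.1.1.1.1 x.1.1.1.2 x.1.1.2 x.1.2 x.2].

Lemma rel_delta_wf : all (fun t => i_p t != Some qf) rel_delta.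
Proof.
rewrite all_map; apply/allP => -[[[[p s] q] o] e]; rewrite mem_filter => /andP [/andP [h _] _] /=.
by apply: contraNneq h => -[->].
Qed.

Definition rel_gsm : gsm2 X Y := @Gsm2 X Y (option Q) rel_delta (Some qi) (Some qf) rel_delta_wf.

Lemma inlist_rel_delta t : inlist t rel_delta <-> exists p s q o e,
  [/\ t = rel_instr (p, s, q, o, e), p != qf & tr p s q o e].
Proof.
rewrite /rel_delta; split.
- suff key l : (forall x, x \in l -> (x.1.1.1.1 != qf) && tr x.1.1.1.1 x.1.1.1.2 x.1.1.2 x.1.2 x.2) ->
    inlist t [seq rel_instr x | x <- l] -> exists p s q o e,
      [/\ t = rel_instr (p, s, q, o, e), p != qf & tr p s q o e].
    by apply: key => x; rewrite mem_filter => /andP [].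
  elim: l => //= x l IH hl [<-|/IH]; last by apply=> y hy; apply: hl; rewrite inE hy orbT.
  have := hl x (mem_head _ _); case: x {hl} => -[[[p s] q] o] e /andP [h1 h2].
  by exists p, s, q, o, e.
- case=> p [s [q [o [e [-> h1 h2]]]]].
  have : (p, s, q, o, e) \in [seq x <- enum {: Q * tsym X * Q * option Y * hmove} |
    (x.1.1.1.1 != qf) && tr x.1.1.1.1 x.1.1.1.2 x.1.1.2 x.1.2 x.2].
    by rewrite mem_filter /= h1 h2 mem_enum.
  elim: (filter _ _) => //= y l IH; rewrite inE => /orP [/eqP <-|/IH h]; first by left.
  by right.
Qed.

Lemma rel_gsm_dead w c c' : star (gstep rel_gsm w) c c' -> c.1.1 = None -> c'.1.1 = None.
Proof.
elim=> // {}c c1 {}c' hs _ IH; case: c hs => -[q i] y /=; case: c1 IH => -[q1 i1] y1 _.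
by case=> u /inlist_rel_delta [? [? [? [? [? [-> _ _]]]]]] [/= <-].
Qed.

Lemma rel_gsmP w z : gsm_rel rel_gsm w z <-> exists j, rreach w (qi, 0) z (qf, j).
Proof.
split.
- case=> j.
  suff key c c' : star (gstep rel_gsm w) c c' -> forall q, c.1.1 = Some q -> c'.1.1 = Some qf ->
      exists2 y, rreach w (q, c.1.2) y (qf, c'.1.2) & c'.2 = c.2 ++ y.
    move=> /key /(_ qi erefl erefl) [y h /= ->]; by exists j.
  elim=> {c c' j} [c q -> [->]|c c1 c' hs hs' IH q eq ef].
    by exists [::]; [apply: rreach_refl | rewrite cats0].
  case: c hs eq => [[p i] y] /=; case: c1 hs' IH => [[p1 i1] y1] hs' IH.
  case=> t /inlist_rel_delta [p' [s [q' [o [e [-> h1 h2]]]]]] [/= <-].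
  case: tsym_eqbP => [es|_] [e1 e2 e3] [eq]; subst p1 y1 q.
    have [y2 h3 h4] := IH q' erefl ef; exists (olist o ++ y2); last by rewrite h4 catA.
    by apply: rreach_step h1 _ e3 h3; rewrite -es.
  by rewrite (rel_gsm_dead hs') // in ef; rewrite -e1.
- case=> j h; exists j.
  suff key k y k' : rreach w k y k' -> forall y0, star (gstep rel_gsm w)
      (Some k.1, k.2, y0) (Some k'.1, k'.2, y0 ++ y) by apply: (key _ _ _ h [::]).
  elim=> {k y k' h j} [k y0|p i q o e j y k h1 h2 h3 _ IH y0].
    by rewrite cats0; apply: star_refl.
  rewrite catA; apply: star_step (IH _) => /=.
  exists (rel_instr (p, tape w i, q, o, e)); first by apply/inlist_rel_delta; exists p, (tape w i), q, o, e.
  by split=> //=; case: tsym_eqbP.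
Qed.

End RelationMachine.

Lemma tape_letter (X : Type) (v : seq X) p a :
  tape v p = Letter a <-> exists2 p', p = p'.+1 & onth v p' = Some a.
Proof.
case: p => [|p]; rewrite /tape /=; first by split=> // -[].
case: (ltnP p (size v)) => h; last first.
  by split=> // -[_ [<-]]; rewrite onth_default.
have [x hx] := ltn_onth h; rewrite (drop_nth x h) (onth_nth x _ _ _ hx).
by split=> [[<-]|[_ [<-]]]; [exists p | rewrite hx => -[->]].
Qed.

Lemma tape_RMark (X : Type) (v : seq X) p : tape v p = RMark -> size v < p.
Proof.
case: p => [|p]; rewrite /tape //=; case: (ltnP p (size v)) => // h.
by have [x hx] := ltn_onth h; rewrite (drop_nth x h).
Qed.

Lemma move_headE N i e j : move_head N i e = Some j ->
  j = match e with MLeft => i.-1 | MStay => i | MRight => i.+1 end.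
Proof. by case: e => /=; [case: i => // ? []|case|case: ifP => // _ []]. Qed.

Section Marking.
Variables (U S : finType) (step : S -> U * (bool * bool) -> S) (s0 : S).
Implicit Type (s : seq U) (M : nat -> bool * bool).

Fixpoint mark o M s : seq (U * (bool * bool)) :=
  if s is u :: s' then (u, M o) :: mark o.+1 M s' else [::].
Definition bare : nat -> bool * bool := fun=> (false, false).
Definition mark1 i : nat -> bool * bool := fun k => (k == i, false).
Definition mark2 i j : nat -> bool * bool := fun k => (k == i, k == j).

Definition pre M s p := foldl step s0 (mark 0 M (take p s)).
Definition post M s p q := foldl step q (mark p M (drop p s)).

Lemma onth_mark o M s i : onth (mark o M s) i = omap (fun u => (u, M (o + i))) (onth s i).
Proof. by elim: s o i => [|u s IH] o [|i] //=; rewrite ?addn0 // IH addSnnS. Qed.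

Lemma mark_cat o M s1 s2 : mark o M (s1 ++ s2) = mark o M s1 ++ mark (o + size s1) M s2.
Proof. by elim: s1 o => [|u s IH] o /=; rewrite ?addn0 // IH addSnnS. Qed.

Lemma mark_eq o M M' s : (forall k, o <= k < o + size s -> M k = M' k) -> mark o M s = mark o M' s.
Proof.
elim: s o => //= u s IH o h; rewrite h ?leqnn ?addnS ?ltnS ?leq_addr //; congr (_ :: _).
by apply: IH => k /andP [h1 h2]; apply: h; rewrite addnS -addSn h2 ltnW.
Qed.

Lemma mark_bare o s : mark o bare s = mark 0 bare s.
Proof. by elim: s o => //= u s IH o; rewrite IH [in RHS]IH. Qed.

Lemma foldl_mark M s p : p <= size s -> foldl step s0 (mark 0 M s) = post M s p (pre M s p).
Proof. by move=> h; rewrite -[in LHS](cat_take_drop p s) mark_cat foldl_cat add0n size_takel. Qed.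

Lemma pre_S M s p u : onth s p = Some u -> pre M s p.+1 = step (pre M s p) (u, M p).
Proof.
move=> h; rewrite /pre (take_onth h) -cats1 mark_cat foldl_cat add0n size_takel //.
exact: ltnW (onth_lt h).
Qed.

Lemma post_S M s p u q : onth s p = Some u -> post M s p q = post M s p.+1 (step q (u, M p)).
Proof. by move=> h; rewrite /post (drop_nth u (onth_lt h)) (onth_nth _ _ _ _ h). Qed.

Lemma pre_ext M M' s p : (forall k, k < p -> M k = M' k) -> pre M s p = pre M' s p.
Proof.
move=> h; congr foldl; apply: mark_eq => k /= hk; apply: h.
by apply: leq_trans hk _; rewrite add0n size_take_min geq_minl.
Qed.

Lemma post_ext M M' s p q : (forall k, p <= k -> M k = M' k) -> post M s p q = post M' s p q.
Proof. by move=> h; congr foldl; apply: mark_eq => k /andP [hk _]; apply: h. Qed.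

(** A cell is told what the unmarked word does on either side of it. A machine standing there can
    evaluate the automaton on the whole word with marks on this cell, without moving. *)
Fixpoint ann q s : seq (U * S * {ffun S -> S}) :=
  if s is u :: s' then
    (u, q, [ffun x => foldl step x (mark 0 bare s')]) :: ann (step q (u, (false, false))) s'
  else [::].

Lemma size_ann q s : size (ann q s) = size s.
Proof. by elim: s q => //= u s IH q; rewrite IH. Qed.

Lemma onth_ann q s p : onth (ann q s) p = omap (fun u => (u, foldl step q (mark 0 bare (take p s)),
  [ffun x => foldl step x (mark 0 bare (drop p.+1 s))])) (onth s p).
Proof. by elim: s q p => [|u s IH] q [|p] //=; rewrite ?drop0 // IH mark_bare. Qed.

Lemma ann_letter s p u q (h : {ffun S -> S}) : onth (ann s0 s) p = Some (u, q, h) <->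
  [/\ onth s p = Some u, q = pre bare s p & h = [ffun x => post bare s p.+1 x]].
Proof.
have e : [ffun x => foldl step x (mark 0 bare (drop p.+1 s))] = [ffun x => post bare s p.+1 x].
  by apply/ffunP => x; rewrite !ffunE /post (mark_bare p.+1).
rewrite onth_ann e; case: (onth s p) => [u'|] /=; last by split=> // -[].
by split=> [[-> <- <-]|[[->] -> ->]].
Qed.

End Marking.

Section Walker.
Variables (U S C B : finType) (step : S -> U * (bool * bool) -> S) (s0 : S).
Variables (Ast Aen : C -> pred S) (Aed : C * C * B -> pred S).

Definition wstate := option (option (C + C * C * B * (S + {ffun S -> S}))).
Notation Seek := (None).
Notation Fin := (Some None).
Notation At c := (Some (Some (inl c))).
Notation Rt e q := (Some (Some (inr (e, inl q)))).
Notation Lf e h := (Some (Some (inr (e, inr h)))).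

(* An edge is guessed and its label written before its other end is searched; [Rt] carries the
   state reached so far, [Lf] the effect of the part of the word already passed. *)
Definition wtr (p : wstate) (t : tsym (U * S * {ffun S -> S})) (p' : wstate) (o : option B)
    (e : hmove) : bool :=
  match t, p, p', o, e with
  | _, Seek, Seek, None, MRight => true
  | Letter (u, q, k), Seek, At c, None, MStay => Ast c (k (step q (u, (true, false))))
  | Letter (u, q, k), At c, Fin, None, MStay => Aen c (k (step q (u, (true, false))))
  | Letter (u, q, k), At c, At c', Some b, MStay => Aed (c, c', b) (k (step q (u, (true, true))))
  | Letter (u, q, k), At c, Rt ed r, Some b, MRight =>
      (ed.1.1 == c) && (ed.2 == b) && (r == step q (u, (true, false)))
  | Letter (u, q, k), At c, Lf ed h, Some b, MLeft =>
      (ed.1.1 == c) && (ed.2 == b) && (h == [ffun x => k (step x (u, (true, false)))])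
  | Letter (u, q, k), Rt ed r, Rt ed' r', None, MRight => (ed' == ed) && (r' == step r (u, (false, false)))
  | Letter (u, q, k), Rt ed r, At c, None, MStay => (c == ed.1.2) && Aed ed (k (step r (u, (false, true))))
  | Letter (u, q, k), Lf ed h, Lf ed' h', None, MLeft =>
      (ed' == ed) && (h' == [ffun x => h (step x (u, (false, false)))])
  | Letter (u, q, k), Lf ed h, At c, None, MStay => (c == ed.1.2) && Aed ed (h (step q (u, (false, true))))
  | _, _, _, _, _ => false
  end.

Variable s : seq U.
Notation v := (ann step s0 s).
Notation run M := (foldl step s0 (mark 0 M s)).
Notation pre := (pre step s0).
Notation post := (post step).

Inductive rwalk : nat -> C -> seq B -> Prop :=
| rwalk_end i c : i < size s -> Aen c (run (mark1 i)) -> rwalk i c [::]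
| rwalk_step i c j c' b z : i < size s -> j < size s -> Aed (c, c', b) (run (mark2 i j)) ->
    rwalk j c' z -> rwalk i c (b :: z).

Lemma run_mark1 i u : onth s i = Some u ->
  run (mark1 i) = post bare s i.+1 (step (pre bare s i) (u, (true, false))).
Proof.
move=> h; rewrite (foldl_mark _ _ _ (ltnW (onth_lt h))) (post_S _ _ _ h) /mark1 eqxx.
rewrite (@pre_ext _ _ _ _ _ bare); last by move=> k hk; rewrite ltn_eqF.
by apply: post_ext => k hk; rewrite gtn_eqF.
Qed.

Lemma run_mark2 i u : onth s i = Some u ->
  run (mark2 i i) = post bare s i.+1 (step (pre bare s i) (u, (true, true))).
Proof.
move=> h; rewrite (foldl_mark _ _ _ (ltnW (onth_lt h))) (post_S _ _ _ h) /mark2 eqxx.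
rewrite (@pre_ext _ _ _ _ _ bare); last by move=> k hk; rewrite ltn_eqF.
by apply: post_ext => k hk; rewrite gtn_eqF.
Qed.

(** The mark on [i] lies in the prefix, whose state the machine has carried along; the suffix behind
    [j] is unmarked, so the annotation of cell [j] suffices for it. *)
Lemma run_right i j u : i < j -> onth s j = Some u ->
  run (mark2 i j) = post bare s j.+1 (step (pre (mark1 i) s j) (u, (false, true))).
Proof.
move=> hij h; rewrite (foldl_mark _ _ _ (ltnW (onth_lt h))) (post_S _ _ _ h) /mark2 eqxx gtn_eqF //.
rewrite (@pre_ext _ _ _ _ _ (mark1 i)); last by move=> k hk; rewrite /mark1 (ltn_eqF hk).
by apply: post_ext => k hk; rewrite !gtn_eqF // (ltn_trans hij).
Qed.

(** Here the annotation gives the state of the unmarked prefix, and the machine has carried the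
    effect of the suffix that contains the mark on [i]. *)
Lemma run_left i j u : j < i -> onth s j = Some u ->
  run (mark2 i j) = post (mark1 i) s j.+1 (step (pre bare s j) (u, (false, true))).
Proof.
move=> hij h; rewrite (foldl_mark _ _ _ (ltnW (onth_lt h))) (post_S _ _ _ h) /mark2 eqxx ltn_eqF //.
rewrite (@pre_ext _ _ _ _ _ bare); last by move=> k hk; rewrite !ltn_eqF // (ltn_trans hk).
by apply: post_ext => k hk; rewrite /mark1 (gtn_eqF hk).
Qed.

Definition arrives i (ed : C * C * B) z := exists j, [/\ j < size s, Aed ed (run (mark2 i j)) & rwalk j ed.1.2 z].

(** It describes the output still to come. In the searching states the source [i] is forgotten, so
    the claim is made for every [i] whose mark explains the carried value. *)
Definition winv (p : wstate) (n : nat) (z : seq B) : Prop :=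
  match p with
  | Seek => exists i c, [/\ i < size s, Ast c (run (mark1 i)) & rwalk i c z]
  | Fin => z = [::]
  | At c => if n is i.+1 then rwalk i c z else False
  | Rt ed r => if n is j.+1 then forall i, i < j -> r = pre (mark1 i) s j -> arrives i ed z else False
  | Lf ed h => if n is j.+1 then forall i, j < i -> h = [ffun x => post (mark1 i) s j.+1 x] -> arrives i ed z
     else False
  end.

(** As the invariant looks ahead, the induction goes back from the final configuration, one
    instruction at a time. *)
Lemma winv_run p n z p' n' : rreach (Fin : wstate) wtr v (p, n) z (p', n') -> p' = Fin -> winv p n z.
Proof.
move=> h; move: {-2}(p, n) {-1}(p', n') (erefl (p, n)) (erefl (p', n')) h => k k' ek ek' h.
elim: h p n ek ek' => {k k' z} [k p n -> [-> _] -> //|p i q o e j z k hp ht hm _ IH p1 n1 [<- <-] ek ef].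
have {}IH := IH _ _ erefl ek ef.
case et: (tape v i) ht => [||[[u q0] g]].
- by case: p hp => [[[c|[ed [r|h]]]|]|] hp //; case: q IH => [[[c'|[ed' [r'|h']]]|]|] //; case: o => [?|]; case: e {hm}.
- by case: p hp => [[[c|[ed [r|h]]]|]|] hp //; case: q IH => [[[c'|[ed' [r'|h']]]|]|] //; case: o => [?|]; case: e {hm}.
case/tape_letter: et hm => n -> /ann_letter [hu -> ->] /move_headE hm {p1 n1 i}.
have hn := onth_lt hu.
case: p hp => [[[c|[ed [r|h]]]|]|] hp //; case: q IH => [[[c'|[ed' [r'|h']]]|]|] //; case: o => [b|] //;
  case: e hm => // ej; subst j; rewrite /= => IH.
- rewrite ffunE -(run_mark2 hu) => hA.
  exact: rwalk_step hA IH.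
- case: ed' IH => [[c1 c2] b1] /= IH /andP [/andP [/eqP ? /eqP ?] /eqP er]; subst c1 b1.
  have [j [hj hA hw]] : arrives n (c, c2, b) z.
    by apply: IH => //; rewrite er (pre_S _ _ _ hu) /mark1 eqxx (@pre_ext _ _ _ _ _ bare) // => l hl; rewrite ltn_eqF.
  exact: rwalk_step hA hw.
- case: ed' IH => [[c1 c2] b1] /= IH /andP [/andP [/eqP ? /eqP ?] /eqP eh]; subst c1 b1.
  case: n hu hn IH eh => // n hu hn IH eh.
  have [j [hj hA hw]] : arrives n.+1 (c, c2, b) z.
    apply: IH => //; rewrite eh; apply/ffunP => x; rewrite !ffunE (post_S _ _ _ hu) /mark1 eqxx.
    by apply: post_ext => l hl; rewrite gtn_eqF.
  exact: rwalk_step hA hw.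
- by rewrite ffunE -(run_mark1 hu) IH => hA; apply: rwalk_end.
- move=> /andP [/eqP ec hA] i hi er; subst c'; exists n; split=> //.
  by rewrite (run_right hi hu) -er; move: hA; rewrite ffunE.
- move=> /andP [/eqP ec /eqP er'] i hi er; subst ed'; apply: IH; first exact: leqW.
  by rewrite er' er (pre_S _ _ _ hu) /mark1 gtn_eqF.
- move=> /andP [/eqP ec hA] i hi er; subst c'; exists n; split=> //.
  by rewrite (run_left hi hu); move: hA; rewrite er ffunE.
- move=> /andP [/eqP ec /eqP er'] i hi er; subst ed'.
  case: n hu hn IH hi er => // n hu hn IH hi er; apply: IH; first exact: ltnW.
  by rewrite er' er; apply/ffunP => x; rewrite !ffunE (post_S _ _ _ hu) /mark1 ltn_eqF.
- rewrite ffunE -(run_mark1 hu) => hA.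
  by exists n, c'.
Qed.

Lemma tape_ann n u : onth s n = Some u ->
  tape v n.+1 = Letter (u, pre bare s n, [ffun x => post bare s n.+1 x]).
Proof. by move=> h; apply/tape_letter; exists n => //; apply/ann_letter. Qed.

Lemma wstep p n p' o e n' z k : p != Fin :> wstate -> wtr p (tape v n) p' o e ->
  move_head (size v) n e = Some n' -> rreach (Fin : wstate) wtr v (p', n') z k ->
  rreach (Fin : wstate) wtr v (p, n) (olist o ++ z) k.
Proof. exact: rreach_step. Qed.

Lemma run_Rt i ed n j z k : i < n -> n <= j -> j < size s -> Aed ed (run (mark2 i j)) ->
  rreach (Fin : wstate) wtr v (At ed.1.2, j.+1) z k ->
  rreach (Fin : wstate) wtr v (Rt ed (pre (mark1 i) s n), n.+1) z k.
Proof.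
(* Induction on the distance to the target: [n] is written as [j - d]. *)
move=> hi hnj hj hA hr; move: hi; rewrite -(subKn hnj); move: (j - n) (leq_subr n j) => d {n hnj}.
elim: d => [|d IH] hd.
  rewrite subn0 => hi; have [u hu] := ltn_onth hj.
  apply: (@wstep _ _ _ None MStay _ _ _ _ _ _ hr) => //.
  by rewrite (tape_ann hu) /= eqxx ffunE -(run_right hi hu).
move=> hi; have [u hu] : exists u, onth s (j - d.+1) = Some u.
  by apply: ltn_onth; apply: leq_ltn_trans hj; apply: leq_subr.
have e : (j - d.+1).+1 = j - d by rewrite subnSK.
apply: (@wstep _ _ _ None MRight _ _ _ _ _ _ (IH _ _)) => //; last 2 first.
- exact: ltnW.
- by rewrite -e ltnS ltnW.
- by rewrite (tape_ann hu) /= eqxx -e (pre_S _ _ _ hu) /mark1 gtn_eqF /=.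
- by rewrite /= size_ann e ltnS (leq_trans (leq_subr _ _) (ltnW hj)).
Qed.

Lemma run_Lf i ed n j z k : n < i -> j <= n -> i < size s -> Aed ed (run (mark2 i j)) ->
  rreach (Fin : wstate) wtr v (At ed.1.2, j.+1) z k ->
  rreach (Fin : wstate) wtr v (Lf ed [ffun x => post (mark1 i) s n.+1 x], n.+1) z k.
Proof.
move=> hi hnj his hA hr; elim: n hi hnj => [|n IH] hi hnj.
  have /eqP ej : j == 0 by rewrite -leqn0.
  subst j; have [u hu] := ltn_onth (ltn_trans hi his).
  apply: (@wstep _ _ _ None MStay _ _ _ _ _ _ hr) => //.
  by rewrite (tape_ann hu) /= eqxx ffunE -(run_left hi hu).
have [u hu] := ltn_onth (ltn_trans hi his).
move: hnj; rewrite leq_eqVlt => /orP [/eqP ej|hnj].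
  subst j; apply: (@wstep _ _ _ None MStay _ _ _ _ _ _ hr) => //.
  by rewrite (tape_ann hu) /= eqxx ffunE -(run_left hi hu).
apply: (@wstep _ _ _ None MLeft _ _ _ _ _ _ (IH (ltnW hi) hnj)) => //.
rewrite (tape_ann hu) /= eqxx; apply/eqP/ffunP => x.
by rewrite !ffunE (post_S _ _ _ hu) /mark1 ltn_eqF.
Qed.

Lemma run_walk i c z : rwalk i c z -> exists n, rreach (Fin : wstate) wtr v (At c, i.+1) z (Fin, n).
Proof.
elim=> {i c z} [i c hi hA|i c j c' b z hi hj hA _ [n IH]].
  have [u hu] := ltn_onth hi; exists i.+1.
  apply: (@wstep _ _ _ None MStay _ _ _ _ _ _ (rreach_refl _ _ _ _)) => //.
  by rewrite (tape_ann hu) /= ffunE -(run_mark1 hu).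
exists n; have [u hu] := ltn_onth hi; case: (ltngtP i j) => hij.
- apply: (@wstep _ _ _ (Some b) MRight _ _ _ _ _ _ (run_Rt (ed := (c, c', b)) (ltnSn i) hij hj hA IH)) => //.
    rewrite (tape_ann hu) /= !eqxx /= (pre_S _ _ _ hu) /mark1 eqxx.
    by rewrite (@pre_ext _ _ _ _ _ bare) // => l hl; rewrite ltn_eqF.
  by rewrite /= size_ann ltnS hi.
- case: i hi hA hu hij => // i hi hA hu hij.
  apply: (@wstep _ _ _ (Some b) MLeft _ _ _ _ _ _ (run_Lf (ed := (c, c', b)) (ltnSn i) hij hi hA IH)) => //.
  rewrite (tape_ann hu) /= !eqxx /=; apply/eqP/ffunP => x; rewrite !ffunE (post_S _ _ _ hu) /mark1 eqxx.
  by apply: post_ext => l hl; rewrite gtn_eqF.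
- subst j; apply: (@wstep _ _ _ (Some b) MStay _ _ _ _ _ _ IH) => //.
  by rewrite (tape_ann hu) /= ffunE -(run_mark2 hu).
Qed.

Lemma walkerP z : (exists n, rreach (Fin : wstate) wtr v (Seek, 0) z (Fin, n)) <->
  exists i c, [/\ i < size s, Ast c (run (mark1 i)) & rwalk i c z].
Proof.
split=> [[n h]|[i [c [hi hA hw]]]]; first exact: (winv_run h).
have [n hn] := run_walk hw; have [u hu] := ltn_onth hi; exists n.
(* The seeking phase is built backwards from the start cell, [d] being the distance to it. *)
suff key d : d <= i.+1 -> rreach (Fin : wstate) wtr v (Seek, i.+1 - d) z (Fin, n).
  by have := key i.+1 (leqnn _); rewrite subnn.
elim: d => [|d IH] hd.
  rewrite subn0; apply: (@wstep _ _ _ None MStay _ _ _ _ _ _ hn) => //.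
  by rewrite (tape_ann hu) /= ffunE -(run_mark1 hu).
have e : (i.+1 - d.+1).+1 = i.+1 - d by rewrite subnSK.
apply: (@wstep _ _ _ None MRight _ _ _ _ _ _ (IH (ltnW hd))) => //.
  by case: (tape _ _) => [||[[? ?] ?]].
by rewrite /= size_ann e (leq_trans (leq_subr _ _) (leqW hi)).
Qed.

End Walker.

Section Annotator.
Variables (A W S : finType) (step : S -> (option A * W) * (bool * bool) -> S) (s0 : S) (acc : pred S).
Notation U := (option A * W)%type.

Definition astate := option (option (S * {ffun S -> S})).
Notation Ini := (None).
Notation Fin := (Some None).
Notation Work q h := (Some (Some (q, h))).

(* The suffix function [h] is guessed, and each guess is checked against the next one. *)
Definition atr (p : astate) (t : tsym A) (p' : astate) (o : option (U * S * {ffun S -> S})) (e : hmove) : bool :=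
  match t, p, p', o, e with
  | LMark, Ini, Work q h, None, MRight => q == s0
  | Letter a, Work q h, Work q' h', Some (u, r, k), MRight =>
      [&& u.1 == Some a, r == q, k == h', q' == step q (u, (false, false))
        & h == [ffun x => h' (step x (u, (false, false)))]]
  | RMark, Work q h, Fin, Some (u, r, k), MStay =>
      [&& u.1 == None, r == q, k == [ffun x => x], h == [ffun x => step x (u, (false, false))]
        & acc (step q (u, (false, false)))]
  | _, _, _, _, _ => false
  end.

Variable w : seq A.

Definition letters (w : seq A) : seq (option A) := rcons (map Some w) None.

(** It speaks of the output still to come, because a guessed suffix function [h] is verified only by
    the rest of the run, up to the right end marker. *)
Definition ainv (p : astate) (n : nat) (y : seq (U * S * {ffun S -> S})) : Prop :=
  match p with
  | Ini => n = 0 -> exists s, [/\ map fst s = letters w, y = ann step s0 s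
      & acc (foldl step s0 (mark 0 bare s))]
  | Fin => y = [::]
  | Work q h => if n is i.+1 then exists s, [/\ map fst s = letters (drop i w), y = ann step q s,
      h = [ffun x => foldl step x (mark 0 bare s)] & acc (foldl step q (mark 0 bare s))] else False
  end.

Lemma ainv_run p n y p' n' : rreach (Fin : astate) atr w (p, n) y (p', n') -> n <= (size w).+1 ->
  p' = Fin -> ainv p n y.
Proof.
move=> h; move: {-2}(p, n) {-1}(p', n') (erefl (p, n)) (erefl (p', n')) h => k k' ek ek' h.
elim: h p n ek ek' => {k k' y} [k p n -> [-> _] _ -> //|p i q o e j y k hp ht hm _ IH p1 n1 [<- <-] ek hi ef].
have hj : j <= (size w).+1.
  move: hm; case: (e) => /=; last by case: ifP => // h [<-].
    by case: (i) hi => // i' hi [<-]; apply: ltnW.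
  by case=> <-.
have {}IH := IH _ _ erefl ek hj ef; move/move_headE: hm => ej {hj}.
case et: (tape w i) ht => [||a].
- case: p hp => [[[q0 h]|]|] hp //; case: q IH => [[[q' h']|]|] //; case: o => [[[? ?] ?]|]; case: e ej => //= ->.
  move=> IH /eqP eq ei; subst i q'; case: IH => s; rewrite drop0 => -[h1 h2 h3 h4].
  by exists s.
- case: p hp => [[[q0 h]|]|] hp //; case: q IH => [[[q' h']|]|] //; case: o => [[[[u1 u2] r] k0]|]; case: e ej => //= _.
  move=> -> /and5P [/eqP -> /eqP -> /eqP -> /eqP -> hA].
  have := tape_RMark et; case: i hi {et} => // i hi; rewrite ltnS => hi'.
  exists [:: (None, u2)]; rewrite drop_oversize //; split=> //=.
case/tape_letter: et => n ei ha {hi}; subst i.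
case: p hp => [[[q0 h]|]|] hp //; case: q IH => [[[q' h']|]|] //; case: o => [[[[u1 u2] r] k0]|]; case: e ej => // -> /=.
case=> s [h1 -> h3 h4] /and5P [/eqP -> /eqP -> /eqP -> /eqP eq /eqP ->].
exists ((Some a, u2) :: s); rewrite (drop_nth a (onth_lt ha)) (onth_nth _ _ _ _ ha) /=.
rewrite -eq h1; split=> //.
- by rewrite h3; congr (_ :: _); rewrite (@mark_bare _ 1).
- by rewrite h3; apply/ffunP => x; rewrite !ffunE (mark_bare 1).
- by rewrite eq (mark_bare 1) in h4 *.
Qed.

Lemma annotatorP y : (exists n, rreach (Fin : astate) atr w (Ini, 0) y (Fin, n)) <->
  exists s, [/\ map fst s = letters w, y = ann step s0 s & acc (foldl step s0 (mark 0 bare s))].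
Proof.
split=> [[n h]|[s [hs -> hA]]]; first exact: (ainv_run h).
exists (size w).+1; set h := [ffun x => foldl step x (mark 0 bare s)].
apply: (@rreach_step _ _ _ _ _ _ _ _ (Work s0 h) None MRight 1) => //=.
move: hA hs @h; rewrite -[in map fst s = _](drop0 w); move: s0 {-2 4}0 (leq0n (size w)) => q i hi.
elim: s i q hi => [|[u1 u2] s IH] i q hi hA; first by rewrite /letters => /(congr1 size); rewrite size_rcons.
case: (ltnP i (size w)) => hiw.
  have [a ha] := ltn_onth hiw; rewrite (drop_nth a hiw) (onth_nth _ _ _ _ ha) => -[e1 e2] h /=.
  set h' := [ffun x => foldl step x (mark 0 bare s)].
  apply: (@rreach_step _ _ _ _ _ _ _ _ (Work (step q (u1, u2, (false, false))) h') (Some (_, _, _)) MRight i.+2) => //=.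
  - have -> : tape w i.+1 = Letter a by apply/tape_letter; exists i.
    by rewrite e1 /= !eqxx /=; apply/eqP; rewrite /h /h'; apply/ffunP => x; rewrite !ffunE /= e1 (mark_bare 1).
  - by rewrite ltnS hiw.
  - apply: IH => //; by move: hA; rewrite /= (mark_bare 1).
rewrite drop_oversize //= => -[e1]; case: s IH hA => //= _ hA _.
have ei : i = size w by apply/eqP; rewrite eqn_leq hi.
subst i u1; apply: (@rreach_step _ _ _ _ _ _ _ _ Fin (Some (_, _, _)) MStay (size w).+1); last exact: rreach_refl.
- by [].
- have -> : tape w (size w).+1 = RMark by rewrite /tape /= ltnn.
  by rewrite /= !eqxx /= hA.
- by [].
Qed.

End Annotator.

(** * Words spelled by output graphs *)

Section Spelling.
Variables (S G : Type).

Inductive gwalk (g : graph S G) : gV g -> seq G -> Prop :=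
| gwalk_end x : (forall e y, gE g x e y = false) -> gwalk x [::]
| gwalk_step x e y z : gE g x e y -> gwalk y z -> gwalk x (e :: z).

(** Walks from a source to a sink. The notion is invariant under isomorphism and determines [z] from
    [ed z], so it replaces isomorphisms in the work of the machines. *)
Definition spells (g : graph S G) z :=
  exists2 x : gV g, (forall e y, gE g y e x = false) & gwalk x z.

Lemma giso_refl (g : graph S G) : giso g g.
Proof. by exists id; split=> //; exists id. Qed.

Lemma spells_iso g h z : giso g h -> spells g z -> spells h z.
Proof.
case=> f [[f' fK f'K] _ he] [x hx hw]; exists (f x).
  by move=> e y; rewrite -(f'K y) he.
elim: hw {hx} => {x z} [x hx|x e y z hxy _ IH]; last by apply: gwalk_step IH; rewrite he.
by apply: gwalk_end => e y; rewrite -(f'K y) he.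
Qed.

End Spelling.

Lemma gE_edP (B : finType) (z : seq B) (i j : 'I_(size z).+1) b :
  gE (ed z) i b j = (val j == (val i).+1) && (onth z i == Some b).
Proof.
rewrite /=; case: eqP => //= ej; have hi : i < size z by rewrite -ltnS -ej ltn_ord.
by have [x hx] := ltn_onth hi; rewrite hx (onth_nth _ _ _ _ hx).
Qed.

Lemma spells_ed (B : finType) (z z' : seq B) : spells (ed z') z <-> z = z'.
Proof.
split=> [[x hx hw]|->].
- suff key : z = drop (val x) z'.
    case: x hx hw key => -[|i] hi hx hw -> //=; first by rewrite drop0.
    have hi' : i < size z' by [].
    have [b hb] := ltn_onth hi'; have := hx b (Ordinal (ltnW hi)).
    by rewrite gE_edP /= hb !eqxx.
  elim: hw {hx} => {x z} [x hx|x e y z + _ ->].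
    case: (ltnP (val x) (size z')) => h; last by rewrite drop_oversize.
    have [b hb] := ltn_onth h; have := hx b (Ordinal (h : (val x).+1 < (size z').+1)).
    by rewrite gE_edP hb !eqxx.
  rewrite gE_edP => /andP [/eqP -> /eqP hb].
  by rewrite [in RHS](drop_nth e (onth_lt hb)) (onth_nth _ _ _ _ hb).
- exists ord0; first by move=> e y; rewrite gE_edP.
  suff key d (x : 'I_(size z').+1) : x + d = size z' -> gwalk (g := ed z') x (drop x z').
    by rewrite -[X in gwalk _ X](drop0 z'); apply: (key (size z')).
  elim: d x => [|d IH] x hd.
    rewrite addn0 in hd; rewrite drop_oversize ?hd //; apply: (@gwalk_end _ _ (ed z')) => e y.
    by rewrite gE_edP onth_default ?andbF ?hd.
  have hx : x < size z' by apply: leq_trans (eq_leq hd); rewrite -addSnnS leq_addr.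
  have [b hb] := ltn_onth hx; rewrite (drop_nth b hx) (onth_nth _ _ _ _ hb).
  apply: (@gwalk_step _ _ (ed z') x b (Ordinal (hx : x.+1 < (size z').+1))).
    by rewrite gE_edP hb !eqxx.
  by apply: (IH (Ordinal (hx : x.+1 < (size z').+1))); rewrite /= addSnnS.
Qed.

Lemma giso_ed_inj (B : finType) (z z' : seq B) : giso (ed z) (ed z') -> z = z'.
Proof. by move=> i; apply/spells_ed; apply: (spells_iso i); apply/spells_ed. Qed.

Section OutputGraph.
Variables (A B : finType) (T : msot unit A unit B) (w : seq A).
Variable P : 'I_(npar T) -> {set 'I_(size w).+1}.

Definition onode (x : 'I_(size w).+1 * tC T) : bool :=
  sat (g := ed w) (nu1 x.1) (penv P) (tnode T x.2 tt).

Definition oedge (x : 'I_(size w).+1 * tC T) (b : B) y : bool :=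
  sat (g := ed w) (nu2 x.1 y.1) (penv P) (tedge T x.2 y.2 b).

Definition ograph : graph unit B :=
  @Graph unit B ({x | onode x} : finType) (fun x b y => oedge (val x) b (val y)) (fun=> tt).

Lemma msot_rel_ograph : sat (g := ed w) (fun=> None) (penv P) (tdom T) -> msot_rel T (ed w) ograph.
Proof.
move=> hd; exists P; split=> //; exists val; split=> //.
- exact: val_inj.
- move=> u c; rewrite (unit_card1 [pred s | sat (g := ed w) (nu1 u) (penv P) (tnode T c s)]) /=.
  split=> [[[x hx] /= ex]|h]; first by subst x.
  by exists (exist _ (u, c) h : {x | onode x}).
- by case=> x hx /=; case: (tt).
Qed.

Lemma ograph_iso (h : graph unit B) (f : gV h -> 'I_(size w).+1 * tC T) : injective f ->
  (forall u c, (exists v, f v = (u, c)) <->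
    #|[pred s : unit | sat (g := ed w) (nu1 u) (penv P) (tnode T c s)]| = 1) ->
  (forall v e v', gE h v e v' = oedge (f v) e (f v')) -> giso h ograph.
Proof.
move=> injf im hE.
have hn v : onode (f v).
  have : exists v', f v' = ((f v).1, (f v).2) by exists v; case: (f v).
  by move/im/(unit_card1 [pred s | sat (g := ed w) (nu1 (f v).1) (penv P) (tnode T (f v).2 s)]).
pose F v : gV ograph := exist _ (f v) (hn v); exists F; split.
- have injF : injective F by move=> u v /(congr1 val) /injf.
  apply: (inj_card_bij injF); rewrite -(card_codom injF); apply: subset_leq_card.
  apply/subsetP => -[[u c] hx] _; have [v ev] : exists v, f v = (u, c).
    by apply/im; apply/(unit_card1 [pred s | sat (g := ed w) (nu1 u) (penv P) (tnode T c s)]).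
  by apply/codomP; exists v; apply: val_inj; rewrite /= ev.
- by move=> v; case: (glab h v).
- by move=> u b v; rewrite hE.
Qed.

End OutputGraph.

(** For parameters satisfying the domain formula, [ograph P] is itself an output of the
    transduction, hence by hypothesis isomorphic to some [ed z']. Any word it spells is therefore an
    output. *)
Lemma NMSO_ed_ograph (A B : finType) (T : msot unit A unit B) (m : seq A -> seq B -> Prop) :
  (forall g h, msot_rel T g h <-> exists w z, [/\ m w z, giso g (ed w) & giso h (ed z)]) ->
  forall w z, m w z <-> exists P : 'I_(npar T) -> {set 'I_(size w).+1},
    sat (g := ed w) (fun=> None) (penv P) (tdom T) /\ spells (ograph P) z.
Proof.
move=> hT w z; split=> [hm|[P [hd hs]]].
- have [P [hd [f [injf im _ hE]]]] : msot_rel T (ed w) (ed z).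
    by apply/hT; exists w, z; split=> //; apply: giso_refl.
  exists P; split=> //; apply: spells_iso (ograph_iso injf im hE) _.
  exact/spells_ed.
- have /hT [w' [z' [hm /giso_ed_inj ew hi]]] := msot_rel_ograph hd; subst w'.
  by move/(spells_iso hi)/spells_ed: hs => ->.
Qed.

Section Enumeration.
Variables (X : Type) (k : nat) (f : 'I_k -> X).

Lemma onth_map_enum (i : 'I_k) : onth (map f (enum 'I_k)) i = Some (f i).
Proof. by rewrite [LHS]onth_map onth_enum_ord. Qed.

Lemma eq_map_enum s : size s = k -> (forall i : 'I_k, onth s i = Some (f i)) -> s = map f (enum 'I_k).
Proof.
move=> hs h; apply: eq_from_onth => i; case: (ltnP i k) => hi; last first.
  by rewrite onth_default ?hs // onth_default // size_map size_enum_ord.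
by rewrite -[i]/(val (Ordinal hi)) h onth_map_enum.
Qed.

End Enumeration.

Lemma size_mark (U : finType) o M (s : seq U) : size (mark o M s) = size s.
Proof. by elim: s o => //= u s IH o; rewrite IH. Qed.

(** * Marked words for the nodes and edges of the output graph *)

Section Languages.
Variables (A B : finType) (T : msot unit A unit B).
Notation W := {set 'I_(npar T)}.
Notation U := (option A * W)%type.
Notation C := (tC T).

Definition uword w (P : 'I_(npar T) -> {set 'I_(size w).+1}) : seq U :=
  [seq (onth w (val i), [set k | i \in P k]) | i <- enum 'I_(size w).+1].

Lemma uwordP w s : map fst s = letters w <-> exists P : 'I_(npar T) -> {set 'I_(size w).+1}, s = uword P.
Proof.
have e : letters w = [seq onth w (val i) | i <- enum 'I_(size w).+1].
  apply: eq_map_enum => [|i]; first by rewrite size_rcons size_map.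
  rewrite /letters -cats1 onth_cat size_map onth_map; case: ltnP => h.
    by have [a ->] := ltn_onth h.
  have -> : val i = size w by apply/eqP; rewrite eqn_leq h andbT -ltnS ltn_ord.
  by rewrite subnn /= onth_default.
rewrite e; split=> [hs|[P ->]]; last by rewrite -map_comp.
have /seq_ord_map [f ef] : size s = (size w).+1 by rewrite -(size_map fst) hs size_map size_enum_ord.
exists (fun k => [set i | k \in (f i).2]); rewrite ef; apply: eq_map => i.
have := congr1 (fun s => onth s i) hs; rewrite ef -map_comp !onth_map_enum /= => -[<-].
by rewrite [LHS]surjective_pairing; congr pair; apply/setP => k; rewrite !inE.
Qed.

Lemma mark_uword w (P : 'I_(npar T) -> {set 'I_(size w).+1}) M :
  mark 0 M (uword P) = [seq ((onth w (val i), [set k | i \in P k]), M (val i)) | i <- enum 'I_(size w).+1].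
Proof.
apply: eq_map_enum => [|i]; first by rewrite size_mark size_map size_enum_ord.
by rewrite onth_mark onth_map_enum.
Qed.

Definition marked_letter (z : U * (bool * bool)) : fletter_t A :=
  (z.1.1, fun x => if x == 0 then z.2.1 else if x == 1 then z.2.2 else false,
   fun X => if insub X is Some k then k \in z.1.2 else false).

Lemma formula_lang (f : mso unit A) : { L : seq (U * (bool * bool)) -> Prop & (recog L *
  forall w (P : 'I_(npar T) -> {set 'I_(size w).+1}) nu M,
    (forall i : 'I_(size w).+1, M (val i) = (nu 0 == Some i, nu 1 == Some i)) ->
    (forall x, 1 < x -> nu x = None) ->
    sat (g := ed w) nu (penv P) f <-> L (mark 0 M (uword P)))%type }.
Proof.
have [L r h] := formula_recog f; exists (fun s => L (map marked_letter s)); split; first exact: recog_map.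
move=> w P nu M hM hnu; have e : fenc nu (penv P) = map marked_letter (mark 0 M (uword P)); last by rewrite h e.
rewrite mark_uword -map_comp.
apply: eq_map => i; rewrite /marked_letter /= hM; congr (_, _, _); apply: functional_extensionality => x.
  by case: x => [|[|x]] //=; rewrite hnu.
by rewrite /penv; case: insub => [k|] /=; rewrite inE.
Qed.

Definition flang f := projT1 (formula_lang f).
Notation N c := (flang (tnode T c tt)).
Notation E e := (flang (tedge T e.1.1 e.1.2 e.2)).

Definition some_mark (K : seq (U * (bool * bool) * bool) -> Prop) s :=
  exists2 r : seq bool, size r = size s & (count id (unzip2 (zip s r)) == 1) /\ K (zip s r).

Definition only_new (z : U * (bool * bool) * bool) : U * (bool * bool) := (z.1.1, (z.2, false)).
Definition new_first (z : U * (bool * bool) * bool) : U * (bool * bool) := (z.1.1, (z.2, z.1.2.1)).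
Definition new_second (z : U * (bool * bool) * bool) : U * (bool * bool) := (z.1.1, (z.1.2.1, z.2)).
Definition only_second (z : U * (bool * bool)) : U * (bool * bool) := (z.1, (z.2.2, false)).

(* [None] is the domain; then come the start nodes, the end nodes and the edges. *)
Definition walk_lang (i : option ((C + C) + C * C * B)) (s : seq (U * (bool * bool))) : Prop :=
  match i with
  | None => flang (tdom T) s
  | Some (inl (inl c)) => N c s /\ ~ some_mark (fun t => exists cb : C * B,
      N cb.1 (map only_new t) /\ E (cb.1, c, cb.2) (map new_first t)) s
  | Some (inl (inr c)) => N c s /\ ~ some_mark (fun t => exists cb : C * B,
      N cb.1 (map only_new t) /\ E (c, cb.1, cb.2) (map new_second t)) s
  | Some (inr e) => N e.1.2 (map only_second s) /\ E e s
  end.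

Lemma recog_walk_lang i : recog (walk_lang i).
Proof.
have rf f : recog (flang f) by case: (projT2 (formula_lang f)).
have rs K : recog K -> recog (some_mark K).
  by move=> r; apply: recog_proj (recog_and (recog_map snd recog_count1) r).
case: i => [[[c|c]|e]|] /=; last exact: rf.
- apply: recog_and (rf _) (recog_not (rs _ (recog_exists _))) => cb.
  exact: recog_and (recog_map _ (rf _)) (recog_map _ (rf _)).
- apply: recog_and (rf _) (recog_not (rs _ (recog_exists _))) => cb.
  exact: recog_and (recog_map _ (rf _)) (recog_map _ (rf _)).
- exact: recog_and (recog_map _ (rf _)) (rf _).
Qed.

Section Semantics.
Variables (w : seq A) (P : 'I_(npar T) -> {set 'I_(size w).+1}).
Implicit Types (i j : 'I_(size w).+1) (c : C).

Lemma domain_langP : flang (tdom T) (mark 0 bare (uword P)) <-> sat (g := ed w) (fun=> None) (penv P) (tdom T).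
Proof.
case: (projT2 (formula_lang (tdom T))) => _ h; apply: iff_sym; exact: h.
Qed.

Lemma node_flangP i c : N c (mark 0 (mark1 i) (uword P)) <-> onode P (i, c).
Proof.
case: (projT2 (formula_lang (tnode T c tt))) => _ h; apply: iff_sym; apply: h => [j|x] /=.
  by rewrite /mark1 eq_sym.
by case: x => // x _.
Qed.

Lemma edge_flangP i j c c' b :
  E (c, c', b) (mark 0 (mark2 i j) (uword P)) <-> oedge P (i, c) b (j, c').
Proof.
case: (projT2 (formula_lang (tedge T c c' b))) => _ h; apply: iff_sym; apply: h => [k|x] /=.
  by rewrite /mark2 eq_sym [in X in (_, X)]eq_sym.
by case: x => [|[|x]].
Qed.

Lemma some_markP K M : some_mark K (mark 0 M (uword P)) <->
  exists j, K (zip (mark 0 M (uword P)) (map (fun i => i == j) (enum 'I_(size w).+1))).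
Proof.
have sz : size (mark 0 M (uword P)) = (size w).+1 by rewrite size_mark size_map size_enum_ord.
split=> [[r sr]|[j hj]].
  rewrite sz in sr; rewrite unzip2_zip; last by rewrite sr sz.
  case=> hc hK; have [f ef] := seq_ord_map sr; subst r.
  by case/count1_ord: hc => j ej; subst f; exists j.
exists (map (fun i => i == j) (enum 'I_(size w).+1)); first by rewrite size_map size_enum_ord sz.
rewrite unzip2_zip; last by rewrite sz size_map size_enum_ord.
split=> //.
by apply/count1_ord; exists j.
Qed.

Lemma map_mark (f : U * (bool * bool) * bool -> U * (bool * bool)) M j M' :
  (forall u i, f (u, M (val i), i == j) = (u, M' (val i))) ->
  map f (zip (mark 0 M (uword P)) (map (fun i => i == j) (enum 'I_(size w).+1))) = mark 0 M' (uword P).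
Proof. by move=> h; rewrite !mark_uword map_zip_enum -map_comp; apply: eq_map => i; apply: h. Qed.

Lemma only_secondP i j : map only_second (mark 0 (mark2 i j) (uword P)) = mark 0 (mark1 j) (uword P).
Proof. by rewrite !mark_uword -map_comp; apply: eq_map. Qed.

Lemma only_newP i j : map only_new (zip (mark 0 (mark1 i) (uword P))
  (map (fun i => i == j) (enum 'I_(size w).+1))) = mark 0 (mark1 j) (uword P).
Proof. exact: map_mark. Qed.

Lemma new_firstP i j : map new_first (zip (mark 0 (mark1 i) (uword P))
  (map (fun i => i == j) (enum 'I_(size w).+1))) = mark 0 (mark2 j i) (uword P).
Proof. exact: map_mark. Qed.

Lemma new_secondP i j : map new_second (zip (mark 0 (mark1 i) (uword P))
  (map (fun i => i == j) (enum 'I_(size w).+1))) = mark 0 (mark2 i j) (uword P).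
Proof. exact: map_mark. Qed.

Lemma start_langP i c : walk_lang (Some (inl (inl c))) (mark 0 (mark1 i) (uword P)) <->
  exists2 x : gV (ograph P), val x = (i, c) & forall b y, gE (ograph P) y b x = false.
Proof.
rewrite /= node_flangP some_markP; split.
- case=> hn hno; exists (exist _ (i, c) hn) => // b -[[j c'] hy] /=.
  apply/negP => he; apply: hno; exists j, (c', b).
  by rewrite only_newP new_firstP node_flangP edge_flangP.
- case=> -[[i' c'] hx] /= [? ?] hno; subst i' c'; split=> // -[j [[c' b]]] /=.
  rewrite only_newP new_firstP node_flangP edge_flangP => -[hn he].
  by have := hno b (exist _ (j, c') hn); rewrite /= he.
Qed.

Lemma end_langP i c : walk_lang (Some (inl (inr c))) (mark 0 (mark1 i) (uword P)) <->
  exists2 x : gV (ograph P), val x = (i, c) & forall b y, gE (ograph P) x b y = false.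
Proof.
rewrite /= node_flangP some_markP; split.
- case=> hn hno; exists (exist _ (i, c) hn) => // b -[[j c'] hy] /=.
  apply/negP => he; apply: hno; exists j, (c', b).
  by rewrite only_newP new_secondP node_flangP edge_flangP.
- case=> -[[i' c'] hx] /= [? ?] hno; subst i' c'; split=> // -[j [[c' b]]] /=.
  rewrite only_newP new_secondP node_flangP edge_flangP => -[hn he].
  by have := hno b (exist _ (j, c') hn); rewrite /= he.
Qed.

(** Only the target is tested for being a node: the source is a start node or the target of an
    earlier edge. *)
Lemma walk_edge_langP i j c c' b : walk_lang (Some (inr (c, c', b))) (mark 0 (mark2 i j) (uword P)) <->
  onode P (j, c') /\ oedge P (i, c) b (j, c').
Proof. by rewrite /= only_secondP node_flangP edge_flangP. Qed.

Variables (S : finType) (step : S -> U * (bool * bool) -> S) (s0 : S).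
Variable acc : option ((C + C) + C * C * B) -> pred S.
Hypothesis accP : forall k s, reflect (walk_lang k s) (acc k (foldl step s0 s)).

(** Nodes of [ograph P] form a subtype, while [rwalk] moves on plain positions and copies; the
    languages supply at each step the proof that the pair reached is a node. *)
Lemma spells_rwalk z : spells (ograph P) z <-> exists (i : nat) c, [/\ i < size (uword P),
  acc (Some (inl (inl c))) (foldl step s0 (mark 0 (mark1 i) (uword P))) &
  rwalk step s0 (fun c => acc (Some (inl (inr c)))) (fun e => acc (Some (inr e))) (uword P) i c z].
Proof.
have sz : size (uword P) = (size w).+1 by rewrite size_map size_enum_ord.
split.
- case=> -[[i c] hx] hs hw; exists i, c; split; first by rewrite sz ltn_ord.
    by apply/accP/start_langP; exists (exist _ (i, c) hx).
  suff key (x : gV (ograph P)) y : gwalk x y -> rwalk step s0 (fun c => acc (Some (inl (inr c))))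
    (fun e => acc (Some (inr e))) (uword P) (val (val x).1) (val x).2 y by apply: key hw.
  elim {z hs hw i c hx} => {x y} [[[i c] hx] hno|[[i c] hx] b [[j c'] hy] z he _ IH].
    by apply: rwalk_end; rewrite ?sz ?ltn_ord //; apply/accP/end_langP; exists (exist _ (i, c) hx).
  apply: rwalk_step IH; rewrite ?sz ?ltn_ord //.
  by apply/accP/walk_edge_langP.
case=> i [c [hi /accP hs hw]]; rewrite sz in hi.
have /start_langP [x ex hx] : walk_lang (Some (inl (inl c))) (mark 0 (mark1 (Ordinal hi)) (uword P)) by [].
exists x => //.
have {ex} : (val (val x).1, (val x).2) = (i, c) by rewrite ex.
elim: hw x {hx hs hi} => {i c z} [i c hi /accP hA|i c j c' b z hi hj /accP hA _ IH] [[i' c1] hx] [/= ei ec]; subst i c1.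
  have [[[i c'] hy] [/= ? ?] hno] := (end_langP _ _).1 hA; subst i c'.
  by apply: (@gwalk_end _ _ (ograph P)) => b y; rewrite -(hno b y).
rewrite sz in hj; have /walk_edge_langP [hy he] :
  walk_lang (Some (inr (c, c', b))) (mark 0 (mark2 i' (Ordinal hj)) (uword P)) by [].
by apply: (@gwalk_step _ _ (ograph P) _ b (exist _ (Ordinal hj, c') hy)) => //; apply: IH.
Qed.

End Semantics.

End Languages.

(** One product automaton evaluates the domain, start, end and edge languages. The annotator accepts
    a guess of the parameters by the domain language, and the walker uses the same annotation for
    the others. *)
Theorem NMSO_ed_NGSM2 (A B : finType) (m : seq A -> seq B -> Prop) : NMSO_ed m -> NGSMk 2 m.
Proof.
case=> T [_ hT]; have mE := NMSO_ed_ograph hT.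
have [S [s0 [step [acc accP]]]] := recog_family (@recog_walk_lang A B T).
pose M1 := rel_gsm (None : astate S) (Some None)
  (atr (A := A) (W := {set 'I_(npar T)}) step s0 (acc None)).
pose M2 := rel_gsm (None : wstate S (tC T) B) (Some None)
  (wtr (U := (option A * {set 'I_(npar T)})%type) step (fun c => acc (Some (inl (inl c))))
     (fun c => acc (Some (inl (inr c)))) (fun e => acc (Some (inr e)))).
apply: (NGSM_comp (M := M1) (NGSM_one (M := M2) (m := gsm_rel M2) (fun _ _ => iff_refl _))) => w z.
rewrite mE; split.
- case=> P [hd /(spells_rwalk P accP) hs]; exists (ann step s0 (uword P)); split.
    apply/rel_gsmP/annotatorP; exists (uword P); split=> //; first by apply/uwordP; exists P.
    by apply/accP/domain_langP.
  by apply/rel_gsmP/walkerP.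
- case=> y [/rel_gsmP/annotatorP [s [/uwordP [P ->] -> /accP/domain_langP hd]]] /rel_gsmP/walkerP hs.
  by exists P; split=> //; apply/(spells_rwalk P accP).
Qed.

(** For all parameters the output has at most [(size w).+1 * #|tC T|] nodes, and there are only
    finitely many words of bounded length over [B]. *)
Theorem NMSO_ed_finitary (A B : finType) (m : seq A -> seq B -> Prop) : NMSO_ed m -> finitary m.
Proof.
case=> T [_ hT] w; set n := (size w).+1 * #|tC T|.
exists (flatten [seq [seq val t | t : k.-tuple B] | k <- iota 0 n.+1]) => z hm.
have [P [_ [f [injf _ _ _]]]] : msot_rel T (ed w) (ed z).
  by apply/hT; exists w, z; split=> //; apply: giso_refl.
have := leq_card f injf; rewrite card_prod !card_ord => hz.
apply/flatten_mapP; exists (size z); first by rewrite mem_iota leq0n add0n ltnS; apply: ltnW.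
by apply/imageP; exists (in_tuple z).
Qed.

Theorem theorem6p10 (A B : finType) (m : seq A -> seq B -> Prop) :
  NMSO_ed m <-> ((exists k, 0 < k /\ NGSMk k m) /\ finitary m).
Proof.
split=> [h|[[k [_ hk]] hf]].
  by split; [exists 2; split=> //; apply: NMSO_ed_NGSM2 | apply: NMSO_ed_finitary].
by have [K hK] := NGSMk_implements hk; apply: implements_NMSO hK hf.
Qed.
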